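(* Let $S$ be a separable $\Bbbk$-algebra over a field $\Bbbk$ and let $A$ denote a strongly graded connected $S$-ring. There exists a bimodule of relations $R$ for $A$. If $P$ is an $S$-subbimodule of $T_A$ such that $R\subseteq R_P$, then $U(P)$ is a PBW-deformation of $A$ if and only if $\langle R\rangle=\langle R_P\rangle$, there exists a morphism of filtered $S$-bimodules $\alpha:R\to T_A$ such that $\alpha(R)\subseteq P\subseteq\langle\alpha(R)\rangle$, and either $c(A)=-1$ or $\alpha(R)$ satisfies the Jacobi conditions $(\mathcal J_n)$ for $1\le n\le c(A)$.
   Context: $S$-bimodules are left modules over $S^e=S\otimes_{\Bbbk}S^{op}$; $S$ is separable if it is projective as an $S^e$-module. $\otimes=\otimes_S$. A positively graded $S$-ring $A$ is connected if $A^0=S$ and strongly graded if $A^nA^m=A^{n+m}$. $T:=T_A:=T_S(A^1)$ is the tensor $S$-ring, $I_A$ the kernel of the canonical surjection $T_A\to A$. A bimodule of relations for $A$ is a graded $S$-subbimodule $R\subseteq I_A$ with $I_A=R\oplus(A^1I_A+I_AA^1)$ (it then generates $I_A$). $p^n:T\to T^n$ is the projection, $T^{\le n}=\bigoplus_{m\le n}T^m$, $X^{\le n}=X\cap T^{\le n}$, $\langle X\rangle$ the two-sided ideal generated by $X$. For an $S$-subbimodule $P\subseteq T$: $R_P:=\bigoplus_np^n(P^{\le n})$; $U(P):=T/\langle P\rangle$, filtered by the images of $T^{\le n}$. $U(P)$ is a PBW-deformation of $A=T/\langle R\rangle$ if the graded $S$-ring map $T/\langle R\rangle\to\operatorname{gr}U(P)$,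 $x+\langle R\rangle\mapsto(x+\langle P\rangle)+U(P)^{\le n-1}$ ($x\in T^n$), is an isomorphism. A morphism of filtered $S$-bimodules $\alpha:R\to T$ is an $S$-bimodule map with $\alpha(R^n)\subseteq T^{\le n}$, by convention always satisfying $p^n\alpha(r)=r$ for $r\in R^n$. For a subbimodule $Q\subseteq T$, $(\mathcal J_n)$ is the condition $Q_{n+1}\cap T^{\le n}\subseteq Q_n$, where $Q_n:=\sum_{i+j+k=n}T^{\le i}Q^{\le j}T^{\le k}$. The homological complexity $c(A)$ is $-1$ if $\operatorname{Tor}_3^A(S,S)=0$, and otherwise $\sup\{n-1\mid\operatorname{Tor}^A_{3,n}(S,S)\ne0\}$, with $n$ the internal degree (if $c(A)=\infty$ all $(\mathcal J_n)$, $n\ge1$, are required). *)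

(* Defs.v *)
From HB Require Import structures.
From mathcomp Require Import all_boot all_order all_algebra.
From mathcomp Require Import generic_quotient ring_quotient.
From mathcomp Require Import boolp classical_sets functions constructive_ereal.
From mathcomp.multinomials Require Import -(notations) monalg.

Set Implicit Arguments.
Unset Strict Implicit.
Unset Printing Implicit Defensive.

Import GRing.Theory.
Local Open Scope classical_set_scope.
Local Open Scope ring_scope.
Local Open Scope quotient_scope.

Section Additive.
Variable M : zmodType.
Implicit Types (X Y N : set M) (G : nat -> set M).

Definition subgroup N : Prop := N 0 /\ forall x y, N x -> N y -> N (x - y).

Definition zspan X : set M := smallest subgroup X.

Definition setadd X Y : set M :=
  [set z | exists2 x, X x & exists2 y, Y y & z = x + y].

Definition direct_sum_of G : Prop :=
  [/\ forall n, subgroup (G n),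
      forall x, exists n (c : nat -> M),
        (forall i, G i (c i)) /\ x = \sum_(i < n) c i
    & forall n (c : nat -> M), (forall i, G i (c i)) ->
        \sum_(i < n) c i = 0 -> forall i : 'I_n, c i = 0].

(* The degree-n component with respect to M = (+)_i G i; 0 where the
   decomposition fails to exist. *)
Definition hcomp G (n : nat) (x : M) : M :=
  xget 0 [set y | exists m (c : nat -> M),
    [/\ forall i, G i (c i), x = \sum_(i < m) c i
      & y = if (n < m)%N then c n else 0]].

(* The sum of the components of degree < n (not <= n). *)
Definition below G (n : nat) : set M :=
  [set x | exists c : nat -> M,
    (forall i, G i (c i)) /\ x = \sum_(i < n) c i].

Lemma subgroup_zspan X : subgroup (zspan X).
Proof.
split=> [N [[N0 _] _]|x y xX yX N NX]; first exact: N0.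
by case: (NX) => [[_ NB] _]; exact: NB (xX N NX) (yX N NX).
Qed.

Definition zspanp X : {pred M} := fun x => `[< zspan X x >].

Lemma zspanp_closed X : zmod_closed (zspanp X).
Proof.
have [s0 sB] := subgroup_zspan X.
split=> [|x y /asboolP xX /asboolP yX]; first exact/asboolP.
by apply/asboolP; apply: sB.
Qed.
HB.instance Definition _ X :=
  GRing.isZmodClosed.Build M (zspanp X) (zspanp_closed X).

(* The quotient by the subgroup generated by X. *)
Definition zquot X : Type := Quotient.quot (zspanp X).
HB.instance Definition _ X := GRing.Zmodule.on (zquot X).
Definition zpi X (x : M) : zquot X := \pi_(Quotient.quot (zspanp X)) x.

Lemma zpiP X x y : zpi X x = zpi X y <-> zspan X (x - y).
Proof.
rewrite /zpi; split=> [/eqP|xy]; first by rewrite -Quotient.idealrBE => /asboolP.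
by apply/eqP; rewrite -Quotient.idealrBE; apply/asboolP.
Qed.

Lemma zpi_repr X (q : zquot X) : zpi X (repr (q : Quotient.quot _)) = q.
Proof. exact: reprK. Qed.

Lemma zpiB X : {morph zpi X : x y / x - y}.
Proof.
by move=> x y; rewrite /zpi; exact: (raddfB (\pi_(Quotient.quot (zspanp X)))).
Qed.
HB.instance Definition _ X :=
  GRing.isZmodMorphism.Build M (zquot X) (zpi X) (@zpiB X).

Lemma zquot_lift_repr X (Z : zmodType) (f : {additive M -> Z}) :
  (forall x, X x -> f x = 0) ->
  forall x, f (repr (zpi X x : Quotient.quot _)) = f x.
Proof.
move=> fX x; apply/eqP; rewrite -subr_eq0 -raddfB; apply/eqP.
suff /(_ _) sub : zspan X `<=` [set y | f y = 0].
  by apply: sub; apply/zpiP; rewrite zpi_repr.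
apply: smallest_sub => //; split=> [|y z /= fy fz] /=; first exact: raddf0.
by rewrite raddfB fy fz subr0.
Qed.

End Additive.

Section Rings.
Variable B : pzRingType.
Implicit Types X Y : set B.

Definition setmul X Y : set B :=
  zspan [set z | exists2 x, X x & exists2 y, Y y & z = x * y].

Definition two_sided_ideal X : Prop :=
  subgroup X /\ forall a x, X x -> X (a * x) /\ X (x * a).

Definition ideal_gen X : set B := smallest two_sided_ideal X.

Lemma ideal_genP X : two_sided_ideal (ideal_gen X).
Proof.
split; first split.
- by move=> N [[[N0 _] _] _]; exact: N0.
- move=> x y xX yX N NX; case: (NX) => [[[_ NB] _] _].
  exact: NB (xX N NX) (yX N NX).
- by move=> a x xX; split=> N NX; have [[_ NM] _] := NX;
  case: (NM a x (xX N NX)).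
Qed.

Definition ideal_genp X : {pred B} := fun x => `[< ideal_gen X x >].

Lemma ideal_genp_closed X : zmod_closed (ideal_genp X).
Proof.
have [[s0 sB] _] := ideal_genP X.
split=> [|x y /asboolP xX /asboolP yX]; first exact/asboolP.
by apply/asboolP; apply: sB.
Qed.
HB.instance Definition _ X :=
  GRing.isZmodClosed.Build B (ideal_genp X) (ideal_genp_closed X).

(* The quotient ring by the two-sided ideal generated by X. *)
Definition rquot X : Type := Quotient.quot (ideal_genp X).
HB.instance Definition _ X := GRing.Zmodule.on (rquot X).
Definition rpi X (x : B) : rquot X := \pi_(Quotient.quot (ideal_genp X)) x.

Lemma rpiP X x y : rpi X x = rpi X y <-> ideal_gen X (x - y).
Proof.
rewrite /rpi; split=> [/eqP|xy]; first by rewrite -Quotient.idealrBE => /asboolP.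
by apply/eqP; rewrite -Quotient.idealrBE; apply/asboolP.
Qed.

Lemma rpi_repr X (q : rquot X) : rpi X (repr (q : Quotient.quot _)) = q.
Proof. exact: reprK. Qed.

Lemma rpiB X : {morph rpi X : x y / x - y}.
Proof.
by move=> x y; rewrite /rpi; exact: (raddfB (\pi_(Quotient.quot (ideal_genp X)))).
Qed.
HB.instance Definition _ X := GRing.isZmodMorphism.Build B (rquot X) (rpi X) (@rpiB X).

Definition rquot_mul X (p q : rquot X) : rquot X :=
  rpi X (repr (p : Quotient.quot _) * repr (q : Quotient.quot _)).

Lemma rquot_mulE X x y : rquot_mul (rpi X x) (rpi X y) = rpi X (x * y).
Proof.
have [[s0 sB] sM] := ideal_genP X.
have sD a b : ideal_gen X a -> ideal_gen X b -> ideal_gen X (a + b).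
  move=> aX bX; rewrite -[b]opprK -[- b]add0r.
  exact: (sB _ _ aX (sB _ _ s0 bX)).
apply/rpiP; set x' := repr _; set y' := repr _.
have xx : ideal_gen X (x' - x) by apply/rpiP; rewrite rpi_repr.
have yy : ideal_gen X (y' - y) by apply/rpiP; rewrite rpi_repr.
rewrite -(subrK (x * y') (x' * y')) -mulrBl -addrA -mulrBr.
by apply: sD; [case: (sM y' _ xx)|case: (sM x _ yy)].
Qed.

Lemma rquot_mulA X : associative (@rquot_mul X).
Proof.
by move=> x y z; rewrite -[x]rpi_repr -[y]rpi_repr -[z]rpi_repr !rquot_mulE mulrA.
Qed.

Lemma rquot_mul1l X : left_id (rpi X 1) (@rquot_mul X).
Proof. by move=> x; rewrite -[x]rpi_repr rquot_mulE mul1r. Qed.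

Lemma rquot_mul1r X : right_id (rpi X 1) (@rquot_mul X).
Proof. by move=> x; rewrite -[x]rpi_repr rquot_mulE mulr1. Qed.

Lemma rquot_mulDl X : left_distributive (@rquot_mul X) +%R.
Proof.
move=> x y z; rewrite -[x]rpi_repr -[y]rpi_repr -[z]rpi_repr.
by rewrite -raddfD !rquot_mulE -raddfD mulrDl.
Qed.

Lemma rquot_mulDr X : right_distributive (@rquot_mul X) +%R.
Proof.
move=> x y z; rewrite -[x]rpi_repr -[y]rpi_repr -[z]rpi_repr.
by rewrite -raddfD !rquot_mulE -raddfD mulrDr.
Qed.

HB.instance Definition _ X := GRing.Zmodule_isPzRing.Build (rquot X)
  (@rquot_mulA X) (@rquot_mul1l X) (@rquot_mul1r X)
  (@rquot_mulDl X) (@rquot_mulDr X).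

End Rings.

Section FreeAbelianGroup.
Variables (K : choiceType) (Z : zmodType) (F : K -> Z).

(* malg K int is the free abelian group on K; this is the homomorphism
   extending F. *)
Definition free_ext (g : malg K int) : Z :=
  \sum_(w <- finmap.enum_fset (msupp g)) F w *~ mcoeff w g.

Lemma free_extEw (d : finmap.finset_of (Phant K)) (g : malg K int) :
  finmap.fsubset (msupp g) d ->
  free_ext g = \sum_(w <- finmap.enum_fset d) F w *~ mcoeff w g.
Proof.
move=> gd; rewrite /free_ext [LHS](finmap.big_fset_incl _ gd) //.
by move=> w _ /mcoeff_outdom ->; rewrite mulr0z.
Qed.

Lemma free_extB : {morph free_ext : g h / g - h}.
Proof.
move=> g h; pose d := finmap.fsetU (msupp g) (msupp h).
rewrite !(@free_extEw d) ?finmap.fsubsetUl ?finmap.fsubsetUr //; last exact: msuppB_le.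
by rewrite -sumrB; apply: eq_bigr => w _; rewrite mcoeffB mulrzBr.
Qed.
HB.instance Definition _ :=
  GRing.isZmodMorphism.Build (malg K int) Z free_ext free_extB.

Lemma free_extU w : free_ext (mkmalgU w 1%R) = F w.
Proof.
by rewrite (@free_extEw (finmap.fset1 w)) ?msuppU_le // finmap.big_seq_fset1 mcoeffUU.
Qed.

Lemma free_ext_unique (f : {additive malg K int -> Z}) :
  (forall w, f (mkmalgU w 1%R) = F w) -> f =1 free_ext.
Proof.
move=> fF g; rewrite [in LHS](monalgE g) raddf_sum; apply: eq_bigr => w _.
have -> : mkmalgU w (mcoeff w g) = mkmalgU w 1 *~ mcoeff w g :> malg K int.
  by rewrite -raddfMz intz.
by rewrite raddfMz fF.
Qed.

End FreeAbelianGroup.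

(* An S-bimodule is a left module over S^e = S (x)_k S^op, i.e. an abelian
   group with commuting left and right S-actions on which the scalars of k
   act the same way from both sides. *)
HB.mixin Record isBimodule (k : fieldType) (S : algType k) M
    of GRing.Zmodule M := {
  lact : S -> M -> M;
  ract : M -> S -> M;
  lactDl : forall s t m, lact (s + t) m = lact s m + lact t m;
  lactDr : forall s m n, lact s (m + n) = lact s m + lact s n;
  lactA : forall s t m, lact (s * t) m = lact s (lact t m);
  lact1 : forall m, lact 1 m = m;
  ractDl : forall s m n, ract (m + n) s = ract m s + ract n s;
  ractDr : forall m s t, ract m (s + t) = ract m s + ract m t;
  ractA : forall m s t, ract m (s * t) = ract (ract m s) t;
  ract1 : forall m, ract m 1 = m;
  lractA : forall s m t, ract (lact s m) t = lact s (ract m t);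
  lract_scalar : forall (c : k) m, lact c%:A m = ract m c%:A
}.
#[short(type="bimodType")]
HB.structure Definition Bimodule (k : fieldType) (S : algType k) :=
  {M of isBimodule k S M & GRing.Zmodule M}.

Notation "s *> m" := (lact s m) (at level 40, left associativity) : ring_scope.
Notation "m <* s" := (ract m s) (at level 40, left associativity) : ring_scope.

(* An S-ring: an algebra in the monoidal category of S-bimodules.  Its unit
   S -> B is s |-> s *> 1 = 1 <* s. *)
HB.mixin Record Bimodule_isSRing (k : fieldType) (S : algType k) B
    of GRing.PzRing B & Bimodule k S B := {
  lactMl : forall s (a b : B), lact s (a * b) = lact s a * b;
  ractMr : forall (a b : B) s, ract (a * b) s = a * ract b s;
  ractMlact : forall (a b : B) s, ract a s * b = a * lact s b
}.
#[short(type="sringType")]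
HB.structure Definition SRing (k : fieldType) (S : algType k) :=
  {B of Bimodule_isSRing k S B & GRing.PzRing B & Bimodule k S B}.

Section Bimodules.
Variables (k : fieldType) (S : algType k).

Definition is_subbimod (M : bimodType S) (N : set M) : Prop :=
  [/\ subgroup N, forall s x, N x -> N (s *> x) & forall s x, N x -> N (x <* s)].

(* f is a homomorphism of S-bimodules on the subbimodule N of M *)
Definition bimod_hom_on (M M' : bimodType S) (N : set M) (f : M -> M') : Prop :=
  [/\ forall x y, N x -> N y -> f (x + y) = f x + f y,
      forall s x, N x -> f (s *> x) = s *> f x
    & forall s x, N x -> f (x <* s) = f x <* s].

Definition bimod_hom (M M' : bimodType S) (f : M -> M') : Prop :=
  bimod_hom_on setT f.

Definition projective_bimod (M : bimodType S) : Prop :=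
  forall (E E' : bimodType S) (f : E -> E') (g : M -> E'),
    bimod_hom f -> bimod_hom g -> (forall y, exists x, f x = y) ->
    exists2 h : M -> E, bimod_hom h & forall x, f (h x) = g x.

Definition regular_bimod : Type := S.
HB.instance Definition _ := GRing.Zmodule.on regular_bimod.

Lemma regular_lractA (s m t : S) : s * m * t = s * (m * t).
Proof. by rewrite mulrA. Qed.
Lemma regular_scalar (c : k) (m : S) : c%:A * m = m * c%:A.
Proof. by rewrite mulr_algl mulr_algr. Qed.
HB.instance Definition _ := isBimodule.Build k S regular_bimod
  (fun s t m : S => mulrDl s t m) (fun s m n : S => mulrDr s m n)
  (fun s t m : S => esym (mulrA s t m)) (fun m : S => mul1r m)
  (fun s m n : S => mulrDl m n s) (fun m s t : S => mulrDr m s t)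
  (fun m s t : S => mulrA m s t) (fun m : S => mulr1 m)
  regular_lractA regular_scalar.

(* S is projective as an S^e-module *)
Definition separable : Prop := projective_bimod regular_bimod.

Section SubBimodule.
Variables (M : bimodType S) (N : set M) (hN : is_subbimod N).

Definition subbimodp of is_subbimod N : {pred M} := fun x => `[< N x >].

Lemma subbimodp_closed : zmod_closed (subbimodp hN).
Proof.
have [[N0 NB] _ _] := hN.
split=> [|x y /asboolP Nx /asboolP Ny]; first exact/asboolP.
by apply/asboolP; apply: NB.
Qed.
HB.instance Definition _ :=
  GRing.isZmodClosed.Build M (subbimodp hN) subbimodp_closed.

Definition subbimod : Type := {x : M | subbimodp hN x}.
HB.instance Definition _ := [isSub of subbimod for @sval M (subbimodp hN)].
HB.instance Definition _ := [Choice of subbimod by <:].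
HB.instance Definition _ := [SubChoice_isSubZmodule of subbimod by <:].

Lemma subbimod_lact_subproof s (x : subbimod) : subbimodp hN (s *> val x).
Proof. by have [_ Nl _] := hN; apply/asboolP/Nl/asboolP/(valP x). Qed.
Lemma subbimod_ract_subproof (x : subbimod) s : subbimodp hN (val x <* s).
Proof. by have [_ _ Nr] := hN; apply/asboolP/Nr/asboolP/(valP x). Qed.

Definition subbimod_lact s (x : subbimod) : subbimod :=
  exist _ (s *> val x) (subbimod_lact_subproof s x).
Definition subbimod_ract (x : subbimod) s : subbimod :=
  exist _ (val x <* s) (subbimod_ract_subproof x s).

Fact subbimod_axioms : isBimodule k S subbimod.
Proof.
apply: (isBimodule.Build k S subbimod (lact := subbimod_lact)
  (ract := subbimod_ract)) => *; apply: val_inj => /=.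
- exact: lactDl.
- exact: lactDr.
- exact: lactA.
- exact: lact1.
- exact: ractDl.
- exact: ractDr.
- exact: ractA.
- exact: ract1.
- exact: lractA.
- exact: lract_scalar.
Defined.
HB.instance Definition _ := subbimod_axioms.

End SubBimodule.
End Bimodules.

Section TensorRing.
Variables (k : fieldType) (S : algType k) (V : bimodType S).

(* Z<S + V>, the free ring on the letters [s], s in S, and [v], v in V *)
Definition free_ring : Type := malg (fmonom (S + V)%type) int.
HB.instance Definition _ := GRing.NzRing.on free_ring.
Definition letter (a : S + V) : free_ring := mkmalgU (fmu a) 1%R.
Local Notation "[@ s ]" := (letter (inl s)) (at level 0).
Local Notation "[# v ]" := (letter (inr v)) (at level 0).

Inductive tensor_rel : set free_ring :=
| trel_D s t : tensor_rel ([@ s + t] - ([@ s] + [@ t]))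
| trel_M s t : tensor_rel ([@ s * t] - [@ s] * [@ t])
| trel_1 : tensor_rel ([@ 1] - 1)
| trel_VD v w : tensor_rel ([# v + w] - ([# v] + [# w]))
| trel_l s v : tensor_rel ([# s *> v] - [@ s] * [# v])
| trel_r v s : tensor_rel ([# v <* s] - [# v] * [@ s]).

(* T_S(V), presented by generators and relations *)
Definition tensor_ring : Type := rquot tensor_rel.
HB.instance Definition _ := GRing.PzRing.on tensor_ring.
Definition tensor_S (s : S) : tensor_ring := rpi tensor_rel [@ s].
Definition tensor_V (v : V) : tensor_ring := rpi tensor_rel [# v].

Lemma rpiM (B : pzRingType) (X : set B) : {morph rpi X : x y / x * y}.
Proof. by move=> x y; rewrite -rquot_mulE. Qed.

Lemma rpi_rel (B : pzRingType) (X : set B) x y : X (x - y) -> rpi X x = rpi X y.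
Proof. by move=> Xxy; apply/rpiP; exact: (sub_gen_smallest Xxy). Qed.

Lemma tensor_SD : {morph tensor_S : s t / s + t}.
Proof. by move=> s t; rewrite /tensor_S -raddfD; apply: rpi_rel; apply: trel_D. Qed.
Lemma tensor_SM : {morph tensor_S : s t / s * t}.
Proof. by move=> s t; rewrite /tensor_S -rpiM; apply: rpi_rel; apply: trel_M. Qed.
Lemma tensor_S1 : tensor_S 1 = 1.
Proof. by apply: rpi_rel; apply: trel_1. Qed.
Lemma tensor_VD : {morph tensor_V : v w / v + w}.
Proof. by move=> v w; rewrite /tensor_V -raddfD; apply: rpi_rel; apply: trel_VD. Qed.
Lemma tensor_Vl s v : tensor_V (s *> v) = tensor_S s * tensor_V v.
Proof. by rewrite /tensor_V /tensor_S -rpiM; apply: rpi_rel; apply: trel_l. Qed.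
Lemma tensor_Vr v s : tensor_V (v <* s) = tensor_V v * tensor_S s.
Proof. by rewrite /tensor_V /tensor_S -rpiM; apply: rpi_rel; apply: trel_r. Qed.

Lemma tensor_ring_ind (P : tensor_ring -> Prop) :
  (forall s, P (tensor_S s)) -> (forall v, P (tensor_V v)) ->
  (forall x y, P x -> P y -> P (x - y)) ->
  (forall x y, P x -> P y -> P (x * y)) -> forall x, P x.
Proof.
move=> PS PV PB PM.
have P1 : P 1 by rewrite -tensor_S1.
have P0 : P 0 by rewrite -(subrr (1 : tensor_ring)); apply: PB.
have PN x : P x -> P (- x) by rewrite -[- x]sub0r; apply: PB.
have PD x y : P x -> P y -> P (x + y).
  by move=> Px Py; rewrite -[y]opprK; apply: PB => //; apply: PN.
move=> x; rewrite -[x]rpi_repr; move: (repr _) => {x} g; rewrite [g]monalgE.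
rewrite raddf_sum; elim/big_ind: _ => // w _; move: (mcoeff w g) => c.
have -> : mkmalgU w c = mkmalgU w 1 *~ c :> malg _ int.
  by rewrite -raddfMz intz.
rewrite raddfMz; have {}Pw : P (rpi tensor_rel (mkmalgU w 1)).
  case: w => s; elim: s => [|a s IHs].
    by rewrite -fmoneE -[fmone _]/(mone) -[mkmalgU _ _]/(1 : free_ring) (_ : rpi _ _ = 1).
  have -> : mkmalgU (FMonom (a :: s)) 1 = letter a * mkmalgU (FMonom s) 1 :> free_ring.
    rewrite /letter -[RHS]/(fgmul _ _) fgmulUU mulr1; congr mkmalgU.
    by apply/eqP; rewrite fmP /= fmM fmU.
  by rewrite rpiM; apply: PM; [case: a => ?; [exact: PS|exact: PV]|exact: IHs].
case: c => n; rewrite ?NegzE ?mulrNz; last apply: PN; rewrite -pmulrn.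
  by elim: n => [|n IHn]; rewrite ?mulr0n // mulrS; apply: PD.
by elim: n.+1 => [|m IHm]; rewrite ?mulr0n // mulrS; apply: PD.
Qed.

Lemma tensor_scalar (c : k) x : tensor_S c%:A * x = x * tensor_S c%:A.
Proof.
elim/tensor_ring_ind: x => [s|v|x y Hx Hy|x y Hx Hy].
- by rewrite -!tensor_SM mulr_algl mulr_algr.
- by rewrite -tensor_Vl -tensor_Vr lract_scalar.
- by rewrite mulrBr mulrBl Hx Hy.
- rewrite mulrA Hx -[LHS]mulrA Hy; exact: mulrA.
Qed.

Definition tensor_lact s (x : tensor_ring) := tensor_S s * x.
Definition tensor_ract (x : tensor_ring) s := x * tensor_S s.

Fact tensor_bimod_axioms : isBimodule k S tensor_ring.
Proof.
apply: (isBimodule.Build k S tensor_ring (lact := tensor_lact)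
  (ract := tensor_ract)); rewrite /tensor_lact /tensor_ract => *.
- by rewrite tensor_SD mulrDl.
- by rewrite mulrDr.
- by rewrite tensor_SM mulrA.
- by rewrite tensor_S1 mul1r.
- by rewrite mulrDl.
- by rewrite tensor_SD mulrDr.
- by rewrite tensor_SM mulrA.
- by rewrite tensor_S1 mulr1.
- by rewrite mulrA.
- exact: tensor_scalar.
Defined.
HB.instance Definition _ := tensor_bimod_axioms.

Fact tensor_sring_axioms : Bimodule_isSRing k S tensor_ring.
Proof.
apply: (Bimodule_isSRing.Build k S tensor_ring) => a b c.
- exact: mulrA.
- exact: (esym (mulrA a b (tensor_S c))).
- exact: (esym (mulrA a (tensor_S c) b)).
Defined.
HB.instance Definition _ := tensor_sring_axioms.

(* The image of V^{(x) n}: T^0 is the image of S and T^{n+1} = T^n V. *)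
Fixpoint tensor_deg (n : nat) : set tensor_ring :=
  if n is n'.+1 then setmul (tensor_deg n') (range tensor_V)
  else range tensor_S.

(* The S-ring homomorphism T_S(V) -> B extending a bimodule homomorphism
   f : V -> B *)
Section Lift.
Variables (B : sringType S) (f : V -> B).

Definition letter_val (a : S + V) : B :=
  match a with inl s => s *> 1 | inr v => f v end.
Definition word_val (w : fmonom (S + V)%type) : B :=
  \prod_(a <- fmonom_val w) letter_val a.
Definition tensor_lift (x : tensor_ring) : B :=
  free_ext word_val (repr (x : Quotient.quot (ideal_genp tensor_rel))).

Lemma word_ext1 : free_ext word_val 1 = 1.
Proof.
have -> : 1 = mkmalgU (mone : fmonom (S + V)%type) 1%R :> free_ring by [].
by rewrite free_extU /word_val fm1 big_nil.
Qed.

Lemma word_ext_letter a : free_ext word_val (letter a) = letter_val a.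
Proof. by rewrite /letter free_extU /word_val fmU big_seq1. Qed.

Lemma word_extM (g h : free_ring) :
  free_ext word_val (g * h) = free_ext word_val g * free_ext word_val h.
Proof.
have scale c (w : fmonom (S + V)%type) :
    mkmalgU w c = mkmalgU w 1 *~ c :> malg (fmonom (S + V)%type) int.
  by rewrite -raddfMz intz.
rewrite malgM_def fgmull raddf_sum [in RHS](monalgE g) [in RHS]raddf_sum mulr_suml.
apply: eq_bigr => w _; rewrite raddf_sum [in RHS](monalgE h) [in RHS]raddf_sum.
rewrite mulr_sumr; apply: eq_bigr => w' _.
rewrite scale [in RHS]scale [X in _ * free_ext _ X]scale.
rewrite !raddfMz /= !free_extU mulrzAl mulrzAr -mulrzA [mcoeff w' h * _]mulrC.
by rewrite /word_val fmM big_cat.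
Qed.

Lemma tensor_lift_rpi : bimod_hom_on setT f -> forall g : free_ring,
  tensor_lift (rpi tensor_rel g) = free_ext word_val g.
Proof.
move=> [fD fl fr] g; rewrite /tensor_lift; apply/eqP.
rewrite -subr_eq0 -raddfB; apply/eqP.
set P : set free_ring := [set h | free_ext word_val h = 0].
suff sub : ideal_gen tensor_rel `<=` P.
  by apply: sub; apply/rpiP; rewrite rpi_repr.
apply: smallest_sub.
  split; first split=> [|x y Px Py]; first exact: raddf0.
    by rewrite /P /= raddfB /= Px Py subr0.
  by move=> a x Px; rewrite /P /= !word_extM Px mulr0 mul0r.
move=> _ [s t|s t||v w|s v|v s]; rewrite /P /=.
- by rewrite raddfB raddfD /= !word_ext_letter /= lactDl subrr.
- by rewrite raddfB /= word_extM !word_ext_letter /= -lactMl mul1r lactA subrr.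
- by rewrite raddfB /= word_ext1 word_ext_letter /= lact1 subrr.
- by rewrite raddfB raddfD /= !word_ext_letter /= fD ?subrr.
- by rewrite raddfB /= word_extM !word_ext_letter /= fl // -lactMl mul1r subrr.
- by rewrite raddfB /= word_extM !word_ext_letter /= fr // -ractMlact mulr1 subrr.
Qed.

Hypothesis fhom : bimod_hom_on setT f.

Lemma tensor_liftS s : tensor_lift (tensor_S s) = s *> 1.
Proof. by rewrite tensor_lift_rpi // word_ext_letter. Qed.
Lemma tensor_liftV v : tensor_lift (tensor_V v) = f v.
Proof. by rewrite tensor_lift_rpi // word_ext_letter. Qed.
Lemma tensor_liftB : {morph tensor_lift : x y / x - y}.
Proof.
move=> x y; rewrite -[x]rpi_repr -[y]rpi_repr -raddfB.
by rewrite !tensor_lift_rpi // raddfB.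
Qed.
Lemma tensor_liftM : {morph tensor_lift : x y / x * y}.
Proof.
move=> x y; rewrite -[x]rpi_repr -[y]rpi_repr -rpiM.
by rewrite !tensor_lift_rpi // word_extM.
Qed.

End Lift.

End TensorRing.

Section Graded.
Variables (k : fieldType) (S : algType k).

Definition is_grading (B : sringType S) (G : nat -> set B) : Prop :=
  [/\ direct_sum_of G, forall n, is_subbimod (G n), G 0%N 1
    & forall m n x y, G m x -> G n y -> G (m + n)%N (x * y)].

(* Connected: the unit of the S-ring identifies S with the part of degree 0. *)
Record conn_sring := ConnSRing {
  conn_sort :> sringType S;
  deg : nat -> set conn_sort;
  deg_grading : is_grading deg;
  deg_connected : set_bij setT (deg 0%N) (fun s : S => s *> 1)
}.

Variable A : conn_sring.

Definition strongly_graded : Prop :=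
  forall m n, setmul (@deg A m) (@deg A n) = @deg A (m + n)%N.

Lemma deg_subbimod n : is_subbimod (@deg A n).
Proof. by case: (deg_grading A). Qed.

(* The projection A -> A^0 = S, through which S is an A-module on both sides. *)
Definition augmentation (a : A) : S :=
  xget 0 [set s : S | s *> 1 = hcomp (@deg A) 0 a].

Record graded_module := GradedModule {
  gmod_sort :> lmodType A;
  gdeg : nat -> set gmod_sort;
  gdeg_sum : direct_sum_of gdeg;
  gdeg_scale : forall m n (a : A) x,
    @deg A m a -> gdeg n x -> gdeg (m + n)%N (a *: x)
}.

Definition projective_module (X : lmodType A) : Prop :=
  forall (E E' : lmodType A) (f : {linear E -> E'}) (g : {linear X -> E'}),
    (forall y, exists x, f x = y) ->
    exists h : {linear X -> E}, forall x, f (h x) = g x.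

(* A graded projective resolution of the left A-module S (in degree 0):
     ... -> res 1 -> res 0 -> S -> 0 *)
Record graded_resolution := GradedResolution {
  res :> nat -> graded_module;
  res_d : forall i, {linear res i.+1 -> res i};
  res_e : res 0%N -> S;
  res_projective : forall i, projective_module (res i);
  res_d_deg : forall i n x, @gdeg (res i.+1) n x -> @gdeg (res i) n (res_d i x);
  res_e_additive : forall x y, res_e (x + y) = res_e x + res_e y;
  res_e_scale : forall (a : A) x, res_e (a *: x) = augmentation a * res_e x;
  res_e_deg : forall n x, @gdeg (res 0%N) n.+1 x -> res_e x = 0;
  res_e_surj : forall s, exists x, res_e x = s;
  res_exact0 : forall x, res_e x = 0 <-> exists y, res_d 0 y = x;
  res_exact : forall i x, res_d i x = 0 <-> exists y, res_d i.+1 y = x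
}.

(* S (x)_A X, for the right A-module structure s . a = s * augmentation a on
   S: the quotient of the free abelian group on S x X by the usual relations. *)
Section TensorS.
Variable X : lmodType A.

Definition free_pairs : zmodType := malg (S * X)%type int.
Definition pair_gen (s : S) (x : X) : free_pairs := mkmalgU (s, x) 1%R.

Inductive Stensor_rel : set free_pairs :=
| strel_l s t x :
    Stensor_rel (pair_gen (s + t) x - (pair_gen s x + pair_gen t x))
| strel_r s x y :
    Stensor_rel (pair_gen s (x + y) - (pair_gen s x + pair_gen s y))
| strel_m s a x :
    Stensor_rel (pair_gen (s * augmentation a) x - pair_gen s (a *: x)).

Definition Stensor : zmodType := zquot Stensor_rel.
Definition pure (s : S) (x : X) : Stensor := zpi Stensor_rel (pair_gen s x).

End TensorS.

(* 1 (x) d *)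
Definition Stensor_map (X Y : lmodType A) (d : {linear X -> Y})
    (z : Stensor X) : Stensor Y :=
  free_ext (fun p => pure p.1 (d p.2))
    (repr (z : Quotient.quot (zspanp (@Stensor_rel X)))).

Lemma pureDl (X : lmodType A) s t (x : X) :
  pure (s + t) x = pure s x + pure t x.
Proof.
rewrite /pure -raddfD; apply/zpiP.
exact: (sub_gen_smallest (strel_l _ _ _)).
Qed.

Lemma pureDr (X : lmodType A) s (x y : X) :
  pure s (x + y) = pure s x + pure s y.
Proof.
rewrite /pure -raddfD; apply/zpiP.
exact: (sub_gen_smallest (strel_r _ _ _)).
Qed.

Lemma pureM (X : lmodType A) s a (x : X) :
  pure (s * augmentation a) x = pure s (a *: x).
Proof. by apply/zpiP; exact: (sub_gen_smallest (strel_m _ _ _)). Qed.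

Lemma Stensor_map_pure (X Y : lmodType A) (d : {linear X -> Y}) s x :
  Stensor_map d (pure s x) = pure s (d x).
Proof.
have gen t y : free_ext (fun p => pure p.1 (d p.2)) (pair_gen t y) = pure t (d y).
  by rewrite /pair_gen free_extU.
rewrite /Stensor_map [in LHS]/pure zquot_lift_repr /= ?gen // => _ [] *.
- by rewrite raddfB raddfD /= !gen pureDl subrr.
- by rewrite raddfB raddfD /= !gen linearD pureDr subrr.
- by rewrite raddfB /= !gen linearZ /= pureM subrr.
Qed.

Definition Stensor_deg (X : graded_module) (n : nat) : set (Stensor X) :=
  zspan [set z | exists s x, @gdeg X n x /\ z = pure s x].

Section Tor.
Variable X : graded_resolution.

Definition cycles (i : nat) : set (Stensor (X i)) :=
  match i return set (Stensor (X i)) with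
  | 0 => setT
  | j.+1 => [set z | Stensor_map (res_d X j) z = 0]
  end.

Definition boundaries (i : nat) : set (Stensor (X i)) :=
  range (Stensor_map (res_d X i)).

(* Tor_i^A(S,S) = cycles / boundaries and its part of internal degree n, as
   subgroups of (S (x)_A X_i) / boundaries *)
Definition Tor (i : nat) : set (zquot (@boundaries i)) :=
  zpi (@boundaries i) @` @cycles i.
Definition Tor_deg (i n : nat) : set (zquot (@boundaries i)) :=
  zpi (@boundaries i) @` (@cycles i `&` @Stensor_deg (X i) n).
End Tor.

(* All resolutions compute the same Tor, so it is immaterial whether vanishing
   is required for one of them or for all. *)
Definition Tor_eq0 (i : nat) : Prop :=
  forall X : graded_resolution, @Tor X i = [set 0].
Definition Tor_deg_eq0 (i n : nat) : Prop :=
  forall X : graded_resolution, @Tor_deg X i n = [set 0].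

(* The homological complexity c(A), with values in Z extended by +oo *)
Definition complexity : \bar int :=
  if `[< Tor_eq0 3 >] then (-1)%:E
  else supremum -oo%E
    [set ((Posz n - 1)%:E : \bar int) | n in [set n | ~ Tor_deg_eq0 3 n]].

(* The tensor S-ring T = T_S(A^1) *)
Definition gen_bimod : bimodType S := subbimod (deg_subbimod 1).
Definition T : sringType S := tensor_ring gen_bimod.
Definition Tdeg : nat -> set T := @tensor_deg k S gen_bimod.
Definition Tproj (n : nat) (x : T) : T := hcomp Tdeg n x.
(* T^{<= n} *)
Definition Tle (n : nat) : set T := below Tdeg n.+1.

Definition can_surj (x : T) : A := tensor_lift (fun v : gen_bimod => val v) x.
Definition I_ : set T := [set x | can_surj x = 0].

Definition bimodule_of_relations (R : set T) : Prop :=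
  [/\ is_subbimod R,
      forall n x, R x -> R (Tproj n x),
      R `<=` I_,
      I_ = setadd R (setadd (setmul (Tdeg 1) I_) (setmul I_ (Tdeg 1)))
    & R `&` setadd (setmul (Tdeg 1) I_) (setmul I_ (Tdeg 1)) = [set 0]].

(* R_P; the sum of the subgroups p^n(P^{<= n}) is direct *)
Definition R_ (P : set T) : set T :=
  zspan (\bigcup_n (Tproj n @` (P `&` Tle n))).

Definition U (P : set T) : pzRingType := rquot P.

(* The image of T^{< n} in U(P); U(P)^{<= n} is Ult P n.+1. *)
Definition Ult (P : set T) (n : nat) : set (U P) := rpi P @` below Tdeg n.

(* gr^n U(P) = U(P)^{<= n} / U(P)^{<= n-1}, inside U(P) / U(P)^{<= n-1} *)
Definition gr (P : set T) (n : nat) : set (zquot (@Ult P n)) :=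
  zpi (@Ult P n) @` @Ult P n.+1.

(* phi n is the degree-n part of the map
   T/<R> -> gr U(P), x + <R> |-> (x + <P>) + U(P)^{<= n-1} for x in T^n. *)
Definition PBW_deformation (R P : set T) : Prop :=
  exists phi : forall n, rquot R -> zquot (@Ult P n),
    forall n,
      (forall x, Tdeg n x -> phi n (rpi R x) = zpi (@Ult P n) (rpi P x)) /\
      set_bij (rpi R @` Tdeg n) (@gr P n) (phi n).

(* A morphism of filtered bimodules R -> T; only the values on R matter. *)
Definition filtered_morphism (R : set T) (alpha : T -> T) : Prop :=
  bimod_hom_on R alpha /\
  forall n r, R r -> Tdeg n r -> Tle n (alpha r) /\ Tproj n (alpha r) = r.

(* Q_n = sum_{i+j+l=n} T^{<=i} Q^{<=j} T^{<=l} *)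
Definition filt_ideal (Q : set T) (n : nat) : set T :=
  zspan [set z | exists i j l x q y,
    [/\ (i + j + l = n)%N, Tle i x, (Q `&` Tle j) q, Tle l y & z = x * q * y]].

Definition Jacobi (Q : set T) (n : nat) : Prop :=
  filt_ideal Q n.+1 `&` Tle n `<=` filt_ideal Q n.

End Graded.

(* Main.v *)
(* Write T = T_S(V) with V = A^1, let I be the kernel of T -> A, and let F_n be
   the subspaces Q_n of the Jacobi conditions for Q = alpha(R). U(P) is a
   PBW-deformation iff I = <R> is the space of leading forms of <P>.

   If it is, splitting the bimodule maps P^(<= n) -> p^n(P^(<= n)), which
   separability allows, gives alpha; cancelling leading forms then shows that
   <P> meets T^(<= n) in F_n, whence all (J_n). Conversely, all (J_n) together
   give that <Q> = <P> meets T^(<= n) in F_n, whose leading forms lie in I.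

   It remains to deduce (J_(n+1)) from (J_n) when Tor_(3,n+2) = 0. Modulo
   F_(n+1), an element of F_(n+2) of lower degree is a + b with a in V F_(n+1)
   and b in F_(n+1) V, and the leading forms of a and b are opposite elements of
   T_+ I and I T_+. By Govorov's formula
     Tor_3 = (T_+ I n I T_+) / (I^2 + T_+ I T_+)
   they lift to V F_(n+1) and F_(n+1) V compatibly, and the rest is the
   injectivity of V (x) I -> T and I (x) V -> T. The formula comes from the
   resolution of S with terms I^n / I^(n+1) and I^n T_+ / I^(n+1) T_+, which are
   projective because ideals of T are projective T-modules. *)
Require Import Defs.
From HB Require Import structures.
From mathcomp Require Import all_boot all_order all_algebra.
From mathcomp Require Import generic_quotient ring_quotient.
From mathcomp Require Import boolp classical_sets functions constructive_ereal.
From mathcomp Require Import zify.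
From mathcomp.multinomials Require Import -(notations) monalg.

Set Implicit Arguments.
Unset Strict Implicit.
Unset Printing Implicit Defensive.

Import Order.TTheory GRing.Theory.
Local Open Scope classical_set_scope.
Local Open Scope ring_scope.
(** * Subgroups and direct sums *)

(** The tensor ring is given by generators and relations, so no freeness is visible in it. It is
    extracted by letting the ring act on auxiliary groups: a prescription on letters that respects
    the relations is an action, and the orbit of one well-chosen element yields the homogeneous
    components, the derivations behind projectivity, and the injectivity of V (x) T -> T and T (x) V
    -> T.

    A choice of lifts can be multiplied into such a tensor product only if it is balanced over [S].
    Separability supplies bimodule maps by averaging, twice, a [k]-linear projection obtained from
    Zorn's lemma.

    The vanishing of Tor is required for all resolutions, and the proof only draws conclusions from
    vanishing; so it suffices to evaluate Tor on Govorov's resolution, and resolutions are never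
    compared.

    Since A^0 = S and A^1 = V, the ideal I begins in degree 2. Hence (J_0) is automatic and starts
    the induction, and the shift by one in c(A) matches (J_(n+1)) with Tor_(3,n+2). *)

Lemma subrACA (M : zmodType) (x y z t : M) : x - y - (z - t) = x - z - (y - t).
Proof. by rewrite !opprB [t - z]addrC [t - y]addrC addrACA. Qed.

Section SubtractionMorphisms.
Variables (M M' : zmodType) (f : M -> M').
Hypothesis fB : {morph f : x y / x - y}.

Lemma morphB0 : f 0 = 0. Proof. by have := fB 0 0; rewrite !subrr. Qed.
Lemma morphBN : {morph f : x / - x}.
Proof. by move=> x; rewrite -sub0r fB morphB0 sub0r. Qed.
Lemma morphBD : {morph f : x y / x + y}.
Proof. by move=> x y; rewrite -{1}[y]opprK fB morphBN opprK. Qed.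
Lemma morphB_sum (J : Type) (r : seq J) (F : J -> M) :
  f (\sum_(j <- r) F j) = \sum_(j <- r) f (F j).
Proof. exact: (big_morph _ morphBD morphB0). Qed.

End SubtractionMorphisms.

Lemma morphDB (M M' : zmodType) (f : M -> M') :
  {morph f : x y / x + y} -> {morph f : x y / x - y}.
Proof. by move=> fD x y; apply: (addIr (f y)); rewrite -fD !subrK. Qed.

Section Subgroups.
Variable M : zmodType.
Implicit Types (X Y N : set M).

Section Closure.
Variables (N : set M) (hN : subgroup N).

Lemma subgroup0 : N 0. Proof. by case: hN. Qed.
Lemma subgroupB x y : N x -> N y -> N (x - y). Proof. by case: hN => _; apply. Qed.
Lemma subgroupN x : N x -> N (- x).
Proof. by move=> Nx; rewrite -sub0r; apply: subgroupB => //; exact: subgroup0. Qed.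
Lemma subgroupD x y : N x -> N y -> N (x + y).
Proof. by move=> Nx Ny; rewrite -[y]opprK; apply/subgroupB/subgroupN. Qed.
Lemma subgroup_sum (J : Type) (r : seq J) (F : J -> M) :
  (forall j, N (F j)) -> N (\sum_(j <- r) F j).
Proof. by move=> NF; elim/big_ind: _ => //; [exact: subgroup0|exact: subgroupD]. Qed.

End Closure.

Lemma sub_zspan X : X `<=` zspan X.
Proof. exact: sub_gen_smallest. Qed.

Lemma zspan_sub X N : subgroup N -> X `<=` N -> zspan X `<=` N.
Proof. exact: smallest_sub. Qed.

Lemma zspan_id N : subgroup N -> zspan N = N.
Proof.
move=> hN; apply/seteqP; split; [exact: zspan_sub|exact: sub_zspan].
Qed.

Lemma subgroup_setI X Y : subgroup X -> subgroup Y -> subgroup (X `&` Y).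
Proof.
move=> [X0 XB] [Y0 YB]; split=> // x y [Xx Yx] [Xy Yy].
by split; [exact: XB|exact: YB].
Qed.

Lemma subgroup_setadd X Y : subgroup X -> subgroup Y -> subgroup (setadd X Y).
Proof.
move=> hX hY; split=> [|_ _ [x Xx [y Yy ->]] [x' Xx' [y' Yy' ->]]].
  by exists 0; [exact: subgroup0|exists 0; [exact: subgroup0|rewrite addr0]].
exists (x - x'); first exact: subgroupB.
by exists (y - y'); [exact: subgroupB|rewrite opprD addrACA].
Qed.

End Subgroups.

Section DirectSums.
Variables (M : zmodType) (G : nat -> set M).
Hypothesis hG : direct_sum_of G.
Implicit Types (x y : M) (m n : nat) (c d : nat -> M).

Lemma direct_sum_subgroup n : subgroup (G n). Proof. by case: hG. Qed.
Let sG := direct_sum_subgroup.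

Lemma sum_widen m n c : (m <= n)%N ->
  \sum_(i < m) c i = \sum_(i < n) (if (i < m)%N then c i else 0).
Proof. by move=> mn; rewrite (big_ord_widen _ c mn) big_mkcond. Qed.

Lemma direct_sum_unique m n c d :
  (forall i, G i (c i)) -> (forall i, G i (d i)) ->
  \sum_(i < m) c i = \sum_(i < n) d i ->
  forall i, (if (i < m)%N then c i else 0) = if (i < n)%N then d i else 0.
Proof.
move=> Gc Gd ecd i.
have [_ _ Gu] := hG; pose N := (m + n).+1.
(* [N + i] exceeds [i] and the lengths of both sums, so padding by zeros turns both into sums over
   one range that contains [i]. *)
have Ni : (i < N + i)%N by lia.
pose b j := (if (j < m)%N then c j else 0) - (if (j < n)%N then d j else 0).
have Gb j : G j (b j).
  by apply: (subgroupB (sG _)); case: ifP => _ //; exact: (subgroup0 (sG _)).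
apply/eqP; rewrite -subr_eq0; apply/eqP.
rewrite -[LHS]/(b (Ordinal Ni)); apply: (Gu (N + i)%N b Gb); rewrite sumrB.
by rewrite -!sum_widen ?ecd ?subrr // /N; lia.
Qed.

Lemma hcompE m c x n : (forall i, G i (c i)) -> x = \sum_(i < m) c i ->
  hcomp G n x = if (n < m)%N then c n else 0.
Proof.
move=> Gc ->; apply: xget_subset1; first by exists m, c.
move=> _ _ [m1 [c1 [G1 e1 ->]]] [m2 [c2 [G2 e2 ->]]].
by apply: direct_sum_unique => //; rewrite -e1.
Qed.

Lemma direct_sumP x : exists2 m, x = \sum_(i < m) hcomp G i x &
  forall i, (m <= i)%N -> hcomp G i x = 0.
Proof.
have [_ /(_ x)[m [c [Gc ec]]] _] := hG; exists m; last first.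
  by move=> i mi; rewrite (hcompE _ Gc ec) ltnNge mi.
by rewrite [LHS]ec; apply: eq_bigr => i _; rewrite (hcompE _ Gc ec) ltn_ord.
Qed.

Lemma hcomp_in n x : G n (hcomp G n x).
Proof.
have [_ /(_ x)[m [c [Gc ec]]] _] := hG; rewrite (hcompE _ Gc ec).
by case: ifP => _ //; exact: (subgroup0 (sG _)).
Qed.

Lemma hcomp_id m n x : G m x -> hcomp G n x = if n == m then x else 0.
Proof.
move=> Gx; pose c i := if i == m then x else 0.
have Gc i : G i (c i).
  by rewrite /c; case: eqP => [->|_] //; exact: (subgroup0 (sG _)).
have ec : x = \sum_(i < m.+1) c i.
  rewrite big_ord_recr /= big1 ?add0r /c ?eqxx // => i _.
  by rewrite ltn_eqF.
rewrite (hcompE _ Gc ec) /c ltnS; case: eqP => [->|_]; first by rewrite leqnn.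
by case: ifP.
Qed.

Lemma hcomp_same n x : G n x -> hcomp G n x = x.
Proof. by move=> Gx; rewrite (hcomp_id _ Gx) eqxx. Qed.

Lemma hcompK m n x : hcomp G m (hcomp G n x) = if m == n then hcomp G n x else 0.
Proof. exact: (hcomp_id _ (hcomp_in _ _)). Qed.

Lemma hcompB n : {morph hcomp G n : x y / x - y}.
Proof.
move=> x y; have [p ex px] := direct_sumP x; have [q ey qy] := direct_sumP y.
have ext r z a : (a <= r)%N -> z = \sum_(i < a) hcomp G i z ->
    (forall i, (a <= i)%N -> hcomp G i z = 0) -> z = \sum_(i < r) hcomp G i z.
  move=> ar ez z0; rewrite [LHS]ez (big_ord_widen _ (fun i => hcomp G i z) ar).
  rewrite big_mkcond; apply: eq_bigr => i _; case: ltnP => // /z0 -> //.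
have := ext (maxn n.+1 (maxn p q)) x p _ ex px.
have := ext (maxn n.+1 (maxn p q)) y q _ ey qy.
have pr : (p <= maxn n.+1 (maxn p q))%N by lia.
have qr : (q <= maxn n.+1 (maxn p q))%N by lia.
have nr : (n < maxn n.+1 (maxn p q))%N by lia.
move: (maxn _ _) pr qr nr => r pr qr nr /(_ qr) eyr /(_ pr) exr.
have Gc i : G i (hcomp G i x - hcomp G i y).
  by apply: (subgroupB (sG _)); exact: hcomp_in.
by rewrite (hcompE (m := r) n Gc) ?nr // sumrB -exr -eyr.
Qed.

Lemma hcomp0 n : hcomp G n 0 = 0.
Proof. by have := hcompB n 0 0; rewrite !subrr. Qed.
Lemma hcompN n : {morph hcomp G n : x / - x}.
Proof. by move=> x; rewrite -[- x]sub0r hcompB hcomp0 sub0r. Qed.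
Lemma hcompD n : {morph hcomp G n : x y / x + y}.
Proof. by move=> x y; rewrite -{1}[y]opprK hcompB hcompN opprK. Qed.
Lemma hcomp_sum n (J : Type) (r : seq J) (F : J -> M) :
  hcomp G n (\sum_(j <- r) F j) = \sum_(j <- r) hcomp G n (F j).
Proof. exact: (big_morph _ (hcompD n) (hcomp0 n)). Qed.

(** The reduction to homogeneous elements used throughout: a property closed under subtraction is
    written as a set [N], and only the components of [x] remain to be checked. *)
Lemma graded_ind (N : set M) x : subgroup N -> (forall n, N (hcomp G n x)) -> N x.
Proof.
by move=> hN Nx; have [m -> _] := direct_sumP x; apply: subgroup_sum.
Qed.

Lemma hcomp_inj x y : (forall n, hcomp G n x = hcomp G n y) -> x = y.
Proof.
move=> exy; apply/eqP; rewrite -subr_eq0; apply/eqP.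
by apply: (@graded_ind [set 0]) => [|n] /=; [split=> //= ? ? -> ->|];
  rewrite ?subrr // hcompB exy subrr.
Qed.

Lemma belowP n x : below G n x <-> forall i, (n <= i)%N -> hcomp G i x = 0.
Proof.
split=> [[c [Gc ec]] i ni|x0]; first by rewrite (hcompE _ Gc ec) ltnNge ni.
exists (fun i => hcomp G i x); split=> [i|]; first exact: hcomp_in.
apply: hcomp_inj => j; rewrite hcomp_sum.
case: (ltnP j n) => [jn|nj].
  rewrite (bigD1 (Ordinal jn)) //= big1 ?hcompK ?eqxx ?addr0 // => i.
  by rewrite hcompK -val_eqE /= eq_sym; case: eqP.
rewrite x0 // big1 // => i _; rewrite hcompK.
by case: eqP => // ji; move: (ltn_ord i); rewrite -ji ltnNge nj.
Qed.

Lemma subgroup_below n : subgroup (below G n).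
Proof.
split=> [|x y /belowP x0 /belowP y0]; apply/belowP => i ni; first exact: hcomp0.
by rewrite hcompB x0 ?y0 ?subrr.
Qed.

Lemma below_hom m n x : (m < n)%N -> G m x -> below G n x.
Proof.
move=> mn Gx; apply/belowP => i ni; rewrite (hcomp_id _ Gx).
by case: eqP => // im; move: mn; rewrite -im ltnNge ni.
Qed.

Lemma below_le m n : (m <= n)%N -> below G m `<=` below G n.
Proof.
by move=> mn x /belowP x0; apply/belowP => i ni; apply: x0; exact: leq_trans ni.
Qed.

Lemma below_ex x : exists n, below G n x.
Proof. by have [m _ x0] := direct_sumP x; exists m; apply/belowP. Qed.

Lemma below_top n x : below G n.+1 x -> below G n (x - hcomp G n x).
Proof.
move=> /belowP x0; apply/belowP => i; rewrite hcompB hcompK leq_eqVlt.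
by case: eqP => [->|/eqP ni /= /x0 ->]; rewrite ?eqxx ?subrr // eq_sym (negPf ni) subr0.
Qed.

Lemma below_sum n x : below G n x -> x = \sum_(i < n) hcomp G i x.
Proof.
move=> [c [Gc ec]]; rewrite {1}ec; apply: eq_bigr => i _.
by rewrite (hcompE _ Gc ec) ltn_ord.
Qed.

End DirectSums.

Section Ideals.
Variable B : pzRingType.
Implicit Types (X Y N : set B).

Lemma subgroup_setmul X Y : subgroup (setmul X Y).
Proof. exact: subgroup_zspan. Qed.

Lemma setmul_mem X Y x y : X x -> Y y -> setmul X Y (x * y).
Proof. by move=> Xx Yy; apply: sub_zspan; exists x => //; exists y. Qed.

Lemma setmul_sub X Y N : subgroup N ->
  (forall x y, X x -> Y y -> N (x * y)) -> setmul X Y `<=` N.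
Proof. by move=> hN XYN; apply: zspan_sub => // _ [x Xx [y Yy ->]]; exact: XYN. Qed.

Lemma setmulS X X' Y Y' : X `<=` X' -> Y `<=` Y' -> setmul X Y `<=` setmul X' Y'.
Proof.
move=> XX YY; apply: setmul_sub => [|x y /XX ? /YY ?]; first exact: subgroup_setmul.
exact: setmul_mem.
Qed.

Lemma sub_ideal_gen X : X `<=` ideal_gen X.
Proof. exact: sub_gen_smallest. Qed.

Lemma ideal_gen_sub X N : two_sided_ideal N -> X `<=` N -> ideal_gen X `<=` N.
Proof. exact: smallest_sub. Qed.

Lemma subgroup_ideal_gen X : subgroup (ideal_gen X).
Proof. by case: (ideal_genP X). Qed.

Lemma ideal_genMl X a x : ideal_gen X x -> ideal_gen X (a * x).
Proof. by case: (ideal_genP X) => _ /(_ a x) h /h[]. Qed.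

Lemma ideal_genMr X a x : ideal_gen X x -> ideal_gen X (x * a).
Proof. by case: (ideal_genP X) => _ /(_ a x) h /h[]. Qed.

End Ideals.

(** * Actions and derivations of the tensor ring *)

Section EndomorphismRing.
Variable M : zmodType.

Definition endop : {pred M -> M} := fun f => `[< {morph f : x y / x - y} >].

Lemma endop_closed : zmod_closed endop.
Proof.
split=> [|f g /asboolP fB /asboolP gB]; apply/asboolP => x y.
  by rewrite /= /GRing.zero /= subrr.
by rewrite !fctE /= fB gB !opprD !opprK addrACA.
Qed.
HB.instance Definition _ := GRing.isZmodClosed.Build (M -> M) endop endop_closed.

(** A ring homomorphism from the tensor ring to this ring is a left action on [M]; one to the
    opposite ring is a right action. *)
Definition endo : Type := {f : M -> M | endop f}.
HB.instance Definition _ := [isSub of endo for @sval (M -> M) endop].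
HB.instance Definition _ := [Choice of endo by <:].
HB.instance Definition _ := [SubChoice_isSubZmodule of endo by <:].

Definition mkEndo (f : M -> M) (fB : {morph f : x y / x - y}) : endo :=
  exist _ f (asboolT fB).

Lemma endoB (f : endo) : {morph val f : x y / x - y}.
Proof. exact/asboolP/(valP f). Qed.

Definition endo_mul (f g : endo) : endo :=
  mkEndo (fun x y => etrans (congr1 (val f) (endoB g x y)) (endoB f _ _)).
Definition endo1 : endo := mkEndo (fun x y : M => erefl (x - y)).

Fact endo_ring_axioms : GRing.Zmodule_isPzRing endo.
Proof.
apply: (GRing.Zmodule_isPzRing.Build endo (one := endo1) (mul := endo_mul)).
- by move=> f g h; apply: val_inj.
- by move=> f; apply: val_inj.
- by move=> f; apply: val_inj.
- by move=> f g h; apply: val_inj.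
- by move=> f g h; apply/val_inj/funext => x; exact: (morphBD (endoB f)).
Defined.
HB.instance Definition _ := endo_ring_axioms.

End EndomorphismRing.

Section TensorMaps.
Variables (k : fieldType) (S : algType k) (V : bimodType S).
Local Notation T := (tensor_ring V).

Lemma free_ring_lift (B : pzRingType) (lv : S + V -> B) :
  exists E : free_ring V -> B, [/\ {morph E : x y / x - y},
    {morph E : x y / x * y}, E 1 = 1 & forall a, E (letter a) = lv a].
Proof.
pose wv (w : fmonom (S + V)%type) : B := \prod_(a <- fmonom_val w) lv a.
have scale c (w : fmonom (S + V)%type) :
    mkmalgU w c = mkmalgU w 1 *~ c :> malg (fmonom (S + V)%type) int.
  by rewrite -raddfMz intz.
exists (free_ext wv); split=> [x y|g h||a].
- exact: raddfB.
- rewrite malgM_def fgmull raddf_sum [in RHS](monalgE g) [in RHS]raddf_sum mulr_suml.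
  apply: eq_bigr => w _; rewrite raddf_sum [in RHS](monalgE h) [in RHS]raddf_sum.
  rewrite mulr_sumr; apply: eq_bigr => w' _.
  rewrite scale [in RHS]scale [X in _ * free_ext _ X]scale.
  rewrite !raddfMz /= !free_extU mulrzAl mulrzAr -mulrzA [mcoeff w' h * _]mulrC.
  by rewrite /wv fmM big_cat.
- have -> : 1 = mkmalgU (mone : fmonom (S + V)%type) 1%R :> free_ring V by [].
  by rewrite free_extU /wv fm1 big_nil.
- by rewrite /letter free_extU /wv fmU big_seq1.
Qed.

(** In contrast to [tensor_lift], the target is any ring with a ring homomorphism from [S]. The
    scalars of [k] need not become central, as they do not in the endomorphism ring of an abelian
    group. *)
Lemma tensor_ring_lift (B : pzRingType) (fS : S -> B) (fV : V -> B) :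
  {morph fS : s t / s + t} -> {morph fS : s t / s * t} -> fS 1 = 1 ->
  {morph fV : v w / v + w} -> (forall s v, fV (s *> v) = fS s * fV v) ->
  (forall v s, fV (v <* s) = fV v * fS s) ->
  exists F : T -> B, [/\ {morph F : x y / x - y}, {morph F : x y / x * y},
    forall s, F (tensor_S V s) = fS s & forall v, F (tensor_V v) = fV v].
Proof.
move=> fSD fSM fS1 fVD fVl fVr.
have [E [EB EM E1 EL]] :=
  free_ring_lift (fun a => match a with inl s => fS s | inr v => fV v end).
have E0 := morphB0 EB; have ED := morphBD EB.
have ker g : ideal_gen (@tensor_rel _ _ V) g -> E g = 0.
  move: g; apply: ideal_gen_sub.
    split; first split=> [|x y /= x0 y0] //; first by rewrite EB x0 y0 subr0.
    move=> a x x0; split; rewrite /=.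
      by rewrite (EM a x) [E x]x0 mulr0.
    by rewrite (EM x a) [E x]x0 mul0r.
  have EBl g h : E g = E h -> E (g - h) = 0 by move=> e; rewrite (EB g h) e subrr.
  move=> _ [s t|s t||v w|s v|v s]; apply: EBl.
  - by rewrite (ED (letter _) (letter _)) !EL fSD.
  - by rewrite (EM (letter _) (letter _)) !EL fSM.
  - by rewrite E1 EL fS1.
  - by rewrite (ED (letter _) (letter _)) !EL fVD.
  - by rewrite (EM (letter _) (letter _)) !EL fVl.
  - by rewrite (EM (letter _) (letter _)) !EL fVr.
pose F (x : T) : B :=
  E (repr (x : Quotient.quot (ideal_genp (@tensor_rel _ _ V)))).
have Fpi g : F (rpi (@tensor_rel _ _ V) g) = E g.
  by apply/eqP; rewrite -subr_eq0 -EB; apply/eqP/ker/rpiP; rewrite rpi_repr.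
exists F; split=> [x y|x y|s|v].
- by rewrite -[x]rpi_repr -[y]rpi_repr -raddfB !Fpi EB.
- by rewrite -[x]rpi_repr -[y]rpi_repr -rpiM !Fpi EM.
- by rewrite /tensor_S Fpi EL.
- by rewrite /tensor_V Fpi EL.
Qed.

Section Actions.
Variables (M : zmodType) (aS : S -> M -> M) (aV : V -> M -> M).
Hypotheses (aSB : forall s, {morph aS s : x y / x - y})
  (aVB : forall v, {morph aV v : x y / x - y})
  (aSD : forall s t x, aS (s + t) x = aS s x + aS t x)
  (aVD : forall v w x, aV (v + w) x = aV v x + aV w x)
  (aS1 : forall x, aS 1 x = x).

Lemma tensor_left_action :
  (forall s t x, aS (s * t) x = aS s (aS t x)) ->
  (forall s v x, aV (s *> v) x = aS s (aV v x)) ->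
  (forall v s x, aV (v <* s) x = aV v (aS s x)) ->
  exists act : T -> M -> M,
  [/\ forall a, {morph act a : x y / x - y},
      forall a b x, act (a - b) x = act a x - act b x,
      forall a b x, act (a * b) x = act a (act b x),
      forall s x, act (tensor_S V s) x = aS s x
    & forall v x, act (tensor_V v) x = aV v x].
Proof.
move=> aSM aVl aVr.
case: (@tensor_ring_lift (endo M) (fun s => mkEndo (aSB s)) (fun v => mkEndo (aVB v))).
1-6: by [] || (move=> *; apply: val_inj; apply/funext => x /=; rewrite ?fctE; auto).
move=> F [FB FM FS FV]; exists (fun a => val (F a)); split=> [a|a b x|a b x|s x|v x].
- exact: endoB.
- by rewrite FB.
- by rewrite FM.
- by rewrite FS.
- by rewrite FV.
Qed.

Lemma tensor_right_action :
  (forall s t x, aS (s * t) x = aS t (aS s x)) ->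
  (forall s v x, aV (s *> v) x = aV v (aS s x)) ->
  (forall v s x, aV (v <* s) x = aS s (aV v x)) ->
  exists act : T -> M -> M,
  [/\ forall a, {morph act a : x y / x - y},
      forall a b x, act (a - b) x = act a x - act b x,
      forall a b x, act (a * b) x = act b (act a x),
      forall s x, act (tensor_S V s) x = aS s x
    & forall v x, act (tensor_V v) x = aV v x].
Proof.
move=> aSM aVl aVr.
case: (@tensor_ring_lift (endo M)^c (fun s => mkEndo (aSB s)) (fun v => mkEndo (aVB v))).
1-6: by [] || (move=> *; apply: val_inj; apply/funext => x /=; rewrite ?fctE; auto).
move=> F [FB FM FS FV].
exists (fun a => val (F a : endo M)); split=> [a|a b x|a b x|s x|v x].
- exact: endoB.
- by rewrite FB.
- by rewrite FM.
- by rewrite FS.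
- by rewrite FV.
Qed.

End Actions.

(* T acts on M (+) T with v sending (m, x) to (v m + delta v x, v x), and the
   derivation is the first component of the orbit of (0, 1). *)
Lemma tensor_left_derivation (M : zmodType) (act : T -> M -> M)
    (delta : V -> T -> M) :
  (forall a, {morph act a : x y / x - y}) ->
  (forall a b x, act (a - b) x = act a x - act b x) ->
  (forall a b x, act (a * b) x = act a (act b x)) ->
  (forall x, act 1 x = x) ->
  (forall v, {morph delta v : x y / x - y}) ->
  (forall v w x, delta (v + w) x = delta v x + delta w x) ->
  (forall s v x, delta (s *> v) x = act (tensor_S V s) (delta v x)) ->
  (forall v s x, delta (v <* s) x = delta v (s *> x)) ->
  exists gam : T -> M,
  [/\ {morph gam : x y / x - y}, gam 1 = 0,
      forall s x, gam (s *> x) = act (tensor_S V s) (gam x)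
    & forall v x, gam (tensor_V v * x) = act (tensor_V v) (gam x) + delta v x].
Proof.
move=> actB actBl actM act1 dB dD dl dr.
have actD a : {morph act a : x y / x + y} by exact: morphBD (actB a).
have actDl a b x : act (a + b) x = act a x + act b x.
  exact: (morphBD (fun a b => actBl a b x)).
pose aS s (p : M * T) : M * T := (act (tensor_S V s) p.1, s *> p.2).
pose aV v (p : M * T) : M * T :=
  (act (tensor_V v) p.1 + delta v p.2, tensor_V v * p.2).
case: (@tensor_left_action (M * T)%type aS aV).
- by move=> s [x a] [y b]; apply: (f_equal2 pair); [exact: actB|exact: mulrBr].
- move=> v [x a] [y b]; apply: (f_equal2 pair); last exact: mulrBr.
  by rewrite /= actB dB opprD addrACA.
- move=> s t [x a]; apply: (f_equal2 pair); last exact: lactDl.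
  by rewrite /= tensor_SD actDl.
- move=> v w [x a]; apply: (f_equal2 pair); rewrite /= tensor_VD; last exact: mulrDl.
  by rewrite actDl dD addrACA.
- by move=> [x a]; apply: (f_equal2 pair); [rewrite /= tensor_S1 act1|exact: lact1].
- by move=> s t [x a]; apply: (f_equal2 pair); [rewrite /= tensor_SM actM|exact: lactA].
- move=> s v [x a]; apply: (f_equal2 pair); rewrite /= tensor_Vl; last exact: esym (mulrA _ _ _).
  by rewrite actM actD dl.
- move=> v s [x a]; apply: (f_equal2 pair); rewrite /= tensor_Vr; last exact: esym (mulrA _ _ _).
  by rewrite actM dr.
move=> F [FB FBl FM FS FV]; pose gam x := (F x (0, 1)).1.
have F2 x p : (F x p).2 = x * p.2.
  elim/tensor_ring_ind: x p => [s|v|x y ex ey|x y ex ey] p.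
  - by rewrite FS.
  - by rewrite FV.
  - by rewrite FBl mulrBl -ex -ey.
  - by rewrite FM ex ey; exact: mulrA.
exists gam; split=> [x y||s x|v x]; rewrite /gam.
- by rewrite FBl.
- by rewrite -(tensor_S1 V) FS; exact: morphB0 (actB _).
- by rewrite -[s *> x]/(_ * _) FM FS.
- by rewrite FM FV [in LHS]/= F2 [in LHS]/= mulr1.
Qed.

(** This is the injectivity of T (x) V -> T: a balanced map on T x V factors through the product. A
    letter acts from the right on pairs by discarding the first component and recomputing it from
    the second, so that in the orbit of (0, 1) only the last letter counts. *)
Lemma tensor_right_extension (delta : T -> V -> T) :
  (forall v, {morph delta^~ v : x y / x - y}) ->
  (forall x v w, delta x (v + w) = delta x v + delta x w) ->
  (forall x v s, delta x (v <* s) = delta x v <* s) ->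
  (forall x s v, delta x (s *> v) = delta (x <* s) v) ->
  exists2 gam : T -> T, {morph gam : x y / x - y}
    & forall x v, gam (x * tensor_V v) = delta x v.
Proof.
move=> dB dD dr dl.
pose aS s (p : T * T) : T * T := (p.1 <* s, p.2 <* s).
pose aV v (p : T * T) : T * T := (delta p.2 v, p.2 * tensor_V v).
case: (@tensor_right_action (T * T)%type aS aV).
- by move=> s [x a] [y b]; apply: (f_equal2 pair); exact: mulrBl.
- by move=> v [x a] [y b]; apply: (f_equal2 pair); [exact: dB|exact: mulrBl].
- by move=> s t [x a]; apply: (f_equal2 pair); exact: ractDr.
- by move=> v w [x a]; apply: (f_equal2 pair); [exact: dD|rewrite /= tensor_VD mulrDr].
- by move=> [x a]; apply: (f_equal2 pair); exact: ract1.
- by move=> s t [x a]; apply: (f_equal2 pair); exact: ractA.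
- move=> s v [x a]; apply: (f_equal2 pair); [exact: dl|rewrite /= tensor_Vl; exact: mulrA].
- move=> v s [x a]; apply: (f_equal2 pair); [exact: dr|rewrite /= tensor_Vr; exact: mulrA].
move=> F [FB FBl FM FS FV]; pose gam x := (F x (0, 1)).1.
have F2 x p : (F x p).2 = p.2 * x.
  elim/tensor_ring_ind: x p => [s|v|x y ex ey|x y ex ey] p.
  - by rewrite FS.
  - by rewrite FV.
  - by rewrite FBl mulrBr -ex -ey.
  - by rewrite FM ey ex; exact: esym (mulrA _ _ _).
exists gam => [x y|x v]; rewrite /gam; first by rewrite FBl.
by rewrite FM FV /= F2 mul1r.
Qed.

End TensorMaps.

(** * The grading of the tensor ring *)

Section TensorGrading.
Variables (k : fieldType) (S : algType k) (V : bimodType S).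
Local Notation T := (tensor_ring V).
Local Notation G := (@tensor_deg k S V).
Implicit Types (x y : T) (m n : nat).

Lemma tensor_SB : {morph tensor_S V : s t / s - t}.
Proof. exact: morphDB (@tensor_SD _ _ V). Qed.
Lemma tensor_VB : {morph @tensor_V _ _ V : v w / v - w}.
Proof. exact: morphDB (@tensor_VD _ _ V). Qed.

Lemma subgroup_tensor_deg n : subgroup (G n).
Proof.
case: n => [|n]; last exact: subgroup_setmul.
split=> [|_ _ [s _ <-] [t _ <-]]; last by exists (s - t); rewrite ?tensor_SB.
by exists 0; rewrite ?(morphB0 tensor_SB).
Qed.

Lemma tensor_degMS n x s : G n x -> G n (x * tensor_S V s).
Proof.
case: n => [[t _ <-]|n]; first by exists (t * s); rewrite ?tensor_SM.
suff sub : G n.+1 `<=` [set x | G n.+1 (x * tensor_S V s)] by exact: sub.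
apply: setmul_sub => [|a _ Ga [v _ <-]].
  split=> [|a b /= Ga Gb] /=; first by rewrite mul0r; apply: subgroup0 (subgroup_setmul _ _).
  by rewrite mulrBl; exact: (subgroupB (subgroup_tensor_deg n.+1) Ga Gb).
rewrite /= -mulrA -tensor_Vr; apply: setmul_mem; first exact: Ga.
by exists (v <* s).
Qed.

Lemma tensor_degM m n x y : G m x -> G n y -> G (m + n)%N (x * y).
Proof.
move=> Gx; elim: n y => [|n IHn] y; first by rewrite addn0 => -[s _ <-]; exact: tensor_degMS.
rewrite addnS; suff sub : G n.+1 `<=` [set y | G (m + n).+1 (x * y)] by exact: sub.
apply: setmul_sub => [|a _ Ga [v _ <-]].
  split=> [|a b /= Ga Gb] /=; first by rewrite mulr0; apply: subgroup0 (subgroup_setmul _ _).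
  by rewrite mulrBr; exact: (subgroupB (subgroup_tensor_deg (m + n).+1) Ga Gb).
by rewrite /= mulrA; apply: setmul_mem; [exact: IHn|exists v].
Qed.

Lemma tensor_degS s : G 0%N (tensor_S V s). Proof. by exists s. Qed.
Lemma tensor_deg1 : G 0%N 1. Proof. by rewrite -tensor_S1; exact: tensor_degS. Qed.

Lemma tensor_degV v : G 1%N (tensor_V v).
Proof. by rewrite -[tensor_V v]mul1r; apply: setmul_mem; [exact: tensor_deg1|exists v]. Qed.

Lemma tensor_deg1E : G 1%N = range (@tensor_V k S V).
Proof.
apply/seteqP; split=> [|_ [v _ <-]]; last exact: tensor_degV.
apply: setmul_sub => [|_ _ [s _ <-] [v _ <-]]; last by exists (s *> v); rewrite ?tensor_Vl.
split=> [|_ _ [v _ <-] [w _ <-]]; last by exists (v - w); rewrite ?tensor_VB.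
by exists 0; rewrite ?(morphB0 tensor_VB).
Qed.

Lemma tensor_degSE n : G n.+1 = setmul (G n) (G 1%N).
Proof. by rewrite tensor_deg1E. Qed.

Lemma tensor_degSl n : G n.+1 = setmul (G 1%N) (G n).
Proof.
apply/seteqP; split; last first.
  by apply: setmul_sub => [|x y Gx Gy]; [exact: subgroup_tensor_deg|exact: (@tensor_degM 1 n)].
elim: n => [|n IHn]; apply: setmul_sub; try exact: subgroup_setmul.
  move=> _ _ [s _ <-] [v _ <-]; rewrite -tensor_Vl -[tensor_V _]mulr1.
  by apply: setmul_mem; [exact: tensor_degV|exact: tensor_deg1].
move=> x _ Gx [v _ <-].
suff sub : G n.+1 `<=` [set x | setmul (G 1%N) (G n.+1) (x * tensor_V v)] by exact: sub.
apply: subset_trans IHn _; apply: setmul_sub => [|a b Ga Gb].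
  split=> [|a b /= Ga Gb] /=; first by rewrite mul0r; apply: subgroup0 (subgroup_setmul _ _).
  by rewrite mulrBl; exact: (subgroupB (subgroup_setmul _ _) Ga Gb).
rewrite /= -mulrA; apply: setmul_mem; first exact: Ga.
by apply: setmul_mem; [exact: Gb|exists v].
Qed.

Lemma is_subbimod_tensor_deg n : is_subbimod (G n).
Proof.
split=> [|s x Gx|s x Gx]; first exact: subgroup_tensor_deg.
  exact: (tensor_degM (tensor_degS s) Gx).
exact: tensor_degMS.
Qed.

Lemma tensor_deg_gen x : exists m (c : nat -> T),
  (forall i, G i (c i)) /\ x = \sum_(i < m) c i.
Proof.
have hom i y : G i y -> exists m (c : nat -> T),
    (forall i, G i (c i)) /\ y = \sum_(i < m) c i.
  move=> Gy; exists i.+1, (fun j => if j == i then y else 0); split=> [j|].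
    by case: eqP => [->|_] //; exact: (subgroup0 (subgroup_tensor_deg j)).
  rewrite big_ord_recr /= eqxx big1 ?add0r // => j _.
  by rewrite ltn_eqF.
have add x1 x2 : (exists m (c : nat -> T), (forall i, G i (c i)) /\ x1 = \sum_(i < m) c i) ->
    (exists m (c : nat -> T), (forall i, G i (c i)) /\ x2 = \sum_(i < m) c i) ->
    exists m (c : nat -> T), (forall i, G i (c i)) /\ x1 + x2 = \sum_(i < m) c i.
  move=> [m [c [Gc ->]]] [n [d [Gd ->]]].
  exists (maxn m n), (fun i => (if (i < m)%N then c i else 0) + (if (i < n)%N then d i else 0)).
  split=> [i|]; last by rewrite big_split /= -!sum_widen ?leq_maxl ?leq_maxr.
  by apply: (subgroupD (subgroup_tensor_deg i)); case: ifP => _ //;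
    exact: (subgroup0 (subgroup_tensor_deg i)).
elim/tensor_ring_ind: x => [s|v|x y hx [n [d [Gd ->]]]|x y [m [c [Gc ->]]] [n [d [Gd ->]]]].
- exact: hom (tensor_degS s).
- exact: hom (tensor_degV v).
- apply: add => //; exists n, (fun i => - d i); split=> [i|]; last by rewrite sumrN.
  exact: (subgroupN (subgroup_tensor_deg i)).
- rewrite mulr_suml; elim/big_ind: _ => [||i _].
  + exact: hom (subgroup0 (subgroup_tensor_deg 0)).
  + exact: add.
  + rewrite mulr_sumr; elim/big_ind: _ => [||j _].
    * exact: hom (subgroup0 (subgroup_tensor_deg 0)).
    * exact: add.
    * exact: hom (tensor_degM (Gc i) (Gd j)).
Qed.

(* Letters act on sequences nat -> T, each v shifting by one; the n-th component
   of x is the n-th entry of the orbit of (1, 0, 0, ...). *)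
Lemma tensor_component : exists comp : nat -> T -> T,
  (forall n, {morph comp n : x y / x - y}) /\
  forall m n x, G m x -> comp n x = if n == m then x else 0.
Proof.
pose aS (s : S) (f : nat -> T) : nat -> T := fun n => tensor_S V s * f n.
pose aV (v : V) (f : nat -> T) : nat -> T :=
  fun n => if n is n'.+1 then tensor_V v * f n' else 0.
case: (@tensor_left_action _ _ V (nat -> T) aS aV).
- by move=> s f g; apply/funext => n; exact: (mulrBr (tensor_S V s)).
- move=> v f g; apply/funext => -[|n]; first exact: esym (subrr _).
  exact: (mulrBr (tensor_V v)).
- by move=> s t f; apply/funext => n; rewrite /aS tensor_SD; exact: mulrDl.
- move=> v w f; apply/funext => -[|n]; first exact: esym (addr0 _).
  by rewrite /aV tensor_VD; exact: mulrDl.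
- by move=> f; apply/funext => n; rewrite /aS tensor_S1 mul1r.
- by move=> s t f; apply/funext => n; rewrite /aS tensor_SM; exact: esym (mulrA _ _ _).
- move=> s v f; apply/funext => -[|n]; first exact: esym (mulr0 (tensor_S V s)).
  by rewrite /aV tensor_Vl; exact: esym (mulrA _ _ _).
- move=> v s f; apply/funext => -[|n]; first by [].
  by rewrite /aV tensor_Vr; exact: esym (mulrA _ _ _).
move=> F [FB FBl FM FS FV].
(* [C m y] shifts a sequence by [m] places and multiplies it by [y] on the right, so it commutes
   with the left action. The claim becomes that [x] of degree [m] sends (1, 0, 0, ...) to the
   sequence with the single entry [x] at place [m]. *)
pose C m y (f : nat -> T) : nat -> T := fun n => if (m <= n)%N then f (n - m)%N * y else 0.
have FC x m y f : F x (C m y f) = C m y (F x f).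
  elim/tensor_ring_ind: x f => [s|v|a b ea eb|a b ea eb] f.
  - rewrite (FS s (C m y f)).
    rewrite (FS s f); apply: funext => n; rewrite /aS /C.
    by case: (m <= n)%N; [exact: mulrA|exact: mulr0].
  - rewrite (FV v (C m y f)) (FV v f); apply/funext => -[|n]; rewrite /aV /C.
      by case: (m <= 0)%N; [rewrite mul0r|].
    case: (ltngtP m n.+1) => mn.
    + have mn' : (m <= n)%N by exact: mn.
      by rewrite mn' (subSn mn'); exact: mulrA.
    + by rewrite [(m <= n)%N]leqNgt (ltnW mn); exact: mulr0.
    + by rewrite mn ltnn subnn mul0r; exact: mulr0.
  - rewrite (FBl a b (C m y f)) (FBl a b f) ea eb; apply/funext => n; rewrite /C; change (
      (if (m <= n)%N then F a f (n - m)%N * y else 0) -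
        (if (m <= n)%N then F b f (n - m)%N * y else 0)
      = if (m <= n)%N then (F a f (n - m)%N - F b f (n - m)%N) * y else 0).
    by case: (m <= n)%N; [rewrite mulrBl|rewrite subrr].
  - by rewrite (FM a b (C m y f)) (FM a b f) eb ea.
pose d0 : nat -> T := fun n => if n == 0 then 1 else 0.
exists (fun n x => F x d0 n); split=> [n x y|m n x Gx]; first by rewrite FBl.
suff -> : F x d0 = C m x d0.
  rewrite /C /d0; case: ltngtP => mn //; last by rewrite mn subnn mul1r.
  by rewrite subn_eq0 leqNgt mn mul0r.
elim: m x Gx {n} => [_ [s _ <-]|m IHm x].
  rewrite (FS s d0); apply: funext => n; rewrite /C /aS /d0 leq0n subn0.
  by case: (n == 0)%N; [rewrite mul1r; exact: mulr1|rewrite mul0r; exact: mulr0].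
suff sub : G m.+1 `<=` [set x | F x d0 = C m.+1 x d0] by exact: sub.
apply: setmul_sub => [|a _ Ga [v _ <-]] /=.
  split=> [|a b /= ea eb] /=.
    rewrite (morphB0 (fun a b => FBl a b d0)); apply/funext => n.
    by rewrite /C mulr0; case: (m < n)%N.
  rewrite FBl ea eb; apply/funext => n; rewrite /C mulrBr.
  change ((if (m < n)%N then d0 (n - m.+1)%N * a else 0) -
      (if (m < n)%N then d0 (n - m.+1)%N * b else 0)
    = if (m < n)%N then d0 (n - m.+1)%N * a - d0 (n - m.+1)%N * b else 0).
  by case: (m < n)%N; [|rewrite subrr].
have -> : F (a * tensor_V v) d0 = C 1%N (tensor_V v) (F a d0).
  rewrite (FM a (tensor_V v) d0) (FV v d0) -(FC a 1%N (tensor_V v) d0).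
  apply: (congr1 (F a)); apply: funext => -[|n]; rewrite /aV /C; first by [].
  rewrite ltn0Sn subn1 succnK /d0.
  by case: (n == 0)%N; [rewrite mulr1 mul1r|rewrite mulr0 mul0r].
rewrite (IHm _ Ga).
apply: funext => -[|n]; rewrite /C; first by rewrite !ltn0.
rewrite ltn0Sn subn1 succnK subSS ltnS.
by case: (m <= n)%N; [exact: esym (mulrA _ _ _)|exact: mul0r].
Qed.

Lemma tensor_direct_sum : direct_sum_of G.
Proof.
have [comp [compB compE]] := tensor_component.
split; [exact: subgroup_tensor_deg|exact: tensor_deg_gen|].
move=> n c Gc c0 i; have := congr1 (comp i) c0.
rewrite (morphB0 (compB i)) (morphB_sum (compB i)) (bigD1 i) //= (compE i) // eqxx.
rewrite big1 ?addr0 // => j; rewrite (compE j) // => /negPf ji.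
by rewrite -val_eqE /= eq_sym in ji; rewrite ji.
Qed.

End TensorGrading.

(** * Projections over a separable algebra *)

Section LinearProjection.
Variable M : zmodType.

Definition left_module (K : pzRingType) (a : K -> M -> M) : Prop :=
  [/\ forall s, {morph a s : x y / x - y}, forall s t x, a (s + t) x = a s x + a t x,
      forall s t x, a (s * t) x = a s (a t x) & forall x, a 1 x = x].

Lemma left_module0 (K : pzRingType) (a : K -> M -> M) x : left_module a -> a 0 x = 0.
Proof. by move=> [_ aD _ _]; apply: (addIr (a 0 x)); rewrite add0r -aD addr0. Qed.

(* Zorn's lemma is applied to X with X `|` [set 0] a subspace, so that the empty
   chain causes no trouble. *)
Lemma linear_complement (K : fieldType) (a : K -> M -> M) (N : set M) :
  left_module a -> subgroup N -> (forall c x, N x -> N (a c x)) ->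
  exists C : set M, [/\ subgroup C, forall c x, C x -> C (a c x),
    forall x, N x -> C x -> x = 0 & forall x, setadd N C x].
Proof.
move=> am sN aN; have [aB aD aM a1] := am.
pose P (X : set M) := let C := X `|` [set 0] in
  [/\ subgroup C, forall c x, C x -> C (a c x) & forall x, N x -> C x -> x = 0].
have [F FP Ftot|A [[sA aA NA] Amax]] := @Zorn_bigcup M P.
  pose U := (\bigcup_(X in F) X) `|` [set 0].
  (* By totality of the chain two elements of the union lie in one member; only if both are 0 may
     there be no member to choose. *)
  have U2 x y : U x -> U y -> x = 0 /\ y = 0 \/
      exists2 Z, F Z & (Z `|` [set 0]) x /\ (Z `|` [set 0]) y.
    move=> [[X FX Xx]|->] [[Y FY Yy]|->]; last by left.
    - by right; case: (Ftot X Y FX FY) => [XY|YX];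
        [exists Y => //; split; left=> //; exact: XY|exists X => //; split; left=> //; exact: YX].
    - by right; exists X => //; split; [left|right].
    - by right; exists Y => //; split; [right|left].
  have ZU Z : F Z -> Z `|` [set 0] `<=` U.
    by move=> FZ z [Zz|z0]; [left; exists Z|right].
  split.
  - split=> [|x y Ux Uy]; first by right.
    case: (U2 _ _ Ux Uy) => [[-> ->]|[Z FZ [Zx Zy]]]; first by rewrite subrr; right.
    by apply: (ZU Z FZ); case: (FP _ FZ) => sZ _ _; exact: (subgroupB sZ).
  - move=> c x Ux; case: (U2 _ _ Ux Ux) => [[-> _]|[Z FZ [Zx _]]].
      by rewrite (morphB0 (aB c)); right.
    by apply: (ZU Z FZ); case: (FP _ FZ) => _ aZ _; exact: aZ.
  - move=> x Nx Ux; case: (U2 _ _ Ux Ux) => [[-> _]|[Z FZ [Zx _]]] //.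
    by case: (FP _ FZ) => _ _; exact.
exists (A `|` [set 0]); split=> // x; apply: contrapT => nx.
(* For [x] outside [N] plus the candidate complement, the candidate is enlarged by the line through
   [x]. It still meets [N] in 0, since a nonzero multiple of [x] in [N] plus the candidate would
   bring [x] there too. *)
pose B := [set z | exists2 y, (A `|` [set 0]) y & exists c, z = y + a c x].
have B0 : B `|` [set 0] = B.
  apply/seteqP; split=> [z [//|->]|z Bz]; last by left.
  by exists 0; [right|exists 0; rewrite (left_module0 _ am) addr0].
apply: (Amax B).
  split=> [y Ay|BA]; first by exists y; [left|exists 0; rewrite (left_module0 _ am) addr0].
  apply: nx; exists 0; first exact: subgroup0.
  exists x; rewrite ?add0r //; left; apply: BA.
  by exists 0; [right|exists 1; rewrite a1 add0r].
split; rewrite B0.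
- split=> [|_ _ [y Ay [c ->]] [z Az [d ->]]]; first by rewrite -B0; right.
  exists (y - z); first exact: subgroupB.
  exists (c - d); rewrite opprD addrACA; congr (_ + _).
  by rewrite (morphDB (fun c d => aD c d x)).
- move=> c _ [y Ay [d ->]]; exists (a c y); first exact: aA.
  by exists (c * d); rewrite aM (morphBD (aB c)).
- move=> _ /[swap] -[y Ay [c ->]] Nyc; have [c0|c0] := eqVneq c 0.
    by rewrite c0 (left_module0 _ am) addr0 in Nyc *; exact: NA.
  case: nx; exists (a c^-1 (y + a c x)); first exact: aN.
  exists (a c^-1 (- y)); first by apply: aA; exact: subgroupN.
  by rewrite -(morphBD (aB _)) addrAC subrr add0r -aM mulVf // a1.
Qed.

Lemma linear_projection (K : fieldType) (a : K -> M -> M) (N : set M) :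
  left_module a -> subgroup N -> (forall c x, N x -> N (a c x)) ->
  exists pr : M -> M, [/\ {morph pr : x y / x - y}, forall c x, pr (a c x) = a c (pr x),
    forall x, N (pr x) & forall x, N x -> pr x = x].
Proof.
move=> am sN aN; have [C [sC aC NC NCT]] := linear_complement am sN aN.
have /choice[pr prP] : forall x, exists n, N n /\ C (x - n).
  by move=> x; have [n Nn [c Cc ->]] := NCT x; exists n; rewrite addrAC subrr add0r.
have uniq x n : N n -> C (x - n) -> pr x = n.
  move=> Nn Cn; have [Np Cp] := prP x; apply/eqP; rewrite -subr_eq0; apply/eqP/NC.
    exact: subgroupB.
  have -> : pr x - n = (x - n) - (x - pr x) by rewrite opprB [RHS]addrC addrA subrK.
  exact: subgroupB.
exists pr; split=> [x y|c x|x|x Nx].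
- have [[Nx Cx] [Ny Cy]] := (prP x, prP y); apply: uniq; first exact: subgroupB.
  by rewrite subrACA; exact: subgroupB.
- have [Nx Cx] := prP x; apply: uniq; first exact: aN.
  by case: am => aB _ _ _; rewrite -aB; exact: aC.
- by case: (prP x).
- by apply: uniq => //; rewrite subrr; exact: subgroup0.
Qed.

End LinearProjection.

Section Average.
Variables (k : fieldType) (S : algType k) (H : zmodType).
Variables (la : S -> H -> H) (ra : H -> S -> H) (P : set (H * S)).

(** In the applications [H] consists of all functions M -> M, and [P] of the pairs (h, u) where [h]
    maps into a subgroup [N] and acts on [N] as [u]. Multiplying arguments or values by [S] gives
    two commuting actions on [H], but they satisfy all bimodule axioms only on functions that are
    additive and compatible with [k]; hence the laws that are restricted to [P]. *)
Definition average_axioms : Prop :=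
  [/\ [/\ forall s, {morph la s : x y / x - y}, forall s t x, la (s * t) x = la s (la t x)
      & forall x, la 1 x = x],
    [/\ forall s, {morph ra^~ s : x y / x - y}, forall s t x, ra x (s * t) = ra (ra x s) t
      & forall x, ra x 1 = x],
    forall s x t, ra (la s x) t = la s (ra x t),
    [/\ forall s t x u, P (x, u) -> la (s + t) x = la s x + la t x,
      forall s t x u, P (x, u) -> ra x (s + t) = ra x s + ra x t
      & forall c x u, P (x, u) -> la c%:A x = ra x c%:A]
  & [/\ subgroup P, forall s x u, P (x, u) -> P (la s x, s * u)
      & forall s x u, P (x, u) -> P (ra x s, u * s)]].

Hypothesis hP : average_axioms.

Definition averagep of average_axioms : {pred H * S} := fun p => `[< P p >].

Lemma averagep_closed : zmod_closed (averagep hP).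
Proof.
have [_ _ _ _ [[P0 PB] _ _]] := hP.
by split=> [|x y /asboolP Px /asboolP Py]; apply/asboolP => //; exact: PB.
Qed.
HB.instance Definition _ := GRing.isZmodClosed.Build (H * S)%type (averagep hP) averagep_closed.

Definition average : Type := {x : H * S | averagep hP x}.
HB.instance Definition _ := [isSub of average for @sval (H * S) (averagep hP)].
HB.instance Definition _ := [Choice of average by <:].
HB.instance Definition _ := [SubChoice_isSubZmodule of average by <:].

Lemma averageP (m : average) : P ((val m).1, (val m).2).
Proof. by rewrite -surjective_pairing; exact/asboolP/(valP m). Qed.

Lemma average_la_subproof s (x : average) :
  averagep hP (la s (val x).1, s * (val x).2).
Proof.
have [_ _ _ _ [_ Pl _]] := hP; apply/asboolP/Pl.
by case: x => -[h t] /= /asboolP.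
Qed.
Lemma average_ra_subproof (x : average) s :
  averagep hP (ra (val x).1 s, (val x).2 * s).
Proof.
have [_ _ _ _ [_ _ Pr]] := hP; apply/asboolP/Pr.
by case: x => -[h t] /= /asboolP.
Qed.
Definition average_la s (x : average) : average :=
  exist (fun p => is_true (averagep hP p)) _ (average_la_subproof s x).
Definition average_ra (x : average) s : average :=
  exist (fun p => is_true (averagep hP p)) _ (average_ra_subproof x s).

Fact average_bimod_axioms : isBimodule k S average.
Proof.
apply: (isBimodule.Build k S average (lact := average_la) (ract := average_ra));
  have [[laB laM la1] [raB raM ra1] lra [laD raD Pk] _] := hP.
- by move=> s t m; apply: val_inj; apply: (f_equal2 pair); [exact: laD (averageP m)|exact: mulrDl].
- by move=> s m n; apply: val_inj; apply: (f_equal2 pair);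
    [exact: morphBD (laB s) _ _|exact: mulrDr].
- by move=> s t m; apply: val_inj; apply: (f_equal2 pair); [exact: laM|exact: esym (mulrA _ _ _)].
- by move=> m; apply: val_inj; rewrite /= la1 mul1r -surjective_pairing.
- by move=> s m n; apply: val_inj; apply: (f_equal2 pair);
    [exact: morphBD (raB s) _ _|exact: mulrDl].
- by move=> m s t; apply: val_inj; apply: (f_equal2 pair); [exact: raD (averageP m)|exact: mulrDr].
- by move=> m s t; apply: val_inj; apply: (f_equal2 pair); [exact: raM|exact: mulrA].
- by move=> m; apply: val_inj; rewrite /= ra1 mulr1 -surjective_pairing.
- by move=> s m t; apply: val_inj; apply: (f_equal2 pair); [exact: lra|exact: esym (mulrA _ _ _)].
- move=> c m; apply: val_inj; apply: (f_equal2 pair); last by rewrite mulr_algl mulr_algr.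
  exact: Pk (averageP m).
Defined.
HB.instance Definition _ := average_bimod_axioms.

(* A bimodule section of the second projection P -> S sends 1 to a central
   element. *)
Lemma separable_average h : separable S -> P (h, 1) ->
  exists2 h, P (h, 1) & forall s, la s h = ra h s.
Proof.
move=> hS Ph; pose e : average := exist (fun p => is_true (averagep hP p)) (h, 1) (asboolT Ph).
have [||y|g [gD gl gr] eg] := hS average (regular_bimod S) (fun x => (val x).2) id.
- by split.
- by split.
- by exists (average_la y e); rewrite /= mulr1.
have [/= ga g2] : P (val (g 1)) /\ (val (g 1)).2 = 1.
  by split; [exact/asboolP/(valP (g 1))|exact: eg].
exists (val (g 1)).1; first by rewrite -{2}g2 -surjective_pairing.
move=> s; suff : s *> g 1 = g 1 <* s by move/(congr1 (fun x => (val x).1)).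
by rewrite -gl // -gr //; congr g; rewrite /lact /ract /= mul1r mulr1.
Qed.

End Average.

Section SeparableProjection.
Variables (k : fieldType) (S : algType k).
Hypothesis hS : separable S.

(** A [k]-linear projection is averaged over [S], which acts on functions through their values and
    through their arguments. A function on which both actions agree is [S]-linear, and the component
    u = 1 of the pair keeps it the identity on [N]. *)
Lemma left_projection (M : zmodType) (a : S -> M -> M) (N : set M) :
  left_module a -> subgroup N -> (forall s x, N x -> N (a s x)) ->
  exists pr : M -> M, [/\ {morph pr : x y / x - y}, forall s x, pr (a s x) = a s (pr x),
    forall x, N (pr x) & forall x, N x -> pr x = x].
Proof.
move=> am sN aN; have [aB aD aM a1] := am.
have am' : left_module (fun c : k => a c%:A).
  split=> [c|c d x|c d x|x]; first exact: aB.
  - by rewrite scalerDl aD.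
  - by rewrite -aM mulr_algl scalerA.
  - by rewrite scale1r a1.
have [h [hB hk hN hid]] := linear_projection am' sN (fun c => aN _).
have ac c s x : a c%:A (a s x) = a s (a c%:A x) by rewrite -!aM mulr_algl mulr_algr.
pose P (p : (M -> M) * S) := [/\ {morph p.1 : x y / x - y},
  forall (c : k) x, p.1 (a c%:A x) = a c%:A (p.1 x), forall x, N (p.1 x)
  & forall x, N x -> p.1 x = a p.2 x].
pose la s (h : M -> M) x := a s (h x); pose ra (h : M -> M) s x := h (a s x).
have hP : average_axioms la ra P.
  split.
  - split=> [s f g|s t f|f]; apply: funext => x; [exact: aB|exact: aM|exact: a1].
  - split=> [s f g|s t f|f]; apply: funext => x; first by [].
      by rewrite /ra aM.
    by rewrite /ra a1.
  - by [].
  - split=> [s t f u _|s t f u [/= fB _ _ _]|c f u [/= _ fk _ _]]; apply: funext => x.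
    + exact: aD.
    + by rewrite /ra aD (morphBD fB).
    + by rewrite /la -fk.
  - split; first split=> [|[f u] [g w] [/= fB fk fN fu] [/= gB gk gN gw]].
    + split=> [x y|c x|x|x Nx]; rewrite /= ?(morphB0 (aB _)) ?(left_module0 _ am) //.
      * by rewrite subr0.
      * exact: subgroup0.
    + split=> [x y|c x|x|x Nx]; rewrite -[_ - _]/(f - g, u - w) /= -![(f - g) _]/(f _ - g _).
      * by rewrite fB gB subrACA.
      * by rewrite fk gk aB.
      * exact: subgroupB.
      * by rewrite fu ?gw // (morphDB (fun s t => aD s t x)).
    + move=> s f u [/= fB fk fN fu]; split=> [x y|c x|x|x Nx]; rewrite /= /la.
      * by rewrite fB aB.
      * by rewrite fk ac.
      * exact: aN.
      * by rewrite fu // aM.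
    + move=> s f u [/= fB fk fN fu]; split=> [x y|c x|x|x Nx]; rewrite /= /ra.
      * by rewrite aB fB.
      * by rewrite -ac fk.
      * exact: fN.
      * by rewrite fu ?aM //; exact: aN.
have [|f [/= fB fk fN f1] fS] := separable_average hP (h := h) hS.
  by split=> // x Nx; rewrite /= a1 hid.
exists f; split=> // [s x|x Nx]; last by rewrite f1 // a1.
exact/esym/(congr1 (@^~ x) (fS s)).
Qed.

(** A second averaging, of a left linear projection over the right action of [M]. Right
    multiplication of the argument is now the left action on functions, and right multiplication of
    the value the right one; both preserve left linearity. *)
Lemma bimod_projection (M : bimodType S) (N : set M) : is_subbimod N ->
  exists pr : M -> M, [/\ bimod_hom pr, forall x, N (pr x) & forall x, N x -> pr x = x].
Proof.
move=> [sN lN rN].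
have lm : left_module (fun (s : S) (x : M) => s *> x).
  split=> [s|s t x|s t x|x]; [|exact: lactDl|exact: lactA|exact: lact1].
  exact: morphDB (lactDr s).
have rB s : {morph (fun x : M => x <* s) : x y / x - y} by exact: morphDB (ractDl s).
have [h [hB hl hN hid]] := left_projection lm sN lN.
pose P (p : (M -> M) * S) := [/\ {morph p.1 : x y / x - y},
  forall s x, p.1 (s *> x) = s *> (p.1 x), forall x, N (p.1 x)
  & forall x, N x -> p.1 x = x <* p.2].
pose la s (h : M -> M) x := h (x <* s); pose ra (h : M -> M) s x := h x <* s.
have [lB _ _ _] := lm.
have hP : average_axioms la ra P.
  split.
  - split=> [s f g|s t f|f]; apply: funext => x; first by [].
      by rewrite /la ractA.
    by rewrite /la ract1.
  - split=> [s f g|s t f|f]; apply: funext => x; [exact: rB|exact: ractA|exact: ract1].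
  - by [].
  - split=> [s t f u [/= fB _ _ _]|s t f u _|c f u [/= _ fl _ _]]; apply: funext => x.
    + by rewrite /la ractDr (morphBD fB).
    + exact: ractDr.
    + by rewrite /la /ra -lract_scalar fl lract_scalar.
  - split; first split=> [|[f u] [g w] [/= fB fl fN fu] [/= gB gl gN gw]].
    + split=> [x y|c x|x|x Nx]; rewrite /= ?(morphB0 (lB _)) //.
      * by rewrite subr0.
      * exact: subgroup0.
      * by rewrite (morphB0 (f := ract x)) //; exact: morphDB (ractDr x).
    + split=> [x y|c x|x|x Nx]; rewrite -[_ - _]/(f - g, u - w) /= -![(f - g) _]/(f _ - g _).
      * by rewrite fB gB subrACA.
      * by rewrite fl gl lB.
      * exact: subgroupB.
      * by rewrite fu ?gw // (morphDB (ractDr x)).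
    + move=> s f u [/= fB fl fN fu]; split=> [x y|c x|x|x Nx]; rewrite /= /la.
      * by rewrite rB fB.
      * by rewrite lractA fl.
      * exact: fN.
      * by rewrite fu ?ractA //; exact: rN.
    + move=> s f u [/= fB fl fN fu]; split=> [x y|c x|x|x Nx]; rewrite /= /ra.
      * by rewrite fB rB.
      * by rewrite fl lractA.
      * exact: rN.
      * by rewrite fu // ractA.
have [|f [/= fB fl fN f1] fS] := separable_average hP (h := h) hS.
  by split=> // x Nx; rewrite /= ract1 hid.
exists f; split=> // [|x Nx]; last by rewrite f1 // ract1.
split=> [x y _ _|s x _|s x _]; [exact: morphBD|exact: fl|].
exact: (congr1 (@^~ x) (fS s)).
Qed.

(** An arbitrary preimage minus its projection to the kernel does not depend on the preimage, and is
    therefore linear. *)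
Lemma left_section (M M' : zmodType) (a : S -> M -> M) (a' : S -> M' -> M') (f : M -> M') :
  left_module a -> left_module a' -> {morph f : x y / x - y} ->
  (forall s x, f (a s x) = a' s (f x)) -> (forall y, exists x, f x = y) ->
  exists g : M' -> M, [/\ {morph g : x y / x - y}, forall s x, g (a' s x) = a s (g x)
    & forall y, f (g y) = y].
Proof.
move=> am am' fB fl /choice[h fh]; have [aB _ _ _] := am; have [a'B _ _ _] := am'.
have [||pr [prB prl prK prid]] := left_projection am (N := [set x | f x = 0]).
- by split=> [|x y /= x0 y0]; [exact: morphB0|rewrite /= fB x0 y0 subrr].
- by move=> s x /= x0; rewrite fl x0 (morphB0 (a'B s)).
have uniq x y : f x = f y -> x - pr x = y - pr y.
  move=> exy; apply/eqP; rewrite -subr_eq0 subrACA -prB.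
  by rewrite prid /= ?fB ?exy ?subrr.
exists (fun y => h y - pr (h y)); split=> [x y|s x|y].
- by rewrite (uniq _ (h x - h y)) ?fB ?fh // prB subrACA.
- by rewrite (uniq _ (a s (h x))) ?fl ?fh // prl -aB.
- by rewrite fB fh (prK (h y)) subr0.
Qed.

(** A section over the image of [N] only, made total by first projecting [M'] onto that image.
    Preimages are taken in [N] and corrected by a projection to the part of the kernel inside [N],
    so the values stay in [N]. It is applied with [f] a projection to one degree, where it chooses
    lifts of leading forms. *)
Lemma bimod_section (M M' : bimodType S) (f : M -> M') (N : set M) :
  bimod_hom f -> is_subbimod N ->
  exists g : M' -> M, [/\ bimod_hom g, forall y, N (g y)
    & forall x, N x -> f (g (f x)) = f x].
Proof.
move=> [fD fl fr] [sN lN rN].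
have fB : {morph f : x y / x - y} by apply: morphDB => x y; exact: fD.
have lB s : {morph (fun x : M => s *> x) : x y / x - y} by exact: morphDB (lactDr s).
have rB s : {morph (fun x : M => x <* s) : x y / x - y} by exact: morphDB (ractDl s).
have [|q [[qD ql qr] qN qid]] := @bimod_projection M' (f @` N).
  split=> [|s _ [x Nx <-]|s _ [x Nx <-]].
  - split=> [|_ _ [x Nx <-] [y Ny <-]]; last by exists (x - y); [exact: subgroupB|rewrite fB].
    by exists 0; [exact: subgroup0|exact: morphB0].
  - by exists (s *> x); [exact: lN|rewrite fl].
  - by exists (x <* s); [exact: rN|rewrite fr].
have [|p [[pD pl pr] pN pid]] := @bimod_projection M (N `&` [set x | f x = 0]).
  split=> [|s x [Nx /= x0]|s x [Nx /= x0]].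
  - apply: subgroup_setI => //; split=> [|x y /= x0 y0]; first exact: morphB0.
    by rewrite /= fB x0 y0 subrr.
  - by split; [exact: lN|rewrite /= fl // x0; exact: morphB0 (morphDB (lactDr s))].
  - by split; [exact: rN|rewrite /= fr // x0; exact: morphB0 (morphDB (ractDl s))].
have pB : {morph p : x y / x - y} by apply: morphDB => x y; exact: pD.
have [h hN fh] : exists2 h : M' -> M, forall y, N (h y) & forall y, f (h y) = q y.
  have /choice[h hP] : forall y, exists x, N x /\ f x = q y.
    by move=> y; have [x Nx <-] := qN y; exists x.
  by exists h => y; case: (hP y).
have uniq x y : N x -> N y -> f x = f y -> x - p x = y - p y.
  move=> Nx Ny exy; apply/eqP; rewrite -subr_eq0 subrACA -pB.
  rewrite pid ?subrr //.
  by split; [exact: subgroupB|rewrite /= fB exy subrr].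
have fp x : f (p x) = 0 by case: (pN x).
exists (fun y => h y - p (h y)); split=> [|y|x Nx].
- split=> [x y _ _|s x _|s x _].
  + rewrite (uniq _ (h x + h y)) ?(morphBD fB) ?fh ?qD //; last exact: subgroupD.
    by rewrite pD // opprD addrACA.
  + by rewrite (uniq _ (s *> h x)) ?fl ?fh ?ql // ?pl ?lB //; exact: lN.
  + by rewrite (uniq _ (h x <* s)) ?fr ?fh ?qr // ?pr ?rB //; exact: rN.
- by apply: subgroupB => //; case: (pN (h y)).
- by rewrite fB fp subr0 fh qid //; exists x.
Qed.

End SeparableProjection.

Lemma lact0l (k : fieldType) (S : algType k) (M : bimodType S) (x : M) : (0 : S) *> x = 0.
Proof. exact: morphB0 (morphDB (fun s t => lactDl s t x)). Qed.

Section GradedBimodules.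
Variables (k : fieldType) (S : algType k) (M : bimodType S) (G : nat -> set M).
Hypotheses (hG : direct_sum_of G) (bG : forall n, is_subbimod (G n)).

Lemma lactB s : {morph (fun x : M => s *> x) : x y / x - y}.
Proof. exact: morphDB (lactDr s). Qed.
Lemma ractB s : {morph (fun x : M => x <* s) : x y / x - y}.
Proof. exact: morphDB (ractDl s). Qed.

Lemma hcomp_lact n s x : hcomp G n (s *> x) = s *> hcomp G n x.
Proof.
pose N := [set x | hcomp G n (s *> x) = s *> hcomp G n x].
suff : N x by [].
apply: (graded_ind hG) => [|i]; rewrite /N /=.
  split=> [|y z /= ey ez]; rewrite /=.
    by rewrite (hcomp0 hG) (morphB0 (lactB s)) (hcomp0 hG).
  by rewrite lactB !(hcompB hG) lactB ey ez.
have Gi := hcomp_in hG i x; have [_ Gl _] := bG i.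
rewrite (hcompK hG) (hcomp_id hG n (Gl s _ Gi)).
by case: ifP; rewrite ?(morphB0 (lactB s)).
Qed.

Lemma hcomp_ract n s x : hcomp G n (x <* s) = hcomp G n x <* s.
Proof.
pose N := [set x | hcomp G n (x <* s) = hcomp G n x <* s].
suff : N x by [].
apply: (graded_ind hG) => [|i]; rewrite /N /=.
  split=> [|y z /= ey ez]; rewrite /=.
    by rewrite (hcomp0 hG) (morphB0 (ractB s)) (hcomp0 hG).
  by rewrite ractB !(hcompB hG) ractB ey ez.
have Gi := hcomp_in hG i x; have [_ _ Gr] := bG i.
rewrite (hcompK hG) (hcomp_id hG n (Gr s _ Gi)).
by case: ifP; rewrite ?(morphB0 (ractB s)).
Qed.

Lemma hcomp_hom n : bimod_hom (hcomp G n).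
Proof.
split=> [x y _ _|s x _|s x _]; [exact: hcompD|exact: hcomp_lact|exact: hcomp_ract].
Qed.

Lemma is_subbimod_below n : is_subbimod (below G n).
Proof.
split=> [|s x /(belowP hG) x0|s x /(belowP hG) x0]; first exact: subgroup_below.
- by apply/(belowP hG) => i ni; rewrite hcomp_lact x0 ?(morphB0 (lactB s)).
- by apply/(belowP hG) => i ni; rewrite hcomp_ract x0 ?(morphB0 (ractB s)).
Qed.

Lemma is_subbimod_setI (X Y : set M) : is_subbimod X -> is_subbimod Y -> is_subbimod (X `&` Y).
Proof.
move=> [sX lX rX] [sY lY rY]; split=> [|s x [Xx Yx]|s x [Xx Yx]].
- exact: subgroup_setI.
- by split; [exact: lX|exact: lY].
- by split; [exact: rX|exact: rY].
Qed.

End GradedBimodules.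

(** * Graded rings *)

Section GradedRings.
Variables (B : pzRingType) (G : nat -> set B).
Hypotheses (hG : direct_sum_of G)
  (GM : forall m n x y, G m x -> G n y -> G (m + n)%N (x * y)).
Implicit Types (x y : B) (m n : nat).

Lemma hcompMr m n x y : G m y ->
  hcomp G n (x * y) = if (m <= n)%N then hcomp G (n - m) x * y else 0.
Proof.
move=> Gy; pose N := [set x |
  hcomp G n (x * y) = if (m <= n)%N then hcomp G (n - m) x * y else 0].
suff : N x by [].
apply: (graded_ind hG) => [|i]; rewrite /N /=.
  split=> [|a b /= ea eb] /=; first by rewrite mul0r !(hcomp0 hG) mul0r if_same.
  by rewrite mulrBl !(hcompB hG) ea eb; case: ifP => _; rewrite ?subrr // mulrBl.
rewrite (hcomp_id hG n (GM (hcomp_in hG i x) Gy)) (hcompK hG).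
have [mn|mn] := leqP m n; last by case: eqP => // e; lia.
by rewrite -{1}(subnK mn) eqn_add2r; case: eqP => // _; rewrite mul0r.
Qed.

Lemma hcompMl m n x y : G m x ->
  hcomp G n (x * y) = if (m <= n)%N then x * hcomp G (n - m) y else 0.
Proof.
move=> Gx; pose N := [set y |
  hcomp G n (x * y) = if (m <= n)%N then x * hcomp G (n - m) y else 0].
suff : N y by [].
apply: (graded_ind hG) => [|i]; rewrite /N /=.
  split=> [|a b /= ea eb] /=; first by rewrite mulr0 !(hcomp0 hG) mulr0 if_same.
  by rewrite mulrBr !(hcompB hG) ea eb; case: ifP => _; rewrite ?subrr // mulrBr.
rewrite (hcomp_id hG n (GM Gx (hcomp_in hG i y))) (hcompK hG).
have [mn|mn] := leqP m n; last by case: eqP => // e; lia.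
by rewrite -{1}(subnKC mn) eqn_add2l; case: eqP => // _; rewrite mulr0.
Qed.

Lemma belowM m n x y : below G m x -> below G n.+1 y -> below G (m + n) (x * y).
Proof.
move=> /(below_sum hG) -> /(below_sum hG) ->; rewrite mulr_suml.
apply: subgroup_sum => [|i]; first exact: subgroup_below.
rewrite mulr_sumr; apply: subgroup_sum => [|j]; first exact: subgroup_below.
apply: (below_hom hG) (GM (hcomp_in hG i x) (hcomp_in hG j y)).
by have := ltn_ord i; have := ltn_ord j; lia.
Qed.

Lemma belowMS m n x y : below G m.+1 x -> below G n y -> below G (m + n) (x * y).
Proof.
move=> /(below_sum hG) -> /(below_sum hG) ->; rewrite mulr_suml.
apply: subgroup_sum => [|i]; first exact: subgroup_below.
rewrite mulr_sumr; apply: subgroup_sum => [|j]; first exact: subgroup_below.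
apply: (below_hom hG) (GM (hcomp_in hG i x) (hcomp_in hG j y)).
by have := ltn_ord i; have := ltn_ord j; lia.
Qed.

Lemma hcompM_top m n x y : below G m.+1 x -> below G n.+1 y ->
  hcomp G (m + n) (x * y) = hcomp G m x * hcomp G n y.
Proof.
move=> bx byy; pose x' := x - hcomp G m x; pose y' := y - hcomp G n y.
have -> : x * y = hcomp G m x * hcomp G n y + (hcomp G m x * y' + x' * y).
  rewrite addrA -mulrDr [hcomp G n y + _]addrC subrK.
  by rewrite -mulrDl [hcomp G m x + _]addrC subrK.
have b2 : below G (m + n) (hcomp G m x * y' + x' * y).
  apply: (subgroupD (subgroup_below hG _)).
    by apply: belowMS; [exact: below_hom (ltnSn m) (hcomp_in hG m x)|exact: below_top].
  by apply: belowM => //; exact: below_top.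
move/(belowP hG): b2 => /(_ _ (leqnn _)) b2.
by rewrite (hcompD hG) b2 addr0 (hcomp_same hG (GM (hcomp_in hG m x) (hcomp_in hG n y))).
Qed.

Lemma hcomp0M x y : hcomp G 0 (x * y) = hcomp G 0 x * hcomp G 0 y.
Proof.
pose N := [set y | hcomp G 0 (x * y) = hcomp G 0 x * hcomp G 0 y].
suff : N y by [].
apply: (graded_ind hG) => [|i]; rewrite /N /=.
  split=> [|a b /= ea eb] /=; first by rewrite mulr0 (hcomp0 hG) mulr0.
  by rewrite mulrBr !(hcompB hG) ea eb mulrBr.
rewrite (hcompMr 0 _ (hcomp_in hG i y)) (hcompK hG) leqn0.
by case: eqP => [->|/eqP]; rewrite ?subnn // eq_sym => /negPf ->; rewrite mulr0.
Qed.

End GradedRings.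

(** * The tensor ring of a connected ring *)

Section SRings.
Variables (k : fieldType) (S : algType k) (B : sringType S).

Lemma lactE s (x : B) : s *> x = (s *> 1) * x.
Proof. by rewrite -lactMl mul1r. Qed.
Lemma ract1E s : (1 : B) <* s = s *> 1.
Proof. by rewrite -[LHS]mulr1 ractMlact mul1r. Qed.
Lemma ractE s (x : B) : x <* s = x * (s *> 1).
Proof. by rewrite -ract1E -ractMr mulr1. Qed.

End SRings.

Section ConnectedRing.
Variables (k : fieldType) (S : algType k) (A : conn_sring S).
Implicit Types (a b : A).

Lemma deg_direct_sum : direct_sum_of (@deg k S A). Proof. by case: (deg_grading A). Qed.
Lemma degM m n a b : deg m a -> deg n b -> deg (m + n)%N (a * b).
Proof. by case: (deg_grading A) => _ _ _; exact. Qed.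
Lemma deg1 : @deg k S A 0%N 1. Proof. by case: (deg_grading A). Qed.
Let hG := deg_direct_sum.

Lemma unit_inj (s t : S) : s *> (1 : A) = t *> 1 -> s = t.
Proof. by case: (deg_connected A) => _ inj _ e; apply: inj; rewrite ?inE. Qed.

Lemma augmentationP a : augmentation a *> 1 = hcomp (@deg k S A) 0 a.
Proof.
rewrite /augmentation; case: xgetP => [s _ //|ns].
have [_ _ surj] := deg_connected A.
by have [s _ e] := surj _ (hcomp_in hG 0 a); case: (ns s).
Qed.

Lemma augmentation_eq s a : s *> 1 = hcomp (@deg k S A) 0 a -> augmentation a = s.
Proof. by move=> e; apply: unit_inj; rewrite augmentationP. Qed.

Lemma augmentationB : {morph @augmentation k S A : a b / a - b}.
Proof.
move=> a b; apply: augmentation_eq.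
by rewrite (morphDB (fun s t => lactDl s t (1 : A))) !augmentationP (hcompB hG).
Qed.

Lemma augmentationM : {morph @augmentation k S A : a b / a * b}.
Proof.
move=> a b; apply: augmentation_eq.
by rewrite (hcomp0M hG degM) -!augmentationP lactA lactE.
Qed.

Lemma augmentation_unit s : augmentation (s *> 1 : A) = s.
Proof.
apply: augmentation_eq; rewrite (hcomp_same hG) //.
by have [_ + _] := deg_subbimod A 0; apply; exact: deg1.
Qed.

Lemma augmentation_deg n a : @deg k S A n a -> (0 < n)%N -> augmentation a = 0.
Proof.
move=> Ga n0; apply: augmentation_eq; rewrite (hcomp_id hG _ Ga) eq_sym gtn_eqF //.
exact: lact0l.
Qed.

End ConnectedRing.

(* shadowed by a lemma of classical/functions.v *)
Local Notation can_surj := Defs.can_surj (only parsing).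

Section TensorAlgebra.
Variables (k : fieldType) (S : algType k) (A : conn_sring S).
Implicit Types (x y : T A) (m n : nat).
Local Notation G := (@Tdeg k S A).
Local Notation V := (gen_bimod A).

Lemma Tdeg_direct_sum : direct_sum_of G. Proof. exact: tensor_direct_sum. Qed.
Lemma TdegM m n x y : G m x -> G n y -> G (m + n)%N (x * y).
Proof. exact: tensor_degM. Qed.
Lemma Tdeg_1 : G 0%N 1. Proof. exact: tensor_deg1. Qed.
Lemma Tdeg_subbimod n : is_subbimod (G n). Proof. exact: is_subbimod_tensor_deg. Qed.
Lemma TdegSl n : G n.+1 = setmul (G 1%N) (G n). Proof. exact: tensor_degSl. Qed.
Lemma TdegSr n : G n.+1 = setmul (G n) (G 1%N). Proof. exact: tensor_degSE. Qed.

Lemma tensor_SE s : tensor_S V s = s *> (1 : T A).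
Proof. exact: esym (mulr1 (tensor_S V s)). Qed.

Lemma Tdeg0E x : G 0%N x -> exists s, x = s *> 1.
Proof. by move=> [s _ <-]; exists s; rewrite tensor_SE. Qed.

Lemma val_hom : bimod_hom_on setT (fun v : V => val v).
Proof. by split. Qed.

Lemma can_surjB : {morph @can_surj k S A : x y / x - y}.
Proof. exact: (tensor_liftB val_hom). Qed.
Lemma can_surjM : {morph @can_surj k S A : x y / x * y}.
Proof. exact: (tensor_liftM val_hom). Qed.
Lemma can_surj_tensor_S s : can_surj (tensor_S V s : T A) = s *> 1.
Proof. exact: (tensor_liftS val_hom). Qed.
Lemma can_surj_tensor_V v : can_surj (tensor_V v : T A) = val v.
Proof. exact: (tensor_liftV val_hom). Qed.
Lemma can_surj_lact s x : can_surj (s *> x) = s *> can_surj x.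
Proof. by rewrite lactE can_surjM -tensor_SE can_surj_tensor_S -lactE. Qed.

Lemma can_surj_deg n x : G n x -> deg n (can_surj x).
Proof.
have [_ lA _] := deg_subbimod A 0.
elim: n x => [x [s _ <-]|n IHn].
  by rewrite can_surj_tensor_S; exact: lA (deg1 A).
suff sub : G n.+1 `<=` [set x | deg n.+1 (can_surj x)] by exact: sub.
have [sA _ _] := deg_subbimod A n.+1.
rewrite TdegSr; apply: setmul_sub => [|x y Gx].
  split=> [|a b /= dx dy] /=; first by rewrite (morphB0 can_surjB); case: sA.
  by rewrite can_surjB; exact: (subgroupB sA).
rewrite /Tdeg tensor_deg1E => -[v _ <-] /=.
rewrite can_surjM can_surj_tensor_V -addn1; apply: degM; first exact: IHn.
exact/asboolP/(valP v).
Qed.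

(** Degrees 0 and 1 of the tensor ring are the images of [S] and A^1, which the surjection returns
    to A^0 and A^1 unchanged. Hence I begins in degree 2. *)
Lemma can_surj_inj01 n x : (n <= 1)%N -> G n x -> can_surj x = 0 -> x = 0.
Proof.
case: n => [_ [s _ <-]|[|//] _].
  rewrite can_surj_tensor_S => e.
  have -> : s = 0.
    by apply: (@unit_inj _ _ A); rewrite e lact0l.
  exact: morphB0 (@tensor_SB _ _ V).
rewrite /Tdeg tensor_deg1E => -[v _ <-]; rewrite can_surj_tensor_V => e.
have -> : v = 0 by apply: val_inj; rewrite e.
exact: morphB0 (@tensor_VB _ _ V).
Qed.

(** The place where strong grading enters: it makes [A] generated in degree 1. *)
Lemma can_surj_onto n a : strongly_graded A -> deg n a ->
  exists2 x, G n x & can_surj x = a.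
Proof.
move=> sA; elim: n a => [a|n IHn].
  have [_ _ surj] := deg_connected A => /surj[s _ <-].
  by exists (tensor_S V s); [exact: tensor_degS|exact: can_surj_tensor_S].
suff : @deg k S A n.+1 `<=` [set a | exists2 x, G n.+1 x & can_surj x = a] by exact.
have [sG _ _] := Tdeg_subbimod n.+1.
rewrite -addn1 -sA; apply: setmul_sub => [|a b Ga Gb] /=.
  split=> [|_ _ [x Gx <-] [y Gy <-]].
    by exists 0; [rewrite addn1; exact: (subgroup0 sG)|exact: morphB0 can_surjB].
  rewrite addn1 in Gx Gy *.
  by exists (x - y); [exact: (subgroupB sG Gx Gy)|rewrite can_surjB].
have [x Gx <-] := IHn _ Ga.
have gb : subbimodp (deg_subbimod A 1) b by apply/asboolP.
exists (x * tensor_V (exist _ b gb : V)).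
  exact: (@TdegM _ _ _ _ Gx (tensor_degV (exist _ b gb : V))).
by rewrite can_surjM can_surj_tensor_V.
Qed.

Lemma T_left_derivation (M : zmodType) (act : T A -> M -> M) (delta : T A -> T A -> M) :
  (forall a, {morph act a : d e / d - e}) ->
  (forall a b (e : M), act (a - b) e = act a e - act b e) ->
  (forall a b (e : M), act (a * b) e = act a (act b e)) ->
  (forall e : M, act 1 e = e) ->
  (forall v, {morph delta v : x y / x - y}) ->
  (forall v w x, delta (v + w) x = delta v x + delta w x) ->
  (forall s v x, delta (s *> v) x = act (s *> 1) (delta v x)) ->
  (forall v s x, delta (v <* s) x = delta v (s *> x)) ->
  exists gam : T A -> M,
  [/\ {morph gam : x y / x - y}, gam 1 = 0,
      forall s x, gam (s *> x) = act (s *> 1) (gam x)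
    & forall v x, G 1%N v -> gam (v * x) = act v (gam x) + delta v x].
Proof.
move=> actB actBl actM act1 dB dD dl dr.
case: (@tensor_left_derivation _ _ V M act (fun v => delta (tensor_V v))) => //.
- by move=> v w x; rewrite tensor_VD dD.
- by move=> s v x; rewrite tensor_Vl tensor_SE -dl -lactE.
- by move=> v s x; rewrite tensor_Vr tensor_SE -dr -ractE.
move=> gam [gB g1 gl gv]; exists gam; split=> // [s x|v x].
  by rewrite -tensor_SE -gl.
by rewrite /Tdeg tensor_deg1E => -[w _ <-].
Qed.

Lemma T_right_extension (delta : T A -> T A -> T A) :
  (forall v, {morph delta^~ v : x y / x - y}) ->
  (forall x v w, delta x (v + w) = delta x v + delta x w) ->
  (forall x v s, delta x (v <* s) = delta x v <* s) ->
  (forall x s v, delta x (s *> v) = delta (x <* s) v) ->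
  exists2 gam : T A -> T A, {morph gam : x y / x - y}
    & forall x v, G 1%N v -> gam (x * v) = delta x v.
Proof.
move=> dB dD dr dl.
case: (@tensor_right_extension _ _ V (fun x v => delta x (tensor_V v))) => //.
- by move=> x v w; rewrite tensor_VD dD.
- by move=> x v s; rewrite tensor_Vr tensor_SE -dr -ractE.
- by move=> x s v; rewrite tensor_Vl tensor_SE -dl -lactE.
move=> gam gB gv; exists gam => // x v.
by rewrite /Tdeg tensor_deg1E => -[w _ <-].
Qed.

End TensorAlgebra.

(* The structure of T_S(A^1) over A on which the argument rests. The last two
   fields express that multiplication identifies V (x) T and T (x) V with T_+,
   where V = A^1. relations_of, fid, jac, filtered_lift and top_forms below are
   bimodule_of_relations, filt_ideal, Jacobi, filtered_morphism and R_ read in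
   such a model. *)
Record tensor_model (k : fieldType) (S : algType k) (A : conn_sring S) := TensorModel {
  tm_ring :> sringType S;
  tm_deg : nat -> set tm_ring;
  tm_surj : tm_ring -> A;
  tm_direct_sum : direct_sum_of tm_deg;
  tm_degM : forall m n x y, tm_deg m x -> tm_deg n y -> tm_deg (m + n)%N (x * y);
  tm_deg_1 : tm_deg 0%N 1;
  tm_subbimod : forall n, is_subbimod (tm_deg n);
  tm_degSl : forall n, tm_deg n.+1 = setmul (tm_deg 1%N) (tm_deg n);
  tm_degSr : forall n, tm_deg n.+1 = setmul (tm_deg n) (tm_deg 1%N);
  tm_deg0E : forall x, tm_deg 0%N x -> exists s, x = s *> 1;
  tm_surjB : {morph tm_surj : x y / x - y};
  tm_surjM : {morph tm_surj : x y / x * y};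
  tm_surj_lact : forall s x, tm_surj (s *> x) = s *> tm_surj x;
  tm_surj_deg : forall n x, tm_deg n x -> deg n (tm_surj x);
  tm_surj_inj01 : forall n x, (n <= 1)%N -> tm_deg n x -> tm_surj x = 0 -> x = 0;
  tm_surj_onto : forall n a, deg n a -> exists2 x, tm_deg n x & tm_surj x = a;
  tm_left_derivation : forall (M : zmodType) (act : tm_ring -> M -> M)
      (delta : tm_ring -> tm_ring -> M),
    (forall a, {morph act a : d e / d - e}) ->
    (forall a b e, act (a - b) e = act a e - act b e) ->
    (forall a b e, act (a * b) e = act a (act b e)) ->
    (forall e, act 1 e = e) ->
    (forall v, {morph delta v : x y / x - y}) ->
    (forall v w x, delta (v + w) x = delta v x + delta w x) ->
    (forall s v x, delta (s *> v) x = act (s *> 1) (delta v x)) ->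
    (forall v s x, delta (v <* s) x = delta v (s *> x)) ->
    exists gam : tm_ring -> M,
    [/\ {morph gam : x y / x - y}, gam 1 = 0,
        forall s x, gam (s *> x) = act (s *> 1) (gam x)
      & forall v x, tm_deg 1%N v -> gam (v * x) = act v (gam x) + delta v x];
  tm_right_extension : forall delta : tm_ring -> tm_ring -> tm_ring,
    (forall v, {morph delta^~ v : x y / x - y}) ->
    (forall x v w, delta x (v + w) = delta x v + delta x w) ->
    (forall x v s, delta x (v <* s) = delta x v <* s) ->
    (forall x s v, delta x (s *> v) = delta (x <* s) v) ->
    exists2 gam : tm_ring -> tm_ring, {morph gam : x y / x - y}
      & forall x v, tm_deg 1%N v -> gam (x * v) = delta x v
}.

Definition tensor_algebra_model (k : fieldType) (S : algType k) (A : conn_sring S)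
    (hA : strongly_graded A) : tensor_model A :=
  TensorModel (Tdeg_direct_sum A) (@TdegM k S A) (Tdeg_1 A) (Tdeg_subbimod A)
    (TdegSl A) (TdegSr A) (@Tdeg0E k S A) (@can_surjB k S A) (@can_surjM k S A)
    (@can_surj_lact k S A) (@can_surj_deg k S A) (@can_surj_inj01 k S A)
    (fun n a => @can_surj_onto k S A n a hA) (@T_left_derivation k S A)
    (@T_right_extension k S A).

Section TensorModel.
Variables (k : fieldType) (S : algType k) (A : conn_sring S) (D : tensor_model A).
Local Notation G := (@tm_deg k S A D).
Implicit Types x y : D.
Let hG := tm_direct_sum D.

Lemma tm_deg_unit s : G 0%N (s *> 1).
Proof. by have [_ + _] := tm_subbimod D 0; apply; exact: tm_deg_1. Qed.

Lemma tm_surj1 : tm_surj (1 : D) = 1.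
Proof.
have [x _ ex] := tm_surj_onto D (deg1 A).
by rewrite -[RHS]ex -[in RHS](mulr1 x) tm_surjM ex mul1r.
Qed.

(** The injectivity of V (x) T -> T, as a case of the derivation property: when T acts through its
    degree 0 component, letters act by 0 and only the inhomogeneous term [delta] survives. *)
Lemma tm_left_extension (delta : D -> D -> D) :
  (forall v, {morph delta v : x y / x - y}) ->
  (forall v w x, delta (v + w) x = delta v x + delta w x) ->
  (forall v s x, delta (s *> v) x = s *> delta v x) ->
  (forall x s v, delta (v <* s) x = delta v (s *> x)) ->
  exists2 gam : D -> D, {morph gam : x y / x - y}
    & forall x v, G 1%N v -> gam (v * x) = delta v x.
Proof.
move=> dB dD dl dr.
have [||||||||gam [gB _ _ gv]] :=
  @tm_left_derivation _ _ _ D D (fun a x => hcomp G 0 a * x) delta.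
- by move=> a x y; exact: mulrBr.
- by move=> a b x; rewrite (hcompB hG) mulrBl.
- by move=> a b x; rewrite (hcomp0M hG (@tm_degM _ _ _ D)) mulrA.
- by move=> x; rewrite (hcomp_same hG (tm_deg_1 D)) mul1r.
- exact: dB.
- exact: dD.
- by move=> s v x; rewrite (hcomp_same hG (tm_deg_unit s)) dl -lactE.
- by move=> v s x; exact: dr.
exists gam => [|x v Gv]; first exact: gB.
by rewrite (gv v x Gv) (hcomp_id hG 0 Gv) mul0r add0r.
Qed.

End TensorModel.

(** * Bimodules of relations *)

Section SubBimodules.
Variables (k : fieldType) (S : algType k) (B : sringType S).
Implicit Types (X Y : set B).

Lemma is_subbimod_setmul X Y : is_subbimod X -> is_subbimod Y -> is_subbimod (setmul X Y).
Proof.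
move=> [_ lX _] [_ _ rY]; split=> [|s|s]; first exact: subgroup_setmul.
- suff : setmul X Y `<=` [set x | setmul X Y (s *> x)] by exact.
  apply: setmul_sub => [|x y Xx Yy] /=; last by rewrite lactMl; apply: setmul_mem => //; exact: lX.
  split=> [|x y /= sx sy] /=.
    by rewrite (morphB0 (lactB s)); exact: subgroup0 (subgroup_setmul _ _).
  by rewrite lactB; exact: (subgroupB (subgroup_setmul _ _) sx sy).
- suff : setmul X Y `<=` [set x | setmul X Y (x <* s)] by exact.
  apply: setmul_sub => [|x y Xx Yy] /=; last by rewrite ractMr; apply: setmul_mem => //; exact: rY.
  split=> [|x y /= sx sy] /=.
    by rewrite (morphB0 (ractB s)); exact: subgroup0 (subgroup_setmul _ _).
  by rewrite ractB; exact: (subgroupB (subgroup_setmul _ _) sx sy).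
Qed.

Lemma is_subbimod_setadd X Y : is_subbimod X -> is_subbimod Y -> is_subbimod (setadd X Y).
Proof.
move=> [sX lX rX] [sY lY rY]; split=> [|s _ [x Xx [y Yy ->]]|s _ [x Xx [y Yy ->]]].
- exact: subgroup_setadd.
- by exists (s *> x); [exact: lX|exists (s *> y); [exact: lY|rewrite lactDr]].
- by exists (x <* s); [exact: rX|exists (y <* s); [exact: rY|rewrite ractDl]].
Qed.

Lemma ideal_subbimod X : two_sided_ideal X -> is_subbimod X.
Proof.
move=> [sX mX]; split=> // s x Xx; first by rewrite lactE; case: (mX (s *> 1) x Xx).
by rewrite ractE; case: (mX (s *> 1) x Xx).
Qed.

End SubBimodules.

Section HomogeneousSets.
Variables (B : pzRingType) (G : nat -> set B).
Hypotheses (hG : direct_sum_of G)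
  (GM : forall m n x y, G m x -> G n y -> G (m + n)%N (x * y)).

Definition homogeneous (X : set B) : Prop := forall n x, X x -> X (hcomp G n x).

Lemma homogeneous_setmul X Y :
  homogeneous X -> homogeneous Y -> homogeneous (setmul X Y).
Proof.
move=> hX hY n; suff : setmul X Y `<=` [set x | setmul X Y (hcomp G n x)] by exact.
have sXY := subgroup_setmul X Y.
apply: setmul_sub => [|x y Xx Yy] /=.
  split=> [|x y /= hx hy] /=; first by rewrite (hcomp0 hG); exact: (subgroup0 sXY).
  by rewrite (hcompB hG); exact: (subgroupB sXY hx hy).
have [m -> _] := direct_sumP hG x; rewrite mulr_suml (hcomp_sum hG).
apply: (subgroup_sum sXY) => i; rewrite (hcompMl hG GM n y (hcomp_in hG i x)).
by case: ifP => _; [apply: setmul_mem; [exact: hX|exact: hY]|exact: (subgroup0 sXY)].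
Qed.

Lemma homogeneous_setadd X Y :
  homogeneous X -> homogeneous Y -> homogeneous (setadd X Y).
Proof.
move=> hX hY n _ [x Xx [y Yy ->]]; exists (hcomp G n x); first exact: hX.
by exists (hcomp G n y); [exact: hY|rewrite (hcompD hG)].
Qed.

End HomogeneousSets.

Section Relations.
Variables (k : fieldType) (S : algType k) (A : conn_sring S) (D : tensor_model A).
Local Notation G := (@tm_deg k S A D).
Local Notation I := [set x | tm_surj (x : D) = 0].
Local Notation J := (setadd (setmul (G 1%N) I) (setmul I (G 1%N))).
Implicit Types (x y : D) (R : set D).
Let hG := tm_direct_sum D.
Let GM := @tm_degM k S A D.

Lemma I_ideal : two_sided_ideal I.
Proof.
split; first split=> [|x y]; rewrite /=; first exact: morphB0 (@tm_surjB k S A D).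
  by move=> x0 y0; rewrite tm_surjB x0 y0 subrr.
by move=> a x x0; rewrite /= !tm_surjM x0 mulr0 mul0r.
Qed.

Lemma subgroup_I : subgroup I. Proof. by case: I_ideal. Qed.
Lemma I_Ml a x : I x -> I (a * x). Proof. by case: I_ideal => _ /(_ a x) h /h[]. Qed.
Lemma I_Mr a x : I x -> I (x * a). Proof. by case: I_ideal => _ /(_ a x) h /h[]. Qed.

Lemma tm_surj_hcomp n x : tm_surj (hcomp G n x) = hcomp (@deg k S A) n (tm_surj x).
Proof.
have hA := deg_direct_sum A.
pose N := [set x | tm_surj (hcomp G n x) = hcomp (@deg k S A) n (tm_surj x)].
suff : N x by [].
apply: (graded_ind hG) => [|i]; rewrite /N /=.
  have c0 := morphB0 (@tm_surjB k S A D).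
  split=> [|y z /= ey ez] /=; first by rewrite (hcomp0 hG) c0 (hcomp0 hA).
  by rewrite (hcompB hG) !tm_surjB ey ez (hcompB hA).
rewrite (hcompK hG) (hcomp_id hA n (tm_surj_deg (hcomp_in hG i x))).
by case: eqP => // _; exact: morphB0 (@tm_surjB k S A D).
Qed.

Lemma homogeneous_I : homogeneous G I.
Proof.
move=> n x; rewrite /= tm_surj_hcomp => ->.
exact: hcomp0 (deg_direct_sum A) n.
Qed.

Lemma I_low n x : (n <= 1)%N -> I x -> hcomp G n x = 0.
Proof.
by move=> n1 Ix; apply: (tm_surj_inj01 n1 (hcomp_in hG n x)); exact: homogeneous_I.
Qed.

Lemma homogeneous_deg n : homogeneous G (G n).
Proof.
move=> m x Gx; rewrite (hcomp_id hG m Gx); case: eqP => // _.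
by case: (tm_subbimod D n) => /subgroup0.
Qed.

Lemma homogeneous_J : homogeneous G J.
Proof.
apply: (homogeneous_setadd hG); apply: (homogeneous_setmul hG GM);
  by [exact: homogeneous_I|exact: homogeneous_deg].
Qed.

Lemma is_subbimod_J : is_subbimod J.
Proof.
have bI := ideal_subbimod I_ideal.
by apply: is_subbimod_setadd; apply: is_subbimod_setmul => //; exact: tm_subbimod.
Qed.

Lemma J_sub_I : J `<=` I.
Proof.
have sI := subgroup_I.
move=> _ [x Jx [y Jy ->]]; apply: (subgroupD sI); move: x Jx y Jy => x Jx y Jy.
  by move: Jx; apply: setmul_sub => // a b _; exact: I_Ml.
by move: Jy; apply: setmul_sub => // a b; move=> Ia _; exact: I_Mr.
Qed.

Definition relations_of R : Prop :=
  [/\ is_subbimod R, homogeneous G R, R `<=` I, I = setadd R J & R `&` J = [set 0]].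

(** A bimodule projection [p] onto V I + I V need not respect degrees. [R] is the kernel on I of its
    degree-preserving part, which is again a projection because V I + I V is homogeneous. *)
Lemma relations_exist : separable S ->
  exists R, relations_of R.
Proof.
move=> hS; have [sI lI rI] := ideal_subbimod I_ideal.
have [p [[pD pl pr] pJ pid]] := bimod_projection hS is_subbimod_J.
have pB : {morph p : x y / x - y} by apply: morphDB => x y; exact: pD.
have [sJ lJ rJ] := is_subbimod_J.
pose R := [set x | I x /\ forall n, hcomp G n (p (hcomp G n x)) = 0].
have hl n s x : hcomp G n (s *> x) = s *> hcomp G n x.
  exact: (hcomp_lact hG (tm_subbimod D)).
have hr n s x : hcomp G n (x <* s) = hcomp G n x <* s.
  exact: (hcomp_ract hG (tm_subbimod D)).
have sR : subgroup R.
  split=> [|x y [Ix px] [Iy py]]; split.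
  - exact: (subgroup0 sI).
  - by move=> n; rewrite (hcomp0 hG) (morphB0 pB) (hcomp0 hG).
  - exact: (subgroupB sI Ix Iy).
  - by move=> n; rewrite (hcompB hG) pB (hcompB hG) px py subrr.
exists R; split.
- split=> // s x [Ix px]; split; [exact: lI| |exact: rI|].
    by move=> n; rewrite hl pl // hl px (morphB0 (lactB s)).
  by move=> n; rewrite hr pr // hr px (morphB0 (ractB s)).
- move=> n x [Ix px]; split; first exact: homogeneous_I.
  move=> m; rewrite (hcompK hG); case: eqP => [->|_]; first exact: px.
  by rewrite (morphB0 pB) (hcomp0 hG).
- by move=> x [].
- apply/seteqP; split=> [x Ix|_ [x [Ix _] [y Jy ->]]]; last first.
    by apply: (subgroupD sI) => //; exact: J_sub_I.
  apply: (graded_ind hG) => [|n]; first exact: subgroup_setadd.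
  have In := @homogeneous_I n x Ix.
  pose j := hcomp G n (p (hcomp G n x)).
  have Jj : J j by apply: homogeneous_J; exact: pJ.
  exists (hcomp G n x - j); last by exists j => //; rewrite subrK.
  split; first by apply: (subgroupB sI) => //; exact: J_sub_I.
  move=> m; rewrite (hcompB hG) (hcompK hG) (hcompK hG).
  case: eqP => [->|_]; last by rewrite subr0 (morphB0 pB) (hcomp0 hG).
  by rewrite -/j pB (pid j Jj) (hcompB hG) -/j {2}/j (hcompK hG) eqxx subrr.
- apply/seteqP; split=> [x [[Ix px] Jx]|_ ->]; last first.
    by split; [exact: (subgroup0 sR)|exact: (subgroup0 sJ)].
  apply: (hcomp_inj hG) => n; rewrite (hcomp0 hG) -(px n).
  by rewrite (pid _ (homogeneous_J n Jx)) (hcompK hG) eqxx.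
Qed.

Section GivenRelations.
Variables (R : set D) (hR : relations_of R).

Lemma relations_subbimod : is_subbimod R. Proof. by case: hR. Qed.
Lemma relations_homogeneous : homogeneous G R. Proof. by case: hR => _ h. Qed.
Lemma relations_sub : R `<=` I. Proof. by case: hR. Qed.
Lemma relations_J x : R x -> J x -> x = 0.
Proof.
by case: hR => _ _ _ _ RJ Rx Jx; move: (conj Rx Jx : (R `&` J) x); rewrite RJ.
Qed.

(** Induction on the degree: modulo [R], an element of I is a sum of products of a letter with
    elements of I, and these have one degree less. *)
Lemma relations_gen : ideal_gen R = I.
Proof.
apply/seteqP; split; first exact: (ideal_gen_sub I_ideal relations_sub).
move=> x Ix; have sR := subgroup_ideal_gen R.
apply: (graded_ind hG) => // n; elim/ltn_ind: n x Ix => n IHn x Ix.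
have [y Ry [_ [j Jj [j' Jj' ->]] ->]] : setadd R J x by case: hR => _ _ _ <-.
rewrite !(hcompD hG); apply: (subgroupD sR).
  by apply: sub_ideal_gen; exact: relations_homogeneous.
apply: (subgroupD sR).
  suff : setmul (G 1%N) I `<=` [set j | ideal_gen R (hcomp G n j)] by exact.
  apply: setmul_sub => [|v i Gv Ii] /=.
    split=> [|a b /= ha hb] /=; first by rewrite (hcomp0 hG); exact: (subgroup0 sR).
    by rewrite (hcompB hG); exact: (subgroupB sR ha hb).
  rewrite (hcompMl hG GM n i Gv); case: ifP => n1; last exact: (subgroup0 sR).
  by apply: ideal_genMl; apply: IHn => //; lia.
suff : setmul I (G 1%N) `<=` [set j | ideal_gen R (hcomp G n j)] by exact.
apply: setmul_sub => [|i v Ii Gv] /=.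
  split=> [|a b /= ha hb] /=; first by rewrite (hcomp0 hG); exact: (subgroup0 sR).
  by rewrite (hcompB hG); exact: (subgroupB sR ha hb).
rewrite (hcompMr hG GM n i Gv); case: ifP => n1; last exact: (subgroup0 sR).
by apply: ideal_genMr; apply: IHn => //; lia.
Qed.

End GivenRelations.
End Relations.

(** * Govorov's resolution *)

Fact gcls_key : unit. Proof. by []. Qed.

Section IdealQuotients.
Variables (k : fieldType) (S : algType k) (A : conn_sring S) (D : tensor_model A).
Local Notation G := (@tm_deg k S A D).
Local Notation I := [set x | tm_surj (x : D) = 0].
Implicit Types (x y t : D).
Let hG := tm_direct_sum D.
Let GM := @tm_degM k S A D.

Lemma tm_ind (P : set D) : subgroup P -> (forall s, P (s *> 1)) ->
  (forall v t, G 1%N v -> P t -> P (v * t)) -> forall t, P t.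
Proof.
move=> sP PS PV t; apply: (graded_ind hG) => // n.
have : G n `<=` P; last by apply; exact: hcomp_in.
elim: n => [x /tm_deg0E[s ->]|n IHn] //; rewrite tm_degSl.
by apply: setmul_sub => // v x Gv /IHn; exact: PV.
Qed.

Record graded_ideal := GradedIdeal {
  gi_set :> set D;
  gi_subbimod : is_subbimod gi_set;
  gi_mull : forall t x, gi_set x -> gi_set (t * x);
  gi_homogeneous : homogeneous G gi_set
}.

Lemma subgroup_gi (N : graded_ideal) : subgroup N.
Proof. by case: (gi_subbimod N). Qed.

Lemma gi_mulI_subproof (N : graded_ideal) :
  [/\ is_subbimod (setmul I N), forall t x, setmul I N x -> setmul I N (t * x)
    & homogeneous G (setmul I N)].
Proof.
have hI := @I_ideal k S A D; split.
- exact: is_subbimod_setmul (ideal_subbimod hI) (gi_subbimod N).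
- move=> t; suff : setmul I N `<=` [set x | setmul I N (t * x)] by exact.
  apply: setmul_sub => [|x y Ix Ny] /=.
    split=> [|x y /= tx ty] /=; first by rewrite mulr0; exact: subgroup0 (subgroup_setmul _ _).
    by rewrite mulrBr; exact: (subgroupB (subgroup_setmul _ _) tx ty).
  by rewrite mulrA; apply: setmul_mem => //; exact: I_Ml.
- apply: (homogeneous_setmul hG GM); last exact: gi_homogeneous.
  exact: (@homogeneous_I k S A D).
Qed.

Definition gi_mulI (N : graded_ideal) : graded_ideal :=
  let: And3 b l h := gi_mulI_subproof N in GradedIdeal b l h.

Lemma gi_mulIE (N : graded_ideal) : gi_mulI N = setmul I N :> set D.
Proof. by rewrite /gi_mulI; case: gi_mulI_subproof. Qed.

Lemma tm_surj_lift (a : A) : {x : D | tm_surj x = a}.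
Proof.
apply: cid; apply: (graded_ind (deg_direct_sum A) (N := [set a | exists x : D, tm_surj x = a])).
  split=> [|_ _ [x <-] [y <-]]; first by exists 0; exact: morphB0 (@tm_surjB _ _ _ D).
  by exists (x - y); rewrite tm_surjB.
by move=> n; have [x _ <-] := tm_surj_onto D (hcomp_in (deg_direct_sum A) n a); exists x.
Qed.

Lemma tm_surj_liftP (a : A) : exists t : D, a = tm_surj t.
Proof. by case: (tm_surj_lift a) => t <-; exists t. Qed.

Section Quotient.
Variable Ng : graded_ideal.
Local Notation N := (gi_set Ng).
Local Notation IN := (gi_set (gi_mulI Ng)).

Definition gip : {pred D} := fun x => `[< N x >].
Lemma gip_closed : zmod_closed gip.
Proof.
split=> [|x y /asboolP Nx /asboolP Ny]; apply/asboolP; first exact: subgroup0 (subgroup_gi Ng).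
exact: (subgroupB (subgroup_gi Ng)).
Qed.
HB.instance Definition _ := GRing.isZmodClosed.Build D gip gip_closed.

Definition gi_sub : Type := {x : D | gip x}.
HB.instance Definition _ := [isSub of gi_sub for @sval D gip].
HB.instance Definition _ := [Choice of gi_sub by <:].
HB.instance Definition _ := [SubChoice_isSubZmodule of gi_sub by <:].

Definition gi_rel : set gi_sub := [set u | IN (val u)].

(* N / I N, a left module over A = T / I *)
Definition gquot : Type := zquot gi_rel.
HB.instance Definition _ := GRing.Zmodule.on gquot.

(* the class of x; only meaningful for x in N *)
Definition gcls_def x : gquot := zpi gi_rel (insubd (0 : gi_sub) x).
Definition grep_def (q : gquot) : D := val (repr (q : Quotient.quot (zspanp gi_rel))).
Definition gcls := locked_with gcls_key gcls_def.
Definition grep := locked_with gcls_key grep_def.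
Lemma gclsE : gcls = gcls_def. Proof. exact: unlock. Qed.
Lemma grepE : grep = grep_def. Proof. exact: unlock. Qed.

Lemma val_insubd_gi x : N x -> val (insubd (0 : gi_sub) x) = x.
Proof. by move=> Nx; rewrite insubdK //; exact/asboolP. Qed.

Lemma grepP q : N (grep q).
Proof.
rewrite grepE; exact/asboolP/(valP (repr (q : Quotient.quot (zspanp gi_rel)))).
Qed.

Lemma grepK q : gcls (grep q) = q.
Proof. by rewrite gclsE grepE /gcls_def /grep_def valKd; exact: zpi_repr. Qed.

Lemma gcls_eq x y : N x -> N y -> gcls x = gcls y <-> IN (x - y).
Proof.
move=> Nx Ny; have sR : subgroup gi_rel.
  split=> [|u v]; rewrite /gi_rel /=; first exact: subgroup0 (subgroup_gi _).
  exact: (subgroupB (subgroup_gi _)).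
by rewrite gclsE /gcls_def zpiP (zspan_id sR) /gi_rel /= !val_insubd_gi.
Qed.

Lemma gclsB x y : N x -> N y -> gcls (x - y) = gcls x - gcls y.
Proof.
move=> Nx Ny; rewrite gclsE /gcls_def -zpiB; congr (zpi _ _); apply: val_inj => /=.
have Nxy : N (x - y) by exact: (subgroupB (subgroup_gi Ng)).
rewrite val_insubd_gi //.
change (x - y = val (insubd (0 : gi_sub) x) - val (insubd (0 : gi_sub) y)).
by rewrite !val_insubd_gi.
Qed.

Lemma gcls0 : gcls 0 = 0.
Proof. by have N0 := subgroup0 (subgroup_gi Ng); have := gclsB N0 N0; rewrite !subrr. Qed.

Lemma gclsD x y : N x -> N y -> gcls (x + y) = gcls x + gcls y.
Proof.
move=> Nx Ny; have sN := subgroup_gi Ng; have N0 := subgroup0 sN.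
have NNy := subgroupN sN Ny.
by rewrite -{1}[y]opprK gclsB // -[- y]sub0r gclsB // gcls0 sub0r opprK.
Qed.

Lemma gcls_sum n (c : nat -> D) : (forall i, N (c i)) ->
  gcls (\sum_(i < n) c i) = \sum_(i < n) gcls (c i).
Proof.
move=> Nc; have sN := subgroup_gi Ng.
elim: n => [|n IHn]; first by rewrite !big_ord0 gcls0.
by rewrite !big_ord_recr /= gclsD ?IHn //; apply: (subgroup_sum sN).
Qed.

Lemma gcls_eq0 x : N x -> gcls x = 0 <-> IN x.
Proof.
move=> Nx; rewrite -gcls0 gcls_eq ?subr0 //; exact: subgroup0 (subgroup_gi Ng).
Qed.

Definition gscale (a : A) (q : gquot) : gquot := gcls (sval (tm_surj_lift a) * grep q).

(** Another lift of the scalar differs from [t] by an element of I, which sends N into I N. *)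
Lemma gscaleE t x : N x -> gscale (tm_surj t) (gcls x) = gcls (t * x).
Proof.
move=> Nx; rewrite /gscale; case: tm_surj_lift => u /= eu.
have Nr := grepP (gcls x); apply/gcls_eq; try exact: gi_mull.
have sI := subgroup_gi (gi_mulI Ng).
have e1 : IN (grep (gcls x) - x) by apply/gcls_eq => //; rewrite grepK.
rewrite -(subrK (u * x) (u * _)) -mulrBr -addrA -mulrBl; apply: (subgroupD sI).
  exact: gi_mull.
rewrite gi_mulIE; apply: setmul_mem => //=.
by rewrite tm_surjB eu subrr.
Qed.

Lemma gquotP (q : gquot) : exists2 x, N x & q = gcls x.
Proof. by exists (grep q); [exact: grepP|rewrite grepK]. Qed.

Fact gquot_lmod_axioms : GRing.Zmodule_isLmodule A gquot.
Proof.
apply: (GRing.Zmodule_isLmodule.Build A gquot (scale := gscale)).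
- move=> a b q; have [x Nx ->] := gquotP q; have [t ->] := tm_surj_liftP a.
  have [u ->] := tm_surj_liftP b.
  rewrite -tm_surjM !gscaleE ?mulrA //; exact: gi_mull.
- move=> q; have [x Nx ->] := gquotP q.
  by rewrite -(tm_surj1 D) gscaleE // mul1r.
- move=> a q r; have [x Nx ->] := gquotP q; have [y Ny ->] := gquotP r.
  have [t ->] := tm_surj_liftP a.
  have Nxy : N (x + y) by exact: (subgroupD (subgroup_gi Ng)).
  rewrite -gclsD // !gscaleE // mulrDr gclsD //; exact: gi_mull.
- move=> q a b; have [x Nx ->] := gquotP q; have [t ->] := tm_surj_liftP a.
  have [u ->] := tm_surj_liftP b.
  rewrite -(morphBD (@tm_surjB _ _ _ D)) !gscaleE // mulrDl gclsD //; exact: gi_mull.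
Defined.
HB.instance Definition _ := gquot_lmod_axioms.

Lemma gcls_scale t x : N x -> tm_surj t *: gcls x = gcls (t * x).
Proof. exact: gscaleE. Qed.

(** Vanishing on I N need not be assumed separately: I acts as 0 on [E], so compatibility with
    scalars forces it. *)
Lemma gquot_lift (E : lmodType A) (h : D -> E) :
  (forall x y, N x -> N y -> h (x - y) = h x - h y) ->
  (forall t x, N x -> h (t * x) = tm_surj t *: h x) ->
  exists H : {linear gquot -> E}, forall x, N x -> H (gcls x) = h x.
Proof.
move=> hB hM; have sN := subgroup_gi Ng; have N0 := subgroup0 sN.
have h0 : h 0 = 0 by have := hB _ _ N0 N0; rewrite !subrr.
have hD x y : N x -> N y -> h (x + y) = h x + h y.
  move=> Nx Ny; have NNy := subgroupN sN Ny.
  by rewrite -{1}[y]opprK hB // -[- y]sub0r hB // h0 sub0r opprK.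
pose N' := [set x | N x /\ h x = 0].
have hI x : IN x -> h x = 0.
  suff : IN `<=` N' by move=> sub /sub[].
  rewrite gi_mulIE; apply: setmul_sub => [|x' y /= Ix Ny].
    split=> [|x' y [Nx hx] [Ny hy]]; split=> //; first exact: (subgroupB sN).
    by rewrite hB // hx hy subrr.
  by split; [exact: gi_mull|rewrite hM // Ix scale0r].
have He x : N x -> h (grep (gcls x)) = h x.
  move=> Nx; apply/eqP; rewrite -subr_eq0 -hB //; last exact: grepP.
  by apply/eqP/hI/gcls_eq => //; [exact: grepP|rewrite grepK].
pose H (q : gquot) : E := h (grep q).
have Hl : linear H.
  move=> a q r; have [x Nx ->] := gquotP q; have [y Ny ->] := gquotP r.
  case: (tm_surj_lift a) => t <-.
  have Ntx : N (t * x) by exact: gi_mull.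
  have Ns : N (t * x + y) by exact: (subgroupD sN).
  by rewrite /H gcls_scale // -gclsD // !He // hD // hM.
exists (HB.pack_for {linear gquot -> E} H (GRing.isLinear.Build A gquot E *:%R H Hl)).
exact: He.
Qed.

End Quotient.
End IdealQuotients.
Arguments gcls {k S A D} Ng x.

Section Resolution.
Variables (k : fieldType) (S : algType k) (A : conn_sring S) (D : tensor_model A).
Hypothesis hS : separable S.
Local Notation G := (@tm_deg k S A D).
Implicit Types (x y t : D) (N : graded_ideal D).
Let hG := tm_direct_sum D.
Let GM := @tm_degM k S A D.

Definition gq_deg N (n : nat) : set (gquot N) :=
  [set q | exists x, [/\ gi_set N x, G n x & q = gcls N x]].
Arguments gq_deg : clear implicits.

(** The degrees stay independent in N / I N because I N is homogeneous along with N. *)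
Lemma gq_direct_sum N : direct_sum_of (gq_deg N).
Proof.
have sN := subgroup_gi N; have N0 := subgroup0 sN.
have sG n : subgroup (G n) := direct_sum_subgroup hG n.
split.
- move=> n; split=> [|_ _ [x [Nx Gx ->]] [y [Ny Gy ->]]].
    by exists 0; split; [|exact: subgroup0 (sG n)|rewrite gcls0].
  exists (x - y); split; [exact: (subgroupB sN)|exact: (subgroupB (sG n))|].
  by rewrite gclsB.
- move=> q; have [x Nx ->] := gquotP q; have [m ex _] := direct_sumP hG x.
  have Nc i : gi_set N (hcomp G i x) by exact: gi_homogeneous.
  exists m, (fun i => gcls N (hcomp G i x)); split=> [i|].
    by exists (hcomp G i x); split=> //; exact: hcomp_in.
  by rewrite {1}ex (gcls_sum _ Nc).
- move=> n c /choice[d dP] c0 i.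
  have Nd j : gi_set N (d j) by case: (dP j).
  have Gd j : G j (d j) by case: (dP j).
  have ec j : c j = gcls N (d j) by case: (dP j).
  rewrite ec; apply/gcls_eq0 => //.
  have -> : d i = hcomp G i (\sum_(j < n) d j).
    by rewrite (hcompE hG i Gd erefl) ltn_ord.
  apply: gi_homogeneous; apply/gcls_eq0; first exact: (subgroup_sum sN).
  by rewrite (gcls_sum _ Nd) -[RHS]c0; apply: eq_bigr => j _.
Qed.

Lemma gq_scale N m n (a : A) (q : gquot N) :
  deg m a -> gq_deg N n q -> gq_deg N (m + n)%N (a *: q).
Proof.
move=> /(tm_surj_onto D)[t Gt <-] [x [Nx Gx ->]]; exists (t * x).
by split; [exact: gi_mull|exact: GM|rewrite gcls_scale].
Qed.

Definition gq N : graded_module A :=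
  @GradedModule k S A (gquot N) (gq_deg N) (gq_direct_sum N) (@gq_scale N).

(* T is hereditary relative to S: an S-linear lift h0 of g fails to be T-linear
   by a cocycle delta, which extends from N to T because N is a direct summand
   of T over S, and is a coboundary there by tm_left_derivation. *)
Lemma gquot_projective N : projective_module (gquot N).
Proof.
move=> E E' f g fsurj.
pose aE (s : S) (e : E) := (s *> 1 : A) *: e; pose aE' (s : S) (e : E') := (s *> 1 : A) *: e.
have unitD (s t : S) : (s + t) *> (1 : A) = s *> 1 + t *> 1 by exact: lactDl.
have unitM (s t : S) : (s * t) *> (1 : A) = (s *> 1) * (t *> 1) by rewrite -lactE lactA.
have mE : left_module aE.
  split=> [s|s t e|s t e|e]; rewrite /aE.
  - by move=> d e; rewrite scalerBr.
  - by rewrite unitD scalerDl.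
  - by rewrite unitM scalerA.
  - by rewrite lact1 scale1r.
have mE' : left_module aE'.
  split=> [s|s t e|s t e|e]; rewrite /aE'.
  - by move=> d e; rewrite scalerBr.
  - by rewrite unitD scalerDl.
  - by rewrite unitM scalerA.
  - by rewrite lact1 scale1r.
have [|||sig [sigB sigl sigK]] := left_section hS mE mE' (f := f).
- by move=> d e; rewrite linearB.
- by move=> s e; rewrite /aE linearZ.
- exact: fsurj.
have [q [[qD ql qr] qN qid]] := bimod_projection hS (gi_subbimod N).
have qB : {morph q : x y / x - y} by apply: morphDB => x y; exact: qD.
have usurj s : tm_surj (s *> 1 : D) = s *> 1 by rewrite tm_surj_lact tm_surj1.
have cl s x : gi_set N x -> gcls N (s *> x) = (s *> 1 : A) *: gcls N x.
  by move=> Nx; rewrite lactE -gcls_scale // usurj.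
pose h0 x := sig (g (gcls N (q x))).
have h0B : {morph h0 : x y / x - y}.
  by move=> x y; rewrite /h0 qB gclsB // linearB sigB.
have h0l s x : h0 (s *> x) = aE s (h0 x).
  by rewrite /h0 ql // cl // linearZ sigl.
pose act t (e : E) := tm_surj t *: e.
(* For [x] in [N] this is the failure of [h0] to commute with [v]; inserting [q] extends it to all
   of T. *)
pose delta v x := h0 (v * q x) - act v (h0 x).
have h0q x : h0 (q x) = h0 x by rewrite /h0 qid.
have [||||||||gam [gamB gam1 gaml gamV]] := @tm_left_derivation _ _ _ D E act delta.
- by move=> t d e; rewrite /act scalerBr.
- by move=> t u e; rewrite /act tm_surjB scalerBl.
- by move=> t u e; rewrite /act tm_surjM scalerA.
- by move=> e; rewrite /act tm_surj1 scale1r.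
- by move=> v x y; rewrite /delta /act qB mulrBr !h0B scalerBr subrACA.
- move=> v w x; rewrite /delta /act mulrDl (morphBD h0B) (morphBD (@tm_surjB _ _ _ D)).
  by rewrite scalerDl opprD addrACA.
- move=> s v x; rewrite /delta /act -lactMl h0l tm_surj_lact usurj /aE scalerBr.
  by rewrite [s *> tm_surj v]lactE scalerA.
- move=> v s x; rewrite /delta /act ql // h0l ractMlact ractE tm_surjM usurj.
  by rewrite /aE scalerA.
(* On [N] the inhomogeneous term in the recursion for [gam] is exactly the defect of [h0], so the
   difference is compatible with letters. *)
pose h x := h0 x - gam x.
have hB : {morph h : x y / x - y} by move=> x y; rewrite /h h0B gamB subrACA.
have hM t x : gi_set N x -> h (t * x) = tm_surj t *: h x.
  move=> Nx; pose P := [set t | h (t * x) = tm_surj t *: h x].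
  suff : P t by [].
  apply: tm_ind => [|s|v u Gv]; rewrite /P /=.
  - split=> [|u v /= eu ev] /=.
      by rewrite mul0r (morphB0 hB) (morphB0 (@tm_surjB _ _ _ D)) scale0r.
    by rewrite mulrBl hB eu ev tm_surjB scalerBl.
  - by rewrite -lactE usurj /h h0l gaml /act usurj /aE scalerBr.
  - move=> eu; have Nux : gi_set N (u * x) by exact: gi_mull.
    rewrite -mulrA tm_surjM -scalerA -eu {1}/h gamV // /delta qid // /act /h.
    by rewrite scalerBr opprD opprB addrCA [X in _ + X = _]addrC subrK addrC.
(* After [f], the map [h0] becomes [g] of the class of [q x], which is already linear on [N]; so [f]
   kills [delta] and with it [gam], and [h] still lifts [g]. *)
have fgam x : f (gam x) = 0.
  pose P := [set x | f (gam x) = 0]; suff : P x by [].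
  apply: tm_ind => [|s|v u Gv]; rewrite /P /=.
  - split=> [|u v /= eu ev] /=; first by rewrite (morphB0 gamB) linear0.
    by rewrite gamB linearB eu ev subrr.
  - by rewrite gaml gam1 /act scaler0 linear0.
  - move=> eu; rewrite gamV // linearD /act linearZ /= eu scaler0 add0r /delta linearB.
    rewrite /act linearZ /= /h0 !sigK; have Nvq : gi_set N (v * q u) by exact: gi_mull.
    by rewrite qid // -gcls_scale // linearZ subrr.
have [|H HE] := @gquot_lift _ _ _ _ N E h (fun x y _ _ => hB x y).
  by move=> t x; exact: hM.
exists H => r; have [x Nx ->] := gquotP r.
by rewrite HE // /h linearB /= fgam subr0 /h0 sigK qid.
Qed.

End Resolution.

Section Govorov.
Variables (k : fieldType) (S : algType k) (A : conn_sring S) (D : tensor_model A).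
Hypothesis hS : separable S.
Local Notation G := (@tm_deg k S A D).
Local Notation I := [set x | tm_surj (x : D) = 0].
Implicit Types (x y t : D) (N : graded_ideal D).
Let hG := tm_direct_sum D.
Let GM := @tm_degM k S A D.

Definition tplus : set D := [set x | hcomp G 0 x = 0].

Lemma gi_top_subproof : [/\ is_subbimod (setT : set D),
  forall t x, setT x -> setT (t * x) & homogeneous G setT].
Proof. by split; first split=> //; split. Qed.

Lemma gi_plus_subproof : [/\ is_subbimod tplus,
  forall t x, tplus x -> tplus (t * x) & homogeneous G tplus].
Proof.
split; [apply: ideal_subbimod; split; first split=> [|x y]| |]; rewrite /tplus /=.
- exact: hcomp0.
- by move=> x0 y0; rewrite (hcompB hG) x0 y0 subrr.
- by move=> t x x0; rewrite !(hcomp0M hG GM) x0 mulr0 mul0r.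
- by move=> t x x0; rewrite (hcomp0M hG GM) x0 mulr0.
- by move=> n x x0; rewrite /= (hcompK hG); case: eqP => [<-|].
Qed.

Definition gi_top : graded_ideal D :=
  let: And3 b l h := gi_top_subproof in GradedIdeal b l h.
Definition gi_plus : graded_ideal D :=
  let: And3 b l h := gi_plus_subproof in GradedIdeal b l h.
Lemma gi_topE : gi_top = setT :> set D.
Proof. by rewrite /gi_top; case: gi_top_subproof. Qed.
Lemma gi_plusE : gi_plus = tplus :> set D.
Proof. by rewrite /gi_plus; case: gi_plus_subproof. Qed.

(* T, T_+, I, I T_+, I^2, I^2 T_+, ...: the terms of Govorov's resolution are
   the quotients of each by the one two places further. *)
Fixpoint gseq (i : nat) : graded_ideal D :=
  match i with
  | 0 => gi_top
  | 1 => gi_plus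
  | j.+2 => gi_mulI (gseq j)
  end.

Lemma gseq_sub i : gi_set (gseq i.+1) `<=` gi_set (gseq i).
Proof.
suff : gi_set (gseq i.+1) `<=` gi_set (gseq i) /\ gi_set (gseq i.+2) `<=` gi_set (gseq i.+1).
  by case.
elim: i => [|i [IH1 IH2]]; split=> //.
- by rewrite /= gi_topE.
- rewrite /= gi_plusE gi_mulIE gi_topE; apply: setmul_sub => [|x y Ix _].
    by case: gi_plus_subproof => -[].
  by rewrite /tplus /= (hcomp0M hG GM) (I_low (leq0n 1) Ix) mul0r.
- rewrite [gseq i.+3]/(gi_mulI (gseq i.+1)) [gseq i.+2]/(gi_mulI (gseq i)) !gi_mulIE.
  exact: setmulS.
Qed.

Lemma gres_d_subproof i : exists d : {linear gquot (gseq i.+1) -> gquot (gseq i)},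
  forall x, gi_set (gseq i.+1) x -> d (gcls (gseq i.+1) x) = gcls (gseq i) x.
Proof.
apply: gquot_lift => [x y /gseq_sub Nx /gseq_sub Ny|t x /gseq_sub Nx]; first exact: gclsB.
by rewrite gcls_scale.
Qed.

Definition gres_d i : {linear gquot (gseq i.+1) -> gquot (gseq i)} :=
  sval (cid (gres_d_subproof i)).
Lemma gres_dE i x : gi_set (gseq i.+1) x ->
  gres_d i (gcls (gseq i.+1) x) = gcls (gseq i) x.
Proof. exact: (svalP (cid (gres_d_subproof i))). Qed.

Definition gres_e (q : gquot (gseq 0)) : S := augmentation (tm_surj (grep q)).

Lemma gi_topT x : gi_set (gseq 0) x. Proof. by rewrite /= gi_topE. Qed.

Lemma gres_eE x : gres_e (gcls (gseq 0) x) = augmentation (tm_surj x).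
Proof.
rewrite /gres_e; congr augmentation; apply/eqP; rewrite -subr_eq0 -tm_surjB; apply/eqP.
have : gi_set (gi_mulI (gseq 0)) (grep (gcls (gseq 0) x) - x).
  by apply/gcls_eq; [exact: gi_topT|exact: gi_topT|rewrite grepK].
rewrite gi_mulIE; apply: (setmul_sub (N := I)); first exact: (@subgroup_I _ _ _ D).
by move=> i y Ii _; exact: I_Mr.
Qed.

Lemma tplusP x : tplus x <-> augmentation (tm_surj x) = 0.
Proof.
have e : augmentation (tm_surj x) *> 1 = tm_surj (hcomp G 0 x).
  by rewrite augmentationP tm_surj_hcomp.
split=> [x0|a0].
  by apply: (@unit_inj _ _ A); rewrite e x0 (morphB0 (@tm_surjB _ _ _ D)) lact0l.
by apply: (tm_surj_inj01 (leq0n 1) (hcomp_in hG 0 x)); rewrite -e a0 lact0l.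
Qed.

Lemma gres_eD (q r : gquot (gseq 0)) : gres_e (q + r) = gres_e q + gres_e r.
Proof.
have [x Nx ->] := gquotP q; have [y Ny ->] := gquotP r.
by rewrite -gclsD // !gres_eE (morphBD (@tm_surjB _ _ _ D)) (morphBD (@augmentationB _ _ A)).
Qed.

Lemma gres_eZ (a : A) (q : gquot (gseq 0)) : gres_e (a *: q) = augmentation a * gres_e q.
Proof.
have [x Nx ->] := gquotP q; have [t ->] := tm_surj_liftP D a.
by rewrite gcls_scale // !gres_eE tm_surjM augmentationM.
Qed.

Lemma gres_e_deg n (q : gquot (gseq 0)) : @gdeg _ _ _ (gq (gseq 0)) n.+1 q -> gres_e q = 0.
Proof.
by move=> [x [Nx Gx ->]]; rewrite gres_eE (augmentation_deg (tm_surj_deg Gx)).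
Qed.

Lemma gres_e_surj s : exists q, gres_e q = s.
Proof.
exists (gcls (gseq 0) (s *> 1)).
by rewrite gres_eE tm_surj_lact tm_surj1 augmentation_unit.
Qed.

Lemma gres_exact0 q : gres_e q = 0 <-> exists r, gres_d 0 r = q.
Proof.
have [x Nx ->] := gquotP q; rewrite gres_eE; split=> [/tplusP x0|[r]].
  by exists (gcls (gseq 1) x); rewrite gres_dE //= gi_plusE.
have [y Ny ->] := gquotP r; rewrite gres_dE // => e.
rewrite -gres_eE -e gres_eE; apply/tplusP.
by move: Ny; rewrite /= gi_plusE.
Qed.

(** With N_j for [gseq j], the differentials N_(j+1) / N_(j+3) -> N_j / N_(j+2) come from
    inclusions. The kernel for j = i and the image for j = i + 1 are therefore both N_(i+2) /
    N_(i+3). *)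
Lemma gres_exact i q : gres_d i q = 0 <-> exists r, gres_d i.+1 r = q.
Proof.
have [x Nx ->] := gquotP q; rewrite gres_dE //.
have Nx' := gseq_sub Nx; split=> [/(gcls_eq0 Nx') x0|[r]].
  by exists (gcls (gseq i.+2) x); rewrite gres_dE.
have [y Ny ->] := gquotP r; rewrite gres_dE // => e.
have Ny' := gseq_sub Ny.
by rewrite -gres_dE // -e gres_dE //; apply/gcls_eq0 => //; exact: gseq_sub.
Qed.

Lemma gres_d_deg i n (q : gq (gseq i.+1)) :
  gdeg n q -> @gdeg _ _ _ (gq (gseq i)) n (gres_d i q).
Proof.
move=> [x [Nx Gx ->]]; exists x; split=> //; first exact: gseq_sub.
exact: gres_dE.
Qed.

Definition govorov : graded_resolution A :=
  @GradedResolution k S A (fun i => gq (gseq i)) gres_d gres_e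
    (fun i => @gquot_projective _ _ _ D hS (gseq i)) gres_d_deg gres_eD gres_eZ gres_e_deg
    gres_e_surj gres_exact0 gres_exact.

End Govorov.

(** * Tor in degree three *)

Section StensorFacts.
Variables (k : fieldType) (S : algType k) (A : conn_sring S).
Implicit Types (X Y : lmodType A).

Lemma Stensor_mapB X Y (d : {linear X -> Y}) :
  {morph Stensor_map d : z w / z - w}.
Proof.
pose F (p : S * X) := pure p.1 (d p.2).
have gen t y : free_ext F (pair_gen t y) = pure t (d y) by rewrite /pair_gen free_extU.
have mapE g : Stensor_map d (zpi (@Stensor_rel _ _ _ X) g) = free_ext F g.
  rewrite /Stensor_map zquot_lift_repr // => _ [] *.
  - by rewrite raddfB raddfD /= !gen pureDl subrr.
  - by rewrite raddfB raddfD /= !gen linearD pureDr subrr.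
  - by rewrite raddfB /= !gen linearZ /= pureM subrr.
move=> z w; rewrite -(zpi_repr z) -(zpi_repr w) -zpiB.
by rewrite !mapE raddfB.
Qed.

Lemma Stensor_ind X (P : set (Stensor X)) : subgroup P ->
  (forall s x, P (pure s x)) -> forall z, P z.
Proof.
move=> sP Pp z; rewrite -(zpi_repr z); move: (repr _) => g; rewrite (monalgE g).
rewrite (morphB_sum (@zpiB _ _)); apply: (subgroup_sum sP) => -[s x].
move: (mcoeff _ g) => c.
have -> : mkmalgU (s, x) c = pair_gen s x *~ c by rewrite /pair_gen -raddfMz intz.
rewrite (raddfMz (zpi (@Stensor_rel _ _ _ X))) -/(pure s x).
have Pn n : P (pure s x *+ n).
  by elim: n => [|n IHn]; [rewrite mulr0n; exact: subgroup0|rewrite mulrS; exact: subgroupD].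
by case: c => n; rewrite ?NegzE ?mulrNz -pmulrn; [exact: Pn|apply: subgroupN => //; exact: Pn].
Qed.

Lemma pure0l X (x : X) : pure 0 x = 0 :> Stensor X.
Proof. exact: morphB0 (morphDB (fun s t => pureDl s t x)). Qed.

Lemma pureBr X s : {morph (fun x : X => pure s x) : x y / x - y}.
Proof. exact: morphDB (pureDr s). Qed.

End StensorFacts.

Section TorThree.
Variables (k : fieldType) (S : algType k) (A : conn_sring S) (D : tensor_model A).
Hypothesis hS : separable S.
Local Notation G := (@tm_deg k S A D).
Local Notation I := [set x | tm_surj (x : D) = 0].
Local Notation Tp := (@tplus k S A D).
Implicit Types (x y t : D) (N : graded_ideal D).

Lemma unit_surj s : tm_surj (s *> 1 : D) = s *> 1.
Proof. by rewrite tm_surj_lact tm_surj1. Qed.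

Lemma pure_scalar N s x : gi_set N x ->
  pure s (gcls N x) = pure 1 (gcls N (s *> x)) :> Stensor (gquot N).
Proof.
move=> Nx; have -> : gcls N (s *> x) = (s *> 1 : A) *: gcls N x.
  by rewrite (lactE s x) -unit_surj (gcls_scale (s *> 1) Nx).
by rewrite -pureM augmentation_unit mul1r.
Qed.

Lemma I_tplus x : I x -> Tp x.
Proof. exact: (I_low (leq0n 1)). Qed.

Lemma mulI_tplus N : gi_mulI N `<=` setmul Tp N.
Proof. by rewrite gi_mulIE; apply: setmulS => // x; exact: I_tplus. Qed.

(* S (x)_A (N / I N) = N / T_+ N *)
Lemma pure_eq0 N x : gi_set N x ->
  pure 1 (gcls N x) = 0 :> Stensor (gquot N) <-> setmul Tp N x.
Proof.
move=> Nx; have sTN := subgroup_setmul Tp N; have sN := subgroup_gi N; split; last first.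
  move=> TNx; pose P := [set x | gi_set N x /\ pure 1 (gcls N x) = 0 :> Stensor (gquot N)].
  suff : setmul Tp N `<=` P by case/(_ _ TNx).
  apply: setmul_sub => [|t y /tplusP t0 Ny].
    split=> [|y z [Ny y0] [Nz z0]]; split.
    + exact: (subgroup0 sN).
    + by rewrite gcls0 (morphB0 (@pureBr _ _ _ _ 1)).
    + exact: (subgroupB sN).
    + by rewrite (gclsB Ny Nz) (pureBr 1) y0 z0 subrr.
  split; first exact: gi_mull.
  by rewrite -(gcls_scale t Ny) -pureM t0 mulr0 pure0l.
(* The converse needs an additive map back, sending s (x) q to the class in T / T_+ N of s times a
   representative of q. The representative does not matter, since I N lies in T_+ N. *)
have [W [w [wB w0]]] : exists (W : zmodType) (w : D -> W),
    {morph w : x y / x - y} /\ forall y, w y = 0 <-> setmul Tp N y.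
  exists (zquot (setmul Tp N)), (zpi (setmul Tp N)); split=> [|y]; first exact: zpiB.
  by rewrite -[0](raddf0 (zpi (setmul Tp N))) zpiP subr0 zspan_id.
have wD := morphBD wB.
pose F (p : S * gquot N) : W := w (p.1 *> grep p.2).
have [E [EB EE]] : exists E : free_pairs (gquot N) -> W,
    {morph E : f g / f - g} /\ forall s q, E (pair_gen s q) = F (s, q).
  by exists (free_ext F); split=> [|s q]; [exact: raddfB|rewrite /pair_gen free_extU].
have ED := morphBD EB.
have lTN s y : setmul Tp N y -> setmul Tp N (s *> y).
  have [bP _ _] := @gi_plus_subproof _ _ _ D.
  by case: (is_subbimod_setmul bP (gi_subbimod N)) => _ + _; apply.
have repE y : gi_set N y -> setmul Tp N (grep (gcls N y) - y).
  move=> Ny; apply: mulI_tplus; apply/gcls_eq; [exact: grepP|exact: Ny|].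
  by rewrite grepK.
have Feq s y : gi_set N y -> F (s, gcls N y) = w (s *> y).
  move=> Ny; apply/eqP; rewrite -subr_eq0 -wB -lactB; apply/eqP/w0.
  by apply: lTN; exact: repE.
have EBl f g : E f = E g -> E (f - g) = 0 by move=> e; rewrite EB e subrr.
have E0 (f : free_pairs (gquot N)) : zspan (@Stensor_rel _ _ _ (gquot N)) f -> E f = 0.
  apply: (zspan_sub (N := [set f | E f = 0])) => [|_ [s t q|s q r|s a q]].
  - by split=> [|f' g f0 g0] /=; [exact: morphB0|rewrite EB f0 g0 subrr].
  - have [y Ny ->] := gquotP q; apply: EBl.
    by rewrite ED (EE (s + t)) (EE s) (EE t) !(Feq _ y Ny) lactDl wD.
  - have [y Ny ->] := gquotP q; have [z Nz ->] := gquotP r; apply: EBl.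
    have Nyz : gi_set N (y + z) by exact: (subgroupD sN).
    have e : F (s, gcls N (y + z)) = F (s, gcls N y) + F (s, gcls N z).
      by rewrite (Feq s _ Nyz) (Feq s y Ny) (Feq s z Nz) lactDr wD.
    rewrite ED -(gclsD Ny Nz).
    exact: etrans (EE s _) (etrans e (esym (f_equal2 +%R (EE s _) (EE s _)))).
  - have [y Ny ->] := gquotP q; have [t ->] := tm_surj_liftP D a; apply: EBl.
    have Nty : gi_set N (t * y) by exact: gi_mull.
    rewrite (gcls_scale t Ny); apply: etrans (EE _ _) (etrans _ (esym (EE s _))).
    rewrite (Feq _ _ Ny) (Feq _ _ Nty).
    apply/eqP; rewrite -subr_eq0 -wB; apply/eqP/w0.
    rewrite lactA -lactB; apply: lTN; rewrite lactE -mulrBl; apply: setmul_mem => //.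
    (* The scalar given by the augmentation of [t] differs from [t] by an element of T_+. *)
    apply/tplusP; rewrite tm_surjB augmentationB unit_surj augmentation_unit.
    by rewrite subrr.
rewrite /pure -[0](raddf0 (zpi (@Stensor_rel _ _ _ (gquot N)))) zpiP subr0 => /E0.
by rewrite EE (Feq _ _ Nx) lact1 => /w0.
Qed.

(* Tor_3 = (I T_+ `&` T_+ I) / (I^2 + T_+ I T_+), in each internal degree. *)
Lemma Tor3_vanishing m x : Tor_deg_eq0 A 3 m -> G m x ->
  setmul I Tp x -> setmul Tp I x ->
  setadd (setmul I I) (setmul Tp (setmul I Tp)) x.
Proof.
move=> /(_ (govorov D hS)) T0 Gx x3 x2.
pose N2 := gseq D 2; pose N3 := gseq D 3; pose N4 := gseq D 4.
have N2E : N2 = I :> set D.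
  rewrite /N2 /= gi_mulIE gi_topE; apply/seteqP; split=> [|y Iy].
    apply: setmul_sub => [|y z Iy _]; [exact: (@subgroup_I _ _ _ D)|exact: I_Mr].
  by rewrite -[y]mulr1; exact: setmul_mem.
have N3E : N3 = setmul I Tp :> set D by rewrite /N3 /= gi_mulIE gi_plusE.
have N4E : N4 = setmul I I :> set D.
  by rewrite /N4 /= gi_mulIE -[gi_set (gi_mulI _)]/(gi_set N2) N2E.
have N3x : gi_set N3 x by rewrite N3E.
have N2x : gi_set N2 x by exact: gseq_sub.
(* Tensoring the terms 3 and 2 of the resolution with S gives I T_+ / T_+ I T_+ and I / T_+ I. As
   [x] lies in I T_+ it has a class in the former, and as it lies in T_+ I this class is a cycle. *)
pose z : Stensor (govorov D hS 3) := pure 1 (gcls N3 x).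
have cz : cycles (X := govorov D hS) (i := 3) z.
  rewrite /cycles /= Stensor_map_pure [X in pure 1 X]gres_dE //.
  by apply/(pure_eq0 N2x); rewrite N2E.
have dz : @Stensor_deg _ _ _ (govorov D hS 3) m z.
  by apply: sub_zspan; exists 1, (gcls N3 x); split=> //; exists x.
have : Tor_deg (X := govorov D hS) (i := 3) m (zpi _ z) by exists z.
rewrite T0 /= -[0](raddf0 (zpi _)) zpiP subr0 => bz.
(* Boundaries are the classes of elements of I^2, the numerator of term 4. A bounding [z] thus makes
   [x] congruent to an element of I^2 modulo T_+ I T_+. *)
pose P (w : Stensor (govorov D hS 3)) := exists2 y, gi_set N4 y & w = pure 1 (gcls N3 y).
have sN4 := subgroup_gi N4; have sN3 := subgroup_gi N3.
have sub43 y : gi_set N4 y -> gi_set N3 y by exact: gseq_sub.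
have sP : subgroup P.
  split=> [|_ _ [y Ny ->] [y' Ny' ->]].
    exists 0; first exact: subgroup0.
    by rewrite gcls0 (morphB0 (@pureBr _ _ _ _ 1)).
  exists (y - y'); first exact: (subgroupB sN4).
  by rewrite gclsB ?pureBr //; exact: sub43.
have [y Ny ezy] : P z.
  apply: zspan_sub bz => // _ [w _ <-].
  apply: (Stensor_ind (P := [set w | P (Stensor_map (gres_d D 3) w)])) => [|s q].
    split=> [|u v /= Pu Pv] /=.
      by rewrite (morphB0 (Stensor_mapB _)); case: sP.
    by rewrite Stensor_mapB; exact: (subgroupB sP).
  have [y Ny ->] := gquotP q; rewrite /= Stensor_map_pure gres_dE //.
  exists (s *> y); last by rewrite [LHS]pure_scalar //; exact: sub43.
  by case: (gi_subbimod N4) => _ + _; apply.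
have N3y := sub43 y Ny; have N3xy : gi_set N3 (x - y) by exact: (subgroupB sN3).
have : setmul Tp N3 (x - y).
  apply/(pure_eq0 N3xy); rewrite (gclsB N3x N3y) (pureBr 1).
  exact: (etrans (congr1 (fun u => u - _) ezy) (subrr _)).
rewrite N3E => Txy; exists y; first by rewrite -N4E; exact: Ny.
exists (x - y); first exact: Txy.
by rewrite addrC subrK.
Qed.

End TorThree.

(** * Jacobi conditions *)

Section FilteredIdeal.
Variables (k : fieldType) (S : algType k) (A : conn_sring S) (D : tensor_model A).
Local Notation G := (@tm_deg k S A D).
Local Notation I := [set x | tm_surj (x : D) = 0].
Implicit Types (x y t q : D) (Q : set D) (m n : nat).
Let hG := tm_direct_sum D.
Let GM := @tm_degM k S A D.
Let sb n : subgroup (below G n) := subgroup_below hG n.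

Definition fid Q n : set D :=
  zspan [set z | exists i j l x q y,
    [/\ (i + j + l = n)%N, below G i.+1 x, (Q `&` below G j.+1) q, below G l.+1 y
      & z = x * q * y]].

Lemma subgroup_fid Q n : subgroup (fid Q n). Proof. exact: subgroup_zspan. Qed.

(** The degree bounds need not add up to [n] exactly: the slack is given to the left factor. *)
Lemma fid_mem Q n i j l x q y : (i + j + l <= n)%N -> below G i.+1 x -> Q q ->
  below G j.+1 q -> below G l.+1 y -> fid Q n (x * q * y).
Proof.
move=> ijl bx Qq bq bly; apply: sub_zspan.
exists (n - (j + l))%N, j, l, x, q, y; split=> //; first by lia.
by apply: below_le bx => //; lia.
Qed.

Lemma fid_sub Q n (N : set D) : subgroup N ->
  (forall i j l x q y, (i + j + l = n)%N -> below G i.+1 x -> Q q -> below G j.+1 q ->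
    below G l.+1 y -> N (x * q * y)) -> fid Q n `<=` N.
Proof.
move=> sN h; apply: zspan_sub => // _ [i [j [l [x [q [y [e bx [Qq bq] bly ->]]]]]]].
exact: h e bx Qq bq bly.
Qed.

Lemma fid_mono Q m n : (m <= n)%N -> fid Q m `<=` fid Q n.
Proof.
move=> mn; apply: fid_sub => [|i j l x q y e bx Qq bq bly]; first exact: subgroup_fid.
by apply: (fid_mem _ bx Qq bq bly); rewrite e.
Qed.

Lemma fid_mull Q m n t x : below G m.+1 t -> fid Q n x -> fid Q (m + n) (t * x).
Proof.
move=> bt; have sF := subgroup_fid Q (m + n).
suff : fid Q n `<=` [set x | fid Q (m + n) (t * x)] by apply.
apply: fid_sub => [|i j l y q z e bx Qq bq bly] /=.
  split=> [|y z /= Fy Fz] /=; first by rewrite mulr0; exact: (subgroup0 sF).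
  by rewrite mulrBr; exact: (subgroupB sF).
rewrite !mulrA; apply: (fid_mem (i := m + i) (j := j) (l := l)) => //; first by lia.
by have := belowMS hG GM bt bx; rewrite addnS.
Qed.

Lemma fid_mulr Q m n t x : below G m.+1 t -> fid Q n x -> fid Q (n + m) (x * t).
Proof.
move=> bt; have sF := subgroup_fid Q (n + m).
suff : fid Q n `<=` [set x | fid Q (n + m) (x * t)] by apply.
apply: fid_sub => [|i j l y q z e bx Qq bq bly] /=.
  split=> [|y z /= Fy Fz] /=; first by rewrite mul0r; exact: (subgroup0 sF).
  by rewrite mulrBl; exact: (subgroupB sF).
rewrite -mulrA; apply: (fid_mem (i := i) (j := j) (l := l + m)) => //; first by lia.
by have := belowMS hG GM bly bt; rewrite addnS.
Qed.

Lemma fid_below Q n : fid Q n `<=` below G n.+1.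
Proof.
apply: fid_sub => // i j l x q y <- bx _ bq bly.
have := belowMS hG GM (m := i + j) _ bly; rewrite addnS; apply.
by have := belowMS hG GM bx bq; rewrite addnS.
Qed.

Lemma below_unit s : below G 1 (s *> 1).
Proof. exact: (below_hom hG (ltnSn 0) (tm_deg_unit D s)). Qed.

Lemma below_one : below G 1 1.
Proof. by rewrite -[1]lact1; exact: below_unit. Qed.

Lemma is_subbimod_fid Q n : is_subbimod (fid Q n).
Proof.
split=> [|s x Fx|s x Fx]; first exact: subgroup_fid.
  by rewrite lactE; exact: (fid_mull (below_unit s) Fx).
by rewrite ractE -[n]addn0; exact: (fid_mulr (below_unit s) Fx).
Qed.

Lemma fid_self Q n q : Q q -> below G n.+1 q -> fid Q n q.
Proof.
move=> Qq bq; rewrite -[q]mulr1 -[q]mul1r.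
by apply: (fid_mem _ below_one Qq bq below_one); rewrite addn0.
Qed.

Lemma ideal_gen_fid Q x : ideal_gen Q x <-> exists n, fid Q n x.
Proof.
split; last first.
  move=> [n]; have sI := subgroup_ideal_gen Q; apply: fid_sub => // i j l y q z _ _ Qq _ _.
  by apply: ideal_genMr; apply: ideal_genMl; exact: sub_ideal_gen.
suff : ideal_gen Q `<=` [set x | exists n, fid Q n x] by apply.
apply: ideal_gen_sub => [|q Qq]; last first.
  by have [n bq] := below_ex hG q; exists n; apply: fid_self => //; exact: below_le bq.
split; first split=> [|y z [m Fy] [n Fz]] /=.
- by exists 0; exact: subgroup0 (subgroup_fid Q 0).
- exists (m + n)%N; apply: (subgroupB (subgroup_fid Q _)).
    by apply: fid_mono Fy; lia.
  by apply: fid_mono Fz; lia.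
- move=> a y [n Fy]; have [m ba] := below_ex hG a; have ba' := below_le hG (leqnSn m) ba.
  by split; [exists (m + n)%N; exact: fid_mull|exists (n + m)%N; exact: fid_mulr].
Qed.

Definition jac Q n : Prop := fid Q n.+1 `&` below G n.+1 `<=` fid Q n.

(** Each Jacobi condition lowers the index [m] by one, as long as [m] exceeds the degree bound of
    [x]. *)
Lemma jac_all Q : (forall n, jac Q n) -> forall m n x, fid Q m x -> below G n.+1 x -> fid Q n x.
Proof.
move=> J m n x; elim: m => [|m IHm] Fx bx; first exact: fid_mono Fx.
have [mn|nm] := leqP m.+1 n; first exact: fid_mono Fx.
by apply: IHm => //; apply: J; split=> //; exact: below_le bx.
Qed.

Section Deformation.
Variables (R : set D) (alpha : D -> D).
Hypotheses (hR : relations_of R) (alpha_hom : bimod_hom_on R alpha)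
  (alpha_top : forall n r, R r -> G n r ->
    below G n.+1 (alpha r) /\ hcomp G n (alpha r) = r).
Local Notation Q := (alpha @` R).
Local Notation F := (fid Q).
Let bR := relations_subbimod hR.
Let sR : subgroup R. Proof. by case: bR. Qed.
Let hRn := relations_homogeneous hR.
Let sI := @subgroup_I k S A D.

Lemma alphaB x y : R x -> R y -> alpha (x - y) = alpha x - alpha y.
Proof.
move=> Rx Ry; have [aD _ _] := alpha_hom.
by apply: (addIr (alpha y)); rewrite -aD ?subrK //; exact: (subgroupB sR).
Qed.

Lemma alpha0 : alpha 0 = 0.
Proof. by have R0 := subgroup0 sR; have := alphaB R0 R0; rewrite !subrr. Qed.

Lemma alpha_sum n (c : nat -> D) : (forall i, R (c i)) ->
  alpha (\sum_(i < n) c i) = \sum_(i < n) alpha (c i).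
Proof.
move=> Rc; have [aD _ _] := alpha_hom; elim: n => [|n IHn]; first by rewrite !big_ord0 alpha0.
by rewrite !big_ord_recr /= aD ?IHn //; apply: (subgroup_sum sR).
Qed.

(** The condition on [alpha] speaks of homogeneous relations only; as [R] is homogeneous, it carries
    over to sums. The case n = m + 1 concerns the leading form, and for smaller [n] both sides are
    0. *)
Lemma alpha_below n r : R r -> below G n r ->
  below G n (alpha r) /\ forall m, (n <= m.+1)%N -> hcomp G m (alpha r) = hcomp G m r.
Proof.
move=> Rr br; have Rc i : R (hcomp G i r) by exact: hRn.
have e : alpha r = \sum_(i < n) alpha (hcomp G i r).
  by rewrite {1}(below_sum hG br) (alpha_sum _ Rc).
have bi i : below G i.+1 (alpha (hcomp G i r)) by case: (alpha_top (Rc i) (hcomp_in hG i r)).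
split; first by rewrite e; apply: (subgroup_sum (sb n)) => i; exact: below_le (bi i).
move=> m nm; rewrite e (hcomp_sum hG) {2}(below_sum hG br) (hcomp_sum hG).
apply: eq_bigr => i _; rewrite (hcompK hG); case: eqP => [->|mi].
  by case: (alpha_top (Rc i) (hcomp_in hG i r)).
by have /(belowP hG) -> := bi i => //; have := ltn_ord i; lia.
Qed.

(** Since [alpha] keeps leading forms it cannot lower degrees: the top component of [r] would appear
    in [alpha r]. *)
Lemma alpha_below_inv n r : R r -> below G n (alpha r) -> below G n r.
Proof.
move=> Rr ba; have [m br] := below_ex hG r.
elim: m br => [|m IHm] br; first exact: below_le br.
have [mn|nm] := leqP m.+1 n; first exact: below_le br.
apply: IHm; rewrite -[r](subrK (hcomp G m r)); apply: (subgroupD (sb m)).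
  exact: below_top.
have [_ /(_ m (leqnn _)) <-] := alpha_below Rr br.
by move/(belowP hG): ba => -> //; exact: (subgroup0 (sb m)).
Qed.

Lemma subgroup_Q n : subgroup (Q `&` below G n).
Proof.
apply: subgroup_setI => //; split=> [|_ _ [x Rx <-] [y Ry <-]].
  by exists 0; [exact: (subgroup0 sR)|exact: alpha0].
by exists (x - y); [exact: (subgroupB sR)|rewrite alphaB].
Qed.

Lemma Q_top n q : Q q -> below G n.+1 q -> R (hcomp G n q).
Proof.
move=> [r Rr <-] /(alpha_below_inv Rr) br.
by have [_ ->] := alpha_below Rr br; [exact: hRn|exact: leqnn].
Qed.

(** In degree [n] a generator x q y contributes the product of the three top components, and that of
    [q] is a relation. *)
Lemma fid_top n x : F n x -> I (hcomp G n x).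
Proof.
suff : F n `<=` [set x | I (hcomp G n x)] by apply.
apply: fid_sub => [|i j l y q z <- by_ Qq bq bz] /=.
  split=> [|y z /= Iy Iz]; first by rewrite /= (hcomp0 hG); exact: (subgroup0 sI).
  by rewrite /= (hcompB hG); exact: (subgroupB sI).
have byq : below G (i + j).+1 (y * q) by have := belowMS hG GM by_ bq; rewrite addnS.
rewrite (hcompM_top hG GM byq bz) (hcompM_top hG GM by_ bq).
by apply: I_Mr; apply: I_Ml; apply: (relations_sub hR); exact: Q_top.
Qed.

(** Replacing each relation r by [alpha r] in an expression of a homogeneous element of <R> changes
    only terms of lower degree. The property is stated for all components at once so that it defines
    an ideal. *)
Lemma fid_lift n x : I x -> exists2 y, F n y & hcomp G n y = hcomp G n x.
Proof.
rewrite -[I](relations_gen hR) => Ix.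
pose P := [set x | forall n, exists2 y, F n y & hcomp G n y = hcomp G n x].
suff : ideal_gen R `<=` P by move=> /(_ x Ix).
have sP : subgroup P.
  split=> [m|a b Pa Pb m]; first by exists 0 => //; exact: subgroup0 (subgroup_fid Q m).
  have [a' Fa ea] := Pa m; have [b' Fb eb] := Pb m; exists (a' - b').
    exact: (subgroupB (subgroup_fid Q m)).
  by rewrite !(hcompB hG) ea eb.
apply: ideal_gen_sub => [|r Rr m]; last first.
  have [b1 e1] := alpha_top (hRn m Rr) (hcomp_in hG m r).
  exists (alpha (hcomp G m r)) => //.
  by apply: fid_self => //; exists (hcomp G m r) => //; exact: hRn.
split=> // a y Py; split.
- have [p -> _] := direct_sumP hG a; rewrite mulr_suml; apply: (subgroup_sum sP) => i m.
  have Gi := hcomp_in hG i a; rewrite (hcompMl hG GM m y Gi).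
  case: leqP => im; last by exists 0; [exact: subgroup0 (subgroup_fid Q m)|exact: hcomp0].
  have [y' Fy ey] := Py (m - i)%N; exists (hcomp G i a * y').
    by rewrite -(subnKC im); apply: fid_mull => //; exact: below_hom Gi.
  by rewrite (hcompMl hG GM m y' Gi) im ey.
- have [p -> _] := direct_sumP hG a; rewrite mulr_sumr; apply: (subgroup_sum sP) => i m.
  have Gi := hcomp_in hG i a; rewrite (hcompMr hG GM m y Gi).
  case: leqP => im; last by exists 0; [exact: subgroup0 (subgroup_fid Q m)|exact: hcomp0].
  have [y' Fy ey] := Py (m - i)%N; exists (y' * hcomp G i a).
    by rewrite -{1}(subnK im); apply: fid_mulr => //; exact: below_hom Gi.
  by rewrite (hcompMr hG GM m y' Gi) im ey.
Qed.

(** Relations begin in degree 2 and [alpha] does not lower degrees, so already F_1 is 0. *)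
Lemma jac0 : jac Q 0.
Proof.
move=> x [Fx _]; suff -> : x = 0 by exact: subgroup0 (subgroup_fid Q 0).
suff : F 1 `<=` [set x | x = 0] by apply.
apply: fid_sub => [|i j l y q z e _ [r Rr <-] /(alpha_below_inv Rr) br _] /=.
  by split=> // a b /= -> ->; rewrite subrr.
suff -> : r = 0 by rewrite alpha0 mulr0 mul0r.
apply: (hcomp_inj hG) => m; rewrite (hcomp0 hG); have [m1|m1] := leqP m 1.
  by apply: I_low m1 _; exact: relations_sub hR _ Rr.
by move/(belowP hG): br; apply; lia.
Qed.

End Deformation.
End FilteredIdeal.

Section JacobiStep.
Variables (k : fieldType) (S : algType k) (A : conn_sring S) (D : tensor_model A).
Hypothesis hS : separable S.
Local Notation G := (@tm_deg k S A D).
Local Notation I := [set x | tm_surj (x : D) = 0].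
Local Notation Tp := (@tplus k S A D).
Variables (R : set D) (alpha : D -> D).
Hypotheses (hR : relations_of R) (alpha_hom : bimod_hom_on R alpha)
  (alpha_top : forall n r, R r -> G n r ->
    below G n.+1 (alpha r) /\ hcomp G n (alpha r) = r).
Local Notation Q := (alpha @` R).
Local Notation F := (fid Q).
Implicit Types (x y t q : D).
Let hG := tm_direct_sum D.
Let GM := @tm_degM k S A D.
Let sF n : subgroup (F n) := subgroup_fid Q n.

Lemma subgroup_preim_sub (B : zmodType) (f g : B -> B) (N : set B) :
  {morph f : x y / x - y} -> {morph g : x y / x - y} -> subgroup N ->
  subgroup [set x | N (f x - g x)].
Proof.
move=> fB gB sN; split=> [|x y /= Nx Ny] /=.
  by rewrite (morphB0 fB) (morphB0 gB) subrr; exact: (subgroup0 sN).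
by rewrite fB gB subrACA; exact: (subgroupB sN).
Qed.

(** Lifts of leading forms to F_n that are linear over [S] on both sides; this balance allows
    products of letters with lifts to be defined on V (x) T and T (x) V. *)
Lemma fid_bimod_lift n : exists l : D -> D, [/\ bimod_hom l, forall y, F n (l y)
  & forall x, F n x -> hcomp G n (l (hcomp G n x)) = hcomp G n x].
Proof.
exact: (bimod_section hS (hcomp_hom hG (tm_subbimod D) n) (is_subbimod_fid Q n)).
Qed.

(* the injectivity of V (x) I_(n+1) -> V I_(n+1) in terms of lifts *)
Lemma left_syzygy n a : jac Q n -> setmul (G 1%N) (F n.+1) a ->
  hcomp G n.+2 a = 0 -> F n.+1 a.
Proof.
move=> J Fa a0; have [l [[lD ll lr] lF lK]] := fid_bimod_lift n.+1.
have lB : {morph l : x y / x - y} by apply: morphDB => x y; exact: lD.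
(* [gam] sends v x to v times the lift of x. If a is a sum of products v x with x in F_(n+1) and its
   leading form vanishes, [gam] shows that the sum of the v times lifts of the leading forms of x is
   0. So each x may be diminished by that lift, which leaves an element of F_(n+1) of lower degree,
   in F_n by (J_n). *)
have [||||gam gB gV] := @tm_left_extension _ _ _ D (fun v x => v * l x).
- by move=> v x y; rewrite lB mulrBr.
- by move=> v w x; rewrite mulrDl.
- by move=> v s x; rewrite lactMl.
- by move=> x s v; rewrite ll // ractMlact.
suff : setmul (G 1%N) (F n.+1) `<=` [set a | F n.+1 (a - gam (hcomp G n.+2 a))].
  by move=> /(_ a Fa) /=; rewrite a0 (morphB0 gB) subr0.
apply: setmul_sub => [|v x Gv Fx] /=.
  apply: (subgroup_preim_sub (f := id) (g := fun a => gam (hcomp G n.+2 a))) => // x y.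
  by rewrite (hcompB hG) gB.
rewrite (hcompMl hG GM _ _ Gv) /= subn1 /= gV // -mulrBr.
apply: (fid_mull (m := 1) (n := n)); first exact: (below_hom hG (ltnSn 1)).
have Fd : F n.+1 (x - l (hcomp G n.+1 x)) by exact: (subgroupB (sF _)).
apply: J; split=> //.
have e : hcomp G n.+1 (x - l (hcomp G n.+1 x)) = 0 by rewrite (hcompB hG) lK // subrr.
by have := below_top hG (fid_below Fd); rewrite e subr0.
Qed.

Lemma right_syzygy n a : jac Q n -> setmul (F n.+1) (G 1%N) a ->
  hcomp G n.+2 a = 0 -> F n.+1 a.
Proof.
move=> J Fa a0; have [l [[lD ll lr] lF lK]] := fid_bimod_lift n.+1.
have lB : {morph l : x y / x - y} by apply: morphDB => x y; exact: lD.
have [||||gam gB gV] := @tm_right_extension _ _ _ D (fun x v => l x * v).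
- by move=> v x y; rewrite lB mulrBl.
- by move=> v w x; rewrite mulrDr.
- by move=> v s x; rewrite ractMr.
- by move=> x s v; rewrite lr // ractMlact.
suff : setmul (F n.+1) (G 1%N) `<=` [set a | F n.+1 (a - gam (hcomp G n.+2 a))].
  by move=> /(_ a Fa) /=; rewrite a0 (morphB0 gB) subr0.
apply: setmul_sub => [|x v Fx Gv] /=.
  apply: (subgroup_preim_sub (f := id) (g := fun a => gam (hcomp G n.+2 a))) => // x y.
  by rewrite (hcompB hG) gB.
rewrite (hcompMr hG GM _ _ Gv) /= subn1 /= gV // -mulrBl.
have Fd : F n.+1 (x - l (hcomp G n.+1 x)) by exact: (subgroupB (sF _)).
have e : hcomp G n.+1 (x - l (hcomp G n.+1 x)) = 0 by rewrite (hcompB hG) lK // subrr.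
have bd : below G n.+1 (x - l (hcomp G n.+1 x)).
  by have := below_top hG (fid_below Fd); rewrite e subr0.
by have := fid_mulr (below_hom hG (ltnSn 1) Gv) (J _ (conj Fd bd)); rewrite addn1.
Qed.

Local Notation VF n := (setmul (G 1%N) (F n)).
Local Notation FV n := (setmul (F n) (G 1%N)).

(** Words of positive length have a first letter to split off; the remaining letters are absorbed
    into F. *)
Lemma homog_mull_VF m n t x : G m.+1 t -> F n x -> VF (m + n) (t * x).
Proof.
move=> Gt Fx; suff : G m.+1 `<=` [set t | VF (m + n) (t * x)] by apply.
have sV := subgroup_setmul (G 1%N) (F (m + n)).
rewrite tm_degSl; apply: setmul_sub => [|v u Gv Gu] /=.
  split=> [|a b /= Fa Fb] /=; first by rewrite mul0r; exact: (subgroup0 sV).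
  by rewrite mulrBl; exact: (subgroupB sV).
rewrite -mulrA; apply: setmul_mem => //; apply: fid_mull => //.
exact: below_hom Gu.
Qed.

Lemma homog_mulr_FV m n t x : G m.+1 t -> F n x -> FV (n + m) (x * t).
Proof.
move=> Gt Fx; suff : G m.+1 `<=` [set t | FV (n + m) (x * t)] by apply.
have sV := subgroup_setmul (F (n + m)) (G 1%N).
rewrite tm_degSr; apply: setmul_sub => [|u v Gu Gv] /=.
  split=> [|a b /= Fa Fb] /=; first by rewrite mulr0; exact: (subgroup0 sV).
  by rewrite mulrBr; exact: (subgroupB sV).
rewrite mulrA; apply: setmul_mem => //; apply: fid_mulr => //.
exact: below_hom Gu.
Qed.

(** In a generator x q y where an outer factor has a positive degree bound, replacing that factor by
    its top component costs an element of F_n, and the top component provides a letter in V. If both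
    bounds are 0, the outer factors lie in S and the product is again in Q. *)
Lemma fid_decomp n x : F n.+1 x ->
  exists q a b e, [/\ (Q `&` below G n.+2) q, VF n a, FV n b, F n e & x = q + a + b + e].
Proof.
move=> Fx; have sQ := subgroup_Q hR alpha_hom n.+2.
have sVF := subgroup_setmul (G 1%N) (F n); have sFV := subgroup_setmul (F n) (G 1%N).
pose P := setadd (setadd (setadd (Q `&` below G n.+2) (VF n)) (FV n)) (F n).
have sP : subgroup P.
  by apply: subgroup_setadd (sF n); apply: subgroup_setadd sFV; exact: subgroup_setadd.
have PQ q : (Q `&` below G n.+2) q -> P q.
  exists q; last by exists 0; [exact: (subgroup0 (sF n))|rewrite addr0].
  exists q; last by exists 0; [exact: (subgroup0 sFV)|rewrite addr0].
  by exists q => //; exists 0; [exact: (subgroup0 sVF)|rewrite addr0].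
have PV a : VF n a -> P a.
  exists a; last by exists 0; [exact: (subgroup0 (sF n))|rewrite addr0].
  exists a; last by exists 0; [exact: (subgroup0 sFV)|rewrite addr0].
  by exists 0; [exact: (subgroup0 sQ)|exists a => //; rewrite add0r].
have PW b : FV n b -> P b.
  exists b; last by exists 0; [exact: (subgroup0 (sF n))|rewrite addr0].
  exists 0; first exact: (subgroup0 (subgroup_setadd sQ sVF)).
  by exists b => //; rewrite add0r.
have PF e : F n e -> P e.
  exists 0; last by exists e => //; rewrite add0r.
  exact: (subgroup0 (subgroup_setadd (subgroup_setadd sQ sVF) sFV)).
suff : P x.
  move=> [_ [_ [q Qq [a Va ->]] [b Vb ->]] [e Fe ->]].
  by exists q, a, b, e.
move: x Fx; apply: fid_sub => // -[|i] j [|l] x q y e bx Qq bq bly.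
- have Gx := hcomp_in hG 0 x; have ex : x = hcomp G 0 x by rewrite {1}(below_sum hG bx) big_ord1.
  have ey : y = hcomp G 0 y by rewrite {1}(below_sum hG bly) big_ord1.
  have [s es] := tm_deg0E (hcomp_in hG 0 x); have [t et] := tm_deg0E (hcomp_in hG 0 y).
  rewrite ex es ey et -lactE -ractE.
  have jn : j = n.+1 by lia.
  rewrite jn in bq; have [_ bl br] := is_subbimod_below hG (tm_subbimod D) n.+2.
  apply: PQ; split; last by apply: br; exact: bl.
  have [_ al ar] := alpha_hom; have [_ lR rR] := relations_subbimod hR.
  case: Qq => r Rr <-; exists (s *> r <* t); first by apply: rR; exact: lR.
  by rewrite ar ?al //; exact: lR.
- rewrite -(subrK (hcomp G l.+1 y) y) mulrDr; apply: (subgroupD sP).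
    have le_n : (0 + j + l <= n)%N by lia.
    apply: PF; exact: (fid_mem le_n bx Qq bq (below_top hG bly)).
  apply: PW.
  have -> : n = ((0 + j) + l)%N by lia.
  apply: homog_mulr_FV; first exact: hcomp_in.
  have := fid_mem (leqnn (0 + j + 0)) bx Qq bq (below_one D).
  by rewrite mulr1 addn0.
- have -> : x * q * y = (x - hcomp G i.+1 x) * q * y + hcomp G i.+1 x * q * y.
    by rewrite -!mulrDl subrK.
  apply: (subgroupD sP).
    have le_n : (i + j + 0 <= n)%N by lia.
    apply: PF; exact: (fid_mem le_n (below_top hG bx) Qq bq bly).
  apply: PV; have -> : n = (i + (j + 0))%N by lia.
  rewrite -mulrA; apply: homog_mull_VF; first exact: hcomp_in.
  have := fid_mem (leqnn (0 + j + 0)) (below_one D) Qq bq bly.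
  by rewrite mul1r.
- have -> : x * q * y = (x - hcomp G i.+1 x) * q * y + hcomp G i.+1 x * q * y.
    by rewrite -!mulrDl subrK.
  apply: (subgroupD sP).
    have le_n : (i + j + l.+1 <= n)%N by lia.
    apply: PF; exact: (fid_mem le_n (below_top hG bx) Qq bq bly).
  apply: PV; have -> : n = (i + (j + l.+1))%N by lia.
  rewrite -mulrA; apply: homog_mull_VF; first exact: hcomp_in.
  have := fid_mem (leqnn (0 + j + l.+1)) (below_one D) Qq bq bly.
  by rewrite mul1r.
Qed.

(* For such u, subtracting c1 and adding c2 splits an element of V F + F V with
   leading form u - u into two pieces to which the syzygy lemmas apply. *)
Definition bilift n : set D := [set u | exists c1 c2,
  [/\ VF n.+1 c1, FV n.+1 c2, F n.+1 (c1 - c2), hcomp G n.+2 c1 = hcomp G n.+2 u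
    & hcomp G n.+2 c2 = hcomp G n.+2 u]].

Lemma subgroup_bilift n : subgroup (bilift n).
Proof.
have sVF := subgroup_setmul (G 1%N) (F n.+1); have sFV := subgroup_setmul (F n.+1) (G 1%N).
split=> [|u w [c1 [c2 [V1 V2 Fc e1 e2]]] [d1 [d2 [W1 W2 Fd f1 f2]]]].
  exists 0, 0; split=> //; [exact: (subgroup0 sVF)|exact: (subgroup0 sFV)|].
  by rewrite subrr; exact: (subgroup0 (sF _)).
exists (c1 - d1), (c2 - d2); split; [exact: (subgroupB sVF)|exact: (subgroupB sFV)| | |].
- by rewrite subrACA; exact: (subgroupB (sF _)).
- by rewrite !(hcompB hG) e1 f1.
- by rewrite !(hcompB hG) e2 f2.
Qed.

Lemma bilift0 n u : hcomp G n.+2 u = 0 -> bilift n u.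
Proof.
move=> u0; exists 0, 0; split; rewrite ?u0 ?(hcomp0 hG) //; try exact: subgroup0 (subgroup_setmul _ _).
by rewrite subrr; exact: (subgroup0 (sF _)).
Qed.

Let lift n x := fid_lift hR alpha_top n (x := x).

(** Lift only [y] to stay in V F, and only [x] to stay in F V: x y' - x' y = (x - x') y' + x' (y' -
    y), and here x - x' and y' - y have lower degree than x and y. *)
Lemma bilift_II n c d x y : I x -> G c x -> I y -> G d y -> bilift n (x * y).
Proof.
move=> Ix Gx Iy Gy; have Gxy := GM Gx Gy.
have [e|/eqP ne] := (c + d)%N =P n.+2; last first.
  by apply: bilift0; rewrite (hcomp_id hG _ Gxy) eq_sym (negPf ne).
case: c d Gx Gy {Gxy} e => [|c] [|d] Gx Gy e.
1-2: by apply: bilift0; rewrite -(hcomp_same hG Gx) (I_low _ Ix) // mul0r (hcomp0 hG).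
  by apply: bilift0; rewrite -(hcomp_same hG Gy) (I_low _ Iy) // mulr0 (hcomp0 hG).
have [x' Fx' ex] := lift c.+1 Ix; have [y' Fy' ey] := lift d.+1 Iy.
rewrite (hcomp_same hG Gx) in ex; rewrite (hcomp_same hG Gy) in ey.
exists (x * y'), (x' * y); split.
- have -> : n.+1 = (c + d.+1)%N by lia.
  exact: homog_mull_VF.
- have -> : n.+1 = (c.+1 + d)%N by lia.
  exact: homog_mulr_FV.
- have -> : x * y' - x' * y = (x - x') * y' + x' * (y' - y).
    by rewrite mulrBl mulrBr addrA subrK.
  have dif m z z' : G m.+1 z -> F m.+1 z' -> hcomp G m.+1 z' = z -> below G m.+1 (z - z').
    move=> Gz Fz' ez; have e0 : hcomp G m.+1 (z - z') = 0.
      by rewrite (hcompB hG) (hcomp_same hG Gz) ez subrr.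
    rewrite -[z - z']subr0 -e0; apply: (below_top hG).
    apply: (subgroupB (subgroup_below hG _)); first exact: (below_hom hG (ltnSn m.+1)).
    exact: fid_below Fz'.
  apply: (subgroupD (sF _)).
    have -> : n.+1 = (c + d.+1)%N by lia.
    by apply: fid_mull => //; exact: dif.
  have -> : n.+1 = (c.+1 + d)%N by lia.
  apply: fid_mulr => //; rewrite -opprB; apply: (subgroupN (subgroup_below hG _)).
  exact: dif.
- rewrite -e (hcompMl hG GM _ _ Gx) leq_addr addKn ey.
  by rewrite (hcomp_same hG (GM Gx Gy)).
- rewrite -e (hcompMr hG GM _ _ Gy) leq_addl addnK ex.
  by rewrite (hcomp_same hG (GM Gx Gy)).
Qed.

(** With a letter available on both sides, the single lift t x' t' lies in V F and in F V. *)
Lemma bilift_TIT n a b c t x t' : Tp t -> G a t -> I x -> G b x -> Tp t' -> G c t' ->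
  bilift n (t * (x * t')).
Proof.
move=> Tt Gt Ix Gx Tt' Gt'; have Gp := GM Gt (GM Gx Gt').
have [e|/eqP ne] := (a + (b + c))%N =P n.+2; last first.
  by apply: bilift0; rewrite (hcomp_id hG _ Gp) eq_sym (negPf ne).
case: a c Gt Gt' {Gp} e => [|a] [|c] Gt Gt' e.
1-2: by apply: bilift0; rewrite -(hcomp_same hG Gt) Tt mul0r (hcomp0 hG).
  by apply: bilift0; rewrite -(hcomp_same hG Gt') Tt' !mulr0 (hcomp0 hG).
have [x' Fx' ex] := lift b Ix; rewrite (hcomp_same hG Gx) in ex.
have eh : hcomp G n.+2 (t * (x' * t')) = hcomp G n.+2 (t * (x * t')).
  rewrite -e (hcompMl hG GM _ _ Gt) leq_addr addKn (hcompMr hG GM _ _ Gt') leq_addl addnK ex.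
  by rewrite (hcomp_same hG (GM Gt (GM Gx Gt'))).
exists (t * (x' * t')), (t * (x' * t')); split=> //.
- have -> : n.+1 = (a + (b + c.+1))%N by lia.
  apply: homog_mull_VF => //; apply: fid_mulr => //; exact: (below_hom hG (ltnSn c.+1)).
- have -> : n.+1 = ((a.+1 + b) + c)%N by lia.
  rewrite mulrA; apply: homog_mulr_FV => //; apply: fid_mull => //.
  exact: (below_hom hG (ltnSn a.+1)).
- by rewrite subrr; exact: (subgroup0 (sF _)).
Qed.

Lemma homogeneous_tplus n t : Tp t -> Tp (hcomp G n t).
Proof. by case: (gi_plus_subproof D) => _ _ h /h; apply. Qed.

Lemma bilift_sum n u : setadd (setmul I I) (setmul Tp (setmul I Tp)) u -> bilift n u.
Proof.
have sB := subgroup_bilift n; have hI := @homogeneous_I k S A D.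
move=> [x Ix [y Iy ->]]; apply: (subgroupD sB).
  move: x Ix; apply: setmul_sub => // x x' Ix Ix'.
  have [p -> _] := direct_sumP hG x; rewrite mulr_suml; apply: (subgroup_sum sB) => i.
  have [q -> _] := direct_sumP hG x'; rewrite mulr_sumr; apply: (subgroup_sum sB) => j.
  by apply: (@bilift_II n i j); try exact: hcomp_in; exact: hI.
move: y Iy; apply: setmul_sub => // t w Tt.
suff : setmul I Tp `<=` [set w | bilift n (t * w)] by apply.
apply: setmul_sub => [|z t' Iz Tt'] /=.
  split=> [|a b /= Ba Bb] /=; first by rewrite mulr0; exact: (subgroup0 sB).
  by rewrite mulrBr; exact: (subgroupB sB).
have [p -> _] := direct_sumP hG t; rewrite mulr_suml; apply: (subgroup_sum sB) => i.
have [q -> _] := direct_sumP hG z; rewrite mulr_suml mulr_sumr; apply: (subgroup_sum sB) => j.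
have [r -> _] := direct_sumP hG t'; rewrite !mulr_sumr; apply: (subgroup_sum sB) => l.
by apply: (@bilift_TIT n i j l); try exact: hcomp_in;
  solve [exact: hI|exact: homogeneous_tplus].
Qed.

Lemma jac_step n : jac Q n ->
  (forall x, G n.+2 x -> setmul I Tp x -> setmul Tp I x ->
     setadd (setmul I I) (setmul Tp (setmul I Tp)) x) ->
  jac Q n.+1.
Proof.
move=> J T3 z [Fz bz]; have hz : hcomp G n.+2 z = 0 by move/(belowP hG): bz; apply.
have [q [a [b [e [[Qq bq] Va Vb Fe ez]]]]] := fid_decomp Fz.
have GT v : G 1%N v -> Tp v by move=> Gv; rewrite /tplus /= (hcomp_id hG _ Gv).
have Rq := Q_top hR alpha_hom alpha_top Qq bq.
have VI : setmul (G 1%N) I (hcomp G n.+2 a).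
  suff : VF n.+1 `<=` [set a | setmul (G 1%N) I (hcomp G n.+2 a)] by apply.
  have s := subgroup_setmul (G 1%N) I; apply: setmul_sub => [|v x Gv Fx] /=.
    split=> [|c d /= hc hd] /=; first by rewrite (hcomp0 hG); exact: (subgroup0 s).
    by rewrite (hcompB hG); exact: (subgroupB s).
  rewrite (hcompMl hG GM _ _ Gv) /= subn1 /=; apply: setmul_mem => //.
  exact: (fid_top hR alpha_hom alpha_top Fx).
have IV : setmul I (G 1%N) (hcomp G n.+2 b).
  suff : FV n.+1 `<=` [set b | setmul I (G 1%N) (hcomp G n.+2 b)] by apply.
  have s := subgroup_setmul I (G 1%N); apply: setmul_sub => [|x v Fx Gv] /=.
    split=> [|c d /= hc hd] /=; first by rewrite (hcomp0 hG); exact: (subgroup0 s).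
    by rewrite (hcompB hG); exact: (subgroupB s).
  rewrite (hcompMr hG GM _ _ Gv) /= subn1 /=; apply: setmul_mem => //.
  exact: (fid_top hR alpha_hom alpha_top Fx).
have sVI := subgroup_setmul (G 1%N) I; have sIV := subgroup_setmul I (G 1%N).
have e0 : hcomp G n.+2 e = 0 by have /(belowP hG) := fid_below Fe; apply.
have sum0 : hcomp G n.+2 q + (hcomp G n.+2 a + hcomp G n.+2 b) = 0.
  by rewrite -hz ez !(hcompD hG) e0 addr0 addrA.
(* The leading form of [q] is a relation and, as those of [a] and [b] cancel it, lies in V I + I V,
   which meets [R] in 0. *)
have q0 : hcomp G n.+2 q = 0.
  apply: (relations_J hR Rq); exists (- hcomp G n.+2 a); first exact: (subgroupN sVI).
  exists (- hcomp G n.+2 b); first exact: (subgroupN sIV).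
  by rewrite -opprD; apply/eqP; rewrite -subr_eq0 opprK sum0.
have eb : hcomp G n.+2 b = - hcomp G n.+2 a.
  by apply/eqP; rewrite -subr_eq0 opprK addrC -[X in X == _]add0r -{1}q0 sum0.
have : bilift n (hcomp G n.+2 a).
  apply/bilift_sum/T3; first exact: hcomp_in.
  - have -> : hcomp G n.+2 a = - hcomp G n.+2 b by rewrite eb opprK.
    have s := subgroup_setmul I Tp; apply: (subgroupN s).
    by apply: setmulS IV => // v; exact: GT.
  - by apply: setmulS VI => // v; exact: GT.
move=> [c1 [c2 [V1 V2 Fc]]]; rewrite !(hcompK hG) eqxx => e1 e2.
have Fq : F n.+1 q.
  apply: fid_self => //; have := below_top hG bq; by rewrite q0 subr0.
have sVF := subgroup_setmul (G 1%N) (F n.+1); have sFV := subgroup_setmul (F n.+1) (G 1%N).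
have F1 : F n.+1 (a - c1).
  apply: left_syzygy => //; first exact: (subgroupB sVF).
  by rewrite (hcompB hG) e1 subrr.
have F2 : F n.+1 (b + c2).
  apply: right_syzygy => //; first exact: (subgroupD sFV).
  by rewrite (hcompD hG) e2 eb addNr.
have -> : z = q + ((a - c1) + (b + c2) + (c1 - c2)) + e.
  rewrite ez; congr (_ + _); rewrite -addrA; congr (_ + _).
  by rewrite [RHS]addrACA subrK addrK.
apply: (subgroupD (sF _)) => //; apply: (subgroupD (sF _)) => //.
by apply: (subgroupD (sF _)) => //; exact: (subgroupD (sF _)).
Qed.

End JacobiStep.

(** * PBW-deformations *)

Section LeadingForms.
Variables (B : pzRingType) (G : nat -> set B).
Hypothesis hG : direct_sum_of G.
Variables (R P : set B).

(* <R> is the space of leading forms of <P>. *)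
Definition leading_forms : Prop := forall n x, G n x ->
  (ideal_gen R x <-> exists2 y, below G n y & ideal_gen P (x - y)).

Local Notation Un n := (rpi P @` below G n).

Lemma subgroup_rpi_below n : subgroup (Un n).
Proof.
have sb := subgroup_below hG n.
split=> [|_ _ [x bx <-] [y b_y <-]].
  by exists 0; [exact: (subgroup0 sb)|exact: morphB0 (@rpiB B P)].
by exists (x - y); [exact: (subgroupB sb)|exact: rpiB].
Qed.

Lemma zpi_rpiP n x x' : zpi (Un n) (rpi P x) = zpi (Un n) (rpi P x') <->
  exists2 y, below G n y & ideal_gen P (x - x' - y).
Proof.
rewrite zpiP (zspan_id (subgroup_rpi_below n)) -rpiB; split=> [[y b_y /esym/rpiP e]|[y b_y e]].
  by exists y.
by exists y => //; apply/esym/rpiP.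
Qed.

(** That [phi] is well defined is one implication of [leading_forms], that it is injective is the
    other. Surjectivity is automatic, since an element and its top component agree modulo lower
    filtration. *)
Lemma PBW_leading_forms :
  (exists phi : forall n, rquot R -> zquot (Un n), forall n,
    (forall x, G n x -> phi n (rpi R x) = zpi (Un n) (rpi P x)) /\
    set_bij (rpi R @` G n) (zpi (Un n) @` Un n.+1) (phi n)) <-> leading_forms.
Proof.
have sG n := direct_sum_subgroup hG n; split.
  move=> [phi phiP] n x Gx; have [phiE [_ phi_inj _]] := phiP n.
  have G0 : G n 0 := subgroup0 (sG n).
  split=> [Rx|[y b_y Py]].
    have /zpi_rpiP[y b_y] : zpi (Un n) (rpi P x) = zpi (Un n) (rpi P 0).
      rewrite -!phiE //; congr (phi n _); apply/rpiP; rewrite subr0; exact: Rx.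
    by rewrite subr0; exists y.
  suff /rpiP : rpi R x = rpi R 0 by rewrite subr0.
  apply: phi_inj; rewrite ?inE; [by exists x|by exists 0|].
  rewrite !phiE //; apply/zpi_rpiP; exists y => //; by rewrite subr0.
(* [phi n] evaluates a homogeneous representative of degree [n]; the default 0 serves the classes
   that have none. *)
move=> lf; pose phi n (q : rquot R) :=
  zpi (Un n) (rpi P (xget 0 [set x | G n x /\ rpi R x = q])).
have phiE n x : G n x -> phi n (rpi R x) = zpi (Un n) (rpi P x).
  move=> Gx; rewrite /phi; case: xgetP => [x' _ [Gx' /rpiP e]|/(_ x)[]//].
  by apply/zpi_rpiP; apply/lf => //; exact: (subgroupB (sG n)).
exists phi => n; split; first exact: phiE.
split.
- move=> _ [x Gx <-]; rewrite phiE //; exists (rpi P x) => //.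
  by exists x => //; exact: (below_hom hG (ltnSn n)).
- move=> _ _ /set_mem[x Gx <-] /set_mem[y Gy <-]; rewrite !phiE // => /zpi_rpiP e.
  by apply/rpiP; apply/(lf _ _ (subgroupB (sG n) Gx Gy)).
- move=> _ [_ [x bx <-] <-]; exists (rpi R (hcomp G n x)).
    by exists (hcomp G n x) => //; exact: hcomp_in.
  rewrite phiE; last exact: hcomp_in.
  apply/zpi_rpiP; exists (hcomp G n x - x); last first.
    by rewrite subrr; exact: (subgroup0 (subgroup_ideal_gen P)).
  by rewrite -opprB; apply: (subgroupN (subgroup_below hG n)); exact: below_top.
Qed.

End LeadingForms.

(** * Homological complexity and the vanishing of Tor *)

(** [supremum] takes a default value where no supremum exists, so existence has to be shown: it is
    the maximum when [X] is bounded and +oo otherwise. *)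
Lemma supremum_int_ub (X : set nat) n : X n ->
  ((Posz n - 1)%:E <= supremum -oo [set ((Posz m - 1)%:E : \bar int) | m in X])%E.
Proof.
move=> Xn; pose Y := [set ((Posz m - 1)%:E : \bar int) | m in X].
have Yn : Y (Posz n - 1)%:E by exists n.
suff [s sup_s] : exists s, supremums Y s.
  rewrite /supremum; case: eqP => [e|_]; first by move: Yn; rewrite /Y e.
  by case: xgetP => [s' _ [ub _]|/(_ s)//]; exact: ub.
have [[b ub_b]|nb] := pselect (exists b, forall m, X m -> (m <= b)%N).
  have exX : exists m, `[< X m >] by exists n; apply/asboolP.
  have bX m : `[< X m >] -> (m <= b)%N by move=> /asboolP; exact: ub_b.
  case: (ex_maxnP exX bX) => m /asboolP Xm max_m.
  exists (Posz m - 1)%:E; split=> [_ [i Xi <-]|u]; last by apply; exists m.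
  by rewrite lee_fin; have := max_m i (asboolT Xi); lia.
exists +oo%E; split=> [_ [i Xi <-]|[r| |] ub_u]; rewrite ?leey //.
  (* A finite upper bound [r] of the numbers m - 1 would bound [X] by r + 1. *)
  case: nb; exists (absz (r + 1)) => m Xm.
  have : ((Posz m - 1)%:E <= r%:E)%E by apply: ub_u; exists m.
  by rewrite lee_fin; lia.
by have := ub_u _ Yn; rewrite leNgt ltNyr.
Qed.

Section Complexity.
Variables (k : fieldType) (S : algType k) (A : conn_sring S).

Lemma Tor_eq0_deg i m : Tor_eq0 A i -> Tor_deg_eq0 A i m.
Proof.
move=> T0 X; apply/seteqP; split=> [_ [z [cz dz] <-]|_ ->].
  by rewrite -(T0 X); exists z.
exists 0; last exact: raddf0.
split; last exact: (subgroup0 (subgroup_zspan _)).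
by case: i T0 => [//|i] _ /=; exact: (morphB0 (Stensor_mapB _)).
Qed.

(** Internal degree n + 1 contributes the value n to the supremum defining c(A). When c(A) = -1
    because Tor_3 is 0, all of its degrees vanish. *)
Lemma Tor3_above_complexity n :
  ~ ((n%:Z)%:E <= complexity A)%E -> Tor_deg_eq0 A 3 n.+1.
Proof.
move=> nc; apply: contrapT => nT; apply: nc; rewrite /complexity.
case: asboolP => [T0|_]; first by case: nT; exact: Tor_eq0_deg.
have -> : n%:Z = Posz n.+1 - 1 by lia.
exact: (@supremum_int_ub [set m | ~ Tor_deg_eq0 A 3 m] n.+1 nT).
Qed.

End Complexity.

(** * Leading forms, filtered lifts and Jacobi conditions *)

Section Deformations.
Variables (k : fieldType) (S : algType k) (A : conn_sring S) (D : tensor_model A).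
Hypothesis hS : separable S.
Local Notation G := (@tm_deg k S A D).
Local Notation I := [set x | tm_surj (x : D) = 0].
Implicit Types (x y : D) (R P Q : set D) (alpha : D -> D).
Let hG := tm_direct_sum D.

Definition filtered_lift R alpha : Prop := bimod_hom_on R alpha /\
  forall n r, R r -> G n r -> below G n.+1 (alpha r) /\ hcomp G n (alpha r) = r.

Definition top_forms P : set D :=
  zspan (\bigcup_n (hcomp G n @` (P `&` below G n.+1))).

(** The leading forms of one degree already form a subgroup once 0 is allowed, and distinct degrees
    do not interact; so a homogeneous element of the span is itself a leading form. *)
Lemma top_formsP P n r : is_subbimod P -> top_forms P r -> G n r ->
  exists2 p, (P `&` below G n.+1) p & hcomp G n p = r.
Proof.
move=> [sP _ _] tr Gr.
have sPb m : subgroup (P `&` below G m) by apply: subgroup_setI => //; exact: subgroup_below.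
suff : top_forms P `<=`
    [set r | forall n, exists2 p, (P `&` below G n.+1) p & hcomp G n p = hcomp G n r].
  by move=> /(_ r tr n)[p Pp ep]; exists p => //; rewrite ep (hcomp_same hG Gr).
apply: zspan_sub => [|_ [m _ [p Pp <-]] i].
  split=> [i|x y Px Py i]; first by exists 0 => //; exact: (subgroup0 (sPb _)).
  have [p Pp ep] := Px i; have [q Pq eq] := Py i.
  by exists (p - q); [exact: (subgroupB (sPb _))|rewrite !(hcompB hG) ep eq].
rewrite (hcompK hG); case: eqP => [->|_]; first by exists p.
by exists 0; [exact: (subgroup0 (sPb _))|rewrite (hcomp0 hG)].
Qed.

Lemma leading_forms_jacobi R P alpha : relations_of R -> filtered_lift R alpha ->
  alpha @` R `<=` P -> P `<=` ideal_gen (alpha @` R) ->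
  (forall n, jac (alpha @` R) n) -> leading_forms G R P.
Proof.
move=> hR [ah at_] aP Pa J n x Gx; rewrite (relations_gen hR).
have PQ : ideal_gen P = ideal_gen (alpha @` R).
  apply/seteqP; split; first exact: (ideal_gen_sub (ideal_genP _)).
  by apply: (ideal_gen_sub (ideal_genP _)) => y /aP; exact: sub_ideal_gen.
rewrite PQ; split=> [Ix|[y b_y /ideal_gen_fid[m Fm]]].
  have [y Fy ey] := fid_lift hR at_ n Ix; exists (x - y).
    rewrite (hcomp_same hG Gx) in ey; rewrite -[x in x - y]ey -opprB.
    apply: (subgroupN (subgroup_below hG n)); apply: (below_top hG).
    exact: fid_below Fy.
  by rewrite opprB addrC subrK; apply/ideal_gen_fid; exists n.
have bxy : below G n.+1 (x - y).
  apply: (subgroupB (subgroup_below hG _)); first exact: (below_hom hG (ltnSn n)).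
  exact: below_le b_y.
have := fid_top hR ah at_ (jac_all J Fm bxy).
rewrite (hcompB hG) (hcomp_same hG Gx); move/(belowP hG): b_y => -> //.
by rewrite subr0.
Qed.

Lemma filtered_lift_exists R P : relations_of R -> is_subbimod P -> R `<=` top_forms P ->
  exists2 alpha, filtered_lift R alpha & alpha @` R `<=` P.
Proof.
move=> hR bP RP; have bG := tm_subbimod D; have [sP _ _] := bP.
have /choice[g gP] : forall n, exists g : D -> D, [/\ bimod_hom g,
    forall y, (P `&` below G n.+1) (g y)
    & forall x, (P `&` below G n.+1) x -> hcomp G n (g (hcomp G n x)) = hcomp G n x].
  move=> n; exact: (bimod_section hS (hcomp_hom hG bG n)
    (is_subbimod_setI bP (is_subbimod_below hG bG n.+1))).
have gD n x y : g n (x + y) = g n x + g n y by have [[h _ _] _ _] := gP n; exact: h.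
have gl n s x : g n (s *> x) = s *> g n x by have [[_ h _] _ _] := gP n; exact: h.
have gr n s x : g n (x <* s) = g n x <* s by have [[_ _ h] _ _] := gP n; exact: h.
have gin n y : (P `&` below G n.+1) (g n y) by have [_ h _] := gP n; exact: h.
have gB n : {morph g n : x y / x - y} by apply: morphDB => x y; exact: gD.
have g0 n : g n 0 = 0 by exact: morphB0 (gB n).
(* The splittings in the single degrees are added up. The truncation at [m] does not affect the
   value once [m] bounds the degree, so any bound may be chosen to define [alpha] on all of T. *)
pose al m x := \sum_(i < m) g i (hcomp G i x).
have alE m m' x : (m <= m')%N -> below G m x -> al m' x = al m x.
  move=> mm' /(belowP hG) bx; rewrite /al (sum_widen (fun i => g i (hcomp G i x)) mm').
  by apply: eq_bigr => i _; case: ltnP => // /bx ->; exact: g0.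
pose alpha x := al (sval (cid (below_ex hG x))) x.
have alphaE m x : below G m x -> alpha x = al m x.
  move=> bm; rewrite /alpha; case: cid => n /= bn.
  by rewrite -(alE n (maxn m n)) ?leq_maxr // (alE m) ?leq_maxl.
exists alpha; last first.
  move=> _ [r Rr <-]; have [m br] := below_ex hG r; rewrite (alphaE m) //.
  by apply: (subgroup_sum sP) => i; case: (gin i (hcomp G i r)).
split; first split=> [x y _ _|s x _|s x _].
- have [m bx] := below_ex hG x; have [n b_y] := below_ex hG y.
  have bx' := below_le hG (leq_maxl m n) bx; have by' := below_le hG (leq_maxr m n) b_y.
  rewrite !(alphaE (maxn m n)) //; last exact: (subgroupD (subgroup_below hG _)).
  by rewrite /al -big_split; apply: eq_bigr => i _; rewrite /= (hcompD hG) gD.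
- have [m bx] := below_ex hG x; have [_ bl _] := is_subbimod_below hG bG m.
  rewrite !(alphaE m) //; last exact: bl.
  rewrite /al (big_morph _ (lactDr s) (morphB0 (lactB s))).
  by apply: eq_bigr => i _; rewrite (hcomp_lact hG bG) gl.
- have [m bx] := below_ex hG x; have [_ _ br] := is_subbimod_below hG bG m.
  rewrite !(alphaE m) //; last exact: br.
  rewrite /al (big_morph _ (ractDl s) (morphB0 (ractB s))).
  by apply: eq_bigr => i _; rewrite (hcomp_ract hG bG) gr.
move=> n r Rr Gr; have -> : alpha r = g n r.
  rewrite (alphaE _ _ (below_hom hG (ltnSn n) Gr)) /al big_ord_recr /= (hcomp_same hG Gr).
  rewrite big1 ?add0r // => i _; rewrite (hcomp_id hG _ Gr) ltn_eqF ?g0 //.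
split; first by case: (gin n r).
have [p Pp ep] := top_formsP bP (RP r Rr) Gr.
by rewrite -{1}ep; have [_ _ ->] := gP n.
Qed.

Section PBWDeformation.
Variables (R P : set D).
Hypotheses (hR : relations_of R) (bP : is_subbimod P) (RP : R `<=` top_forms P)
  (lf : leading_forms G R P).

Lemma ideal_gen_top_forms : ideal_gen R = ideal_gen (top_forms P).
Proof.
apply/seteqP; split; apply: (ideal_gen_sub (ideal_genP _)).
  by move=> x /RP; exact: sub_ideal_gen.
apply: zspan_sub => [|_ [n _ [p [Pp bp] <-]]]; first exact: subgroup_ideal_gen.
have [_ lead] := lf (hcomp_in hG n p); apply: lead; exists (hcomp G n p - p).
  by rewrite -opprB; apply: (subgroupN (subgroup_below hG n)); exact: below_top.
by rewrite subKr; exact: sub_ideal_gen.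
Qed.

(** The leading form of [x] lies in I and lifts to F; subtracting the lift lowers the degree and
    stays in <P>. The bound [below G n] means degree at most [n.-1], and for n = 0 it leaves only x
    = 0. *)
Lemma leading_forms_fid alpha n x : filtered_lift R alpha -> alpha @` R `<=` P ->
  ideal_gen P x -> below G n x -> fid (alpha @` R) n.-1 x.
Proof.
move=> [ah at_] aP; have sP := subgroup_ideal_gen P.
elim: n x => [|n IHn] x Px bx.
  by rewrite (below_sum hG bx) big_ord0; exact: (subgroup0 (subgroup_fid _ _)).
have Ih : I (hcomp G n x).
  rewrite -[I](relations_gen hR); have [_ lead] := lf (hcomp_in hG n x); apply: lead.
  exists (hcomp G n x - x); last by rewrite subKr.
  by rewrite -opprB; apply: (subgroupN (subgroup_below hG n)); exact: below_top.
have [y Fy ey] := fid_lift hR at_ n Ih; rewrite (hcompK hG) eqxx in ey.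
have Py : ideal_gen P y.
  have /ideal_gen_fid : exists n, fid (alpha @` R) n y by exists n.
  by apply: (ideal_gen_sub (ideal_genP _)) => z /aP; exact: sub_ideal_gen.
rewrite -[x](subrK y); apply: (subgroupD (subgroup_fid _ n)) => //.
apply: (fid_mono (m := n.-1)); first exact: leq_pred.
apply: IHn; first exact: (subgroupB sP).
have b2 : below G n.+1 (x - y).
  by apply: (subgroupB (subgroup_below hG _)) => //; exact: fid_below Fy.
by have := below_top hG b2; rewrite (hcompB hG) ey subrr subr0.
Qed.

Lemma leading_forms_lift : exists alpha, [/\ filtered_lift R alpha, alpha @` R `<=` P,
  P `<=` ideal_gen (alpha @` R) & forall n, jac (alpha @` R) n].
Proof.
have [alpha fa aP] := filtered_lift_exists hR bP RP; exists alpha; split=> //.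
  move=> x Px; have [n bx] := below_ex hG x; apply/ideal_gen_fid; exists n.-1.
  by apply: leading_forms_fid => //; exact: sub_ideal_gen.
move=> n x [Fx bx]; apply: (leading_forms_fid (n := n.+1)) => //.
have /ideal_gen_fid : exists n, fid (alpha @` R) n x by exists n.+1.
by apply: (ideal_gen_sub (ideal_genP _)) => z /aP; exact: sub_ideal_gen.
Qed.

End PBWDeformation.

(** Up to c(A) the conditions are given, and beyond it the step applies. If c(A) = -1, every
    condition from (J_1) on is obtained by the step. *)
Lemma jac_complexity R alpha : relations_of R -> filtered_lift R alpha ->
  (complexity A = (-1)%:E \/
   forall n, (1 <= n)%N -> ((n%:Z)%:E <= complexity A)%E -> jac (alpha @` R) n) ->
  forall n, jac (alpha @` R) n.
Proof.
move=> hR [ah at_] hc; elim=> [|n IHn]; first exact: (jac0 hR ah at_).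
have step : ~ ((n.+1%:Z)%:E <= complexity A)%E -> jac (alpha @` R) n.+1.
  move=> /Tor3_above_complexity T0; apply: (jac_step hS hR ah at_ IHn) => x Gx.
  exact: (Tor3_vanishing hS T0 Gx).
have [le|nle] := pselect ((n.+1%:Z)%:E <= complexity A)%E; last exact: step.
case: hc => [c1|]; last exact.
by move: le; rewrite c1 lee_fin; lia.
Qed.

Theorem leading_forms_iff R P : relations_of R -> is_subbimod P -> R `<=` top_forms P ->
  (leading_forms G R P <->
   (ideal_gen R = ideal_gen (top_forms P) /\
    exists alpha, [/\ filtered_lift R alpha, alpha @` R `<=` P,
      P `<=` ideal_gen (alpha @` R)
      & complexity A = (-1)%:E \/ forall n, (1 <= n)%N ->
          ((n%:Z)%:E <= complexity A)%E -> jac (alpha @` R) n])).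
Proof.
move=> hR bP RP; split=> [lf|[_ [alpha [fa aP Pa hc]]]].
  split; first exact: (ideal_gen_top_forms RP lf).
  have [alpha [fa aP Pa J]] := leading_forms_lift hR bP RP lf.
  by exists alpha; split=> //; right=> n _ _; exact: J.
exact: (leading_forms_jacobi hR fa aP Pa (jac_complexity hR fa hc)).
Qed.

End Deformations.

Theorem theorem5p23 (k : fieldType) (S : algType k) (hS : separable S)
    (A : conn_sring S) (hA : strongly_graded A) :
  (exists R : set (T A), bimodule_of_relations R) /\
  (forall R P : set (T A),
    bimodule_of_relations R -> is_subbimod P -> R `<=` R_ P ->
    (PBW_deformation R P <->
     (ideal_gen R = ideal_gen (R_ P) /\
      exists alpha : T A -> T A,
        [/\ filtered_morphism R alpha,
            alpha @` R `<=` P,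
            P `<=` ideal_gen (alpha @` R)
          & complexity A = (-1)%:E \/
            forall n : nat, (1 <= n)%N -> ((n%:Z)%:E <= complexity A)%E ->
              Jacobi (alpha @` R) n]))).
Proof.
pose D := tensor_algebra_model hA; split; first exact: (relations_exist D hS).
move=> R P hR bP RP.
apply: iff_trans (PBW_leading_forms (tm_direct_sum D) R P) _.
(* In the model [D] the notions stated for an arbitrary model are convertible to those of the
   theorem. *)
exact: (@leading_forms_iff k S A D hS R P hR bP RP).
Qed.
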